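(* Let $m\geq1$ be an integer. For any real $\mu>0$, the Fock–Bargmann–Hartogs domain $\left(D_{1,m}(\mu),\omega\left(\mu;-\frac{1}{m+1}\right)\right)$ is strongly not relative to any projective Kähler manifold; that is, for every real constant $c>0$, the Kähler manifold $\left(D_{1,m}(\mu),c\,\omega\left(\mu;-\frac{1}{m+1}\right)\right)$ is not relative to any projective Kähler manifold.
   Context: Fock–Bargmann–Hartogs domains. For real $\mu>0$ and positive integers $n,m$, $$D_{n,m}(\mu)=\{(z,w)\in\mathbb{C}^{n}\times\mathbb{C}^m : \|w\|^2<e^{-\mu\|z\|^2}\},$$ with $\|\cdot\|$ the standard Hermitian norm. For $\nu>-1$, $\omega(\mu;\nu)$ denotes the Kähler metric (identified with its Kähler form) on $D_{n,m}(\mu)$ given by the global Kähler potential $\Phi(z,w)=\nu\mu\|z\|^2-\log\bigl(e^{-\mu\|z\|^2}-\|w\|^2\bigr)$, i.e. $\omega(\mu;\nu)=\frac i2\partial\bar\partial\Phi$. Two Kähler manifolds are relatives (one is relative to the other) if they share a common Kähler submanifold of positive dimension, i.e. a complex submanifold of one of them, with the induced metric, is biholomorphically isometric to a complex submanifold of the other one, with the induced metric. A projective Kähler manifold is a Kähler manifold which admits a local holomorphic and isometric immersion into some finite dimensional complex projective space $\mathbb{C}\mathrm{P}^n$ with the Fubini–Study metric $g_{FS}$, whose Kähler form is $\frac i2\partial\bar\partial\log\bigl(1+\sum_{j=1}^n|z_j|^2\bigr)$ in affine coordinates. *)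

(* Defs.v *)
From HB Require Import structures.
From mathcomp Require Import all_boot all_order all_algebra.
From mathcomp Require Import all_classical all_reals all_analysis.
From mathcomp Require Import complex.

Set Implicit Arguments.
Unset Strict Implicit.
Unset Printing Implicit Defensive.

Import Order.TTheory GRing.Theory Num.Theory.
Import numFieldNormedType.Exports.

Local Open Scope classical_set_scope.
Local Open Scope ring_scope.
Local Open Scope quotient_scope.
Local Open Scope complex_scope.

(* Typing R[i] as a numClosedFieldType is what gives 'rV[Cplx R]_n its topology
   and its structure of normed space over the complex numbers; hence
   [differentiable] and [jacobian] below are the complex (C-linear) ones. *)
Definition Cplx (R : realType) : numClosedFieldType := R[i].

Section EuclideanCalculus.
Context {R : realType}.
Local Notation C := (Cplx R).

Definition sqnorm n (v : 'rV[C]_n) : R :=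
  \sum_(j < n) (complex.Re (v 0 j) ^+ 2 + complex.Im (v 0 j) ^+ 2).

Definition adjmx m n (A : 'M[C]_(m, n)) : 'M[C]_(n, m) := map_mx Num.conj A^T.

Definition posdefmx n (A : 'M[C]_n) :=
  adjmx A = A /\ forall v : 'rV[C]_n, v != 0 -> 0 < (v *m A *m adjmx v) 0 0.

(* Restriction of f to the real line through z directed by v *)
Definition along n (f : 'rV[C]_n -> C) (v z : 'rV[C]_n) (t : R) : C :=
  f (z + (t%:C : C) *: v).

Definition rderivable n (f : 'rV[C]_n -> C) (v z : 'rV[C]_n) :=
  derivable (fun t : R => complex.Re (along f v z t)) 0 1 /\
  derivable (fun t : R => complex.Im (along f v z t)) 0 1.

Definition rderiv n (v : 'rV[C]_n) (f : 'rV[C]_n -> C) (z : 'rV[C]_n) : C :=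
  derive1 (fun t : R => complex.Re (along f v z t)) 0 +i*
  derive1 (fun t : R => complex.Im (along f v z t)) 0.

(* Class C^k in the real sense; U is meant to be open. *)
Fixpoint Ck_on (k : nat) n (U : set 'rV[C]_n) (f : 'rV[C]_n -> C) : Prop :=
  if k is k'.+1 then
    forall v, (forall z, U z -> rderivable f v z) /\ Ck_on k' U (rderiv v f)
  else forall z, U z -> {for z, continuous f}.

Definition smooth_on n (U : set 'rV[C]_n) (f : 'rV[C]_n -> C) :=
  forall k, Ck_on k U f.

(* The Wirtinger operators d/dz_j and d/d(conj z_j) *)
Definition dz n (j : 'I_n) (f : 'rV[C]_n -> C) (z : 'rV[C]_n) : C :=
  (rderiv (delta_mx 0 j) f z
     - ('i : C) * rderiv (('i : C) *: delta_mx 0 j) f z) / 2.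

Definition dzbar n (j : 'I_n) (f : 'rV[C]_n -> C) (z : 'rV[C]_n) : C :=
  (rderiv (delta_mx 0 j) f z
     + ('i : C) * rderiv (('i : C) *: delta_mx 0 j) f z) / 2.

Definition complex_hessian n (Phi : 'rV[C]_n -> R) (z : 'rV[C]_n) : 'M[C]_n :=
  \matrix_(j, k) dz j (dzbar k (fun x => ((Phi x)%:C : C))) z.

End EuclideanCalculus.

(* The raw data of a manifold with an atlas and a Hermitian metric; the axioms
   are in [complex_manifold] and [kahler].  [chart_inv i] is the inverse of
   [chart_map i] and matters only on [chart_map i @` chart_dom i]; [metric i] is
   the matrix (h_ab) in these coordinates, which encodes the form
   (i/2) \sum_(a, b) h_ab dz_a /\ d(conj z_b).  A Kahler potential Phi, i.e.
   the form (i/2) d dbar Phi, is thus encoded by [complex_hessian Phi]. *)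
Record hermitian_space (R : realType) := HermitianSpace {
  carrier :> topologicalType;
  cdim : nat;
  chart_index : Type;
  chart_dom : chart_index -> set carrier;
  chart_map : chart_index -> carrier -> 'rV[Cplx R]_cdim;
  chart_inv : chart_index -> 'rV[Cplx R]_cdim -> carrier;
  metric : chart_index -> 'rV[Cplx R]_cdim -> 'M[Cplx R]_cdim
}.

Arguments cdim {R} _.
Arguments chart_index {R} _.
Arguments chart_dom {R _} i _ : rename.
Arguments chart_map {R _} i _ : rename.
Arguments chart_inv {R _} i _ : rename.
Arguments metric {R _} i _ : rename.

Section KahlerManifolds.
Context {R : realType}.
Implicit Types M N S P : hermitian_space R.

Definition is_chart M (i : chart_index M) :=
  [/\ open (chart_dom i),
      open (chart_map i @` chart_dom i),
      (forall p, chart_dom i p -> chart_inv i (chart_map i p) = p),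
      (forall p, chart_dom i p -> {for p, continuous (chart_map i)}) &
      (forall p, chart_dom i p -> {for chart_map i p, continuous (chart_inv i)})].

Definition local_expr M N (f : M -> N) (i : chart_index M) (j : chart_index N) :
    'rV[Cplx R]_(cdim M) -> 'rV[Cplx R]_(cdim N) :=
  fun z => chart_map j (f (chart_inv i z)).

Definition complex_manifold M :=
  [/\ hausdorff_space M,
      @second_countable M,
      (forall p : M, exists i : chart_index M, chart_dom i p),
      (forall i : chart_index M, is_chart i) &
      (forall (i j : chart_index M) (p : M), chart_dom i p -> chart_dom j p ->
         differentiable (local_expr (@id M) i j) (chart_map i p))].

Definition holomorphic_on M N (U : set M) (f : M -> N) :=
  forall p, U p -> {for p, continuous f} /\
    forall i j, chart_dom i p -> chart_dom j (f p) ->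
      differentiable (local_expr f i j) (chart_map i p).

Definition immersion_on M N (U : set M) (f : M -> N) :=
  forall p, U p -> forall i j, chart_dom i p -> chart_dom j (f p) ->
    row_free (jacobian (local_expr f i j) (chart_map i p)).

(* MathComp's jacobian J acts on row vectors: df(v) = v *m J. *)
Definition pullback_metric M N (f : M -> N) (i : chart_index M)
    (j : chart_index N) (z : 'rV[Cplx R]_(cdim M)) : 'M[Cplx R]_(cdim M) :=
  jacobian (local_expr f i j) z *m metric j (local_expr f i j z)
    *m adjmx (jacobian (local_expr f i j) z).

Definition isometric_on M N (U : set M) (f : M -> N) :=
  forall p, U p -> forall i j, chart_dom i p -> chart_dom j (f p) ->
    metric i (chart_map i p) = pullback_metric f i j (chart_map i p).

(* In the last clause, dz l h_ab = dz a h_lb says that the form is closed: this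
   is the vanishing of its (2,1) part, and the (1,2) part is the conjugate. *)
Definition kahler M :=
  [/\ complex_manifold M,
      isometric_on setT (@id M),
      (forall (i : chart_index M) p, chart_dom i p ->
         posdefmx (metric i (chart_map i p))),
      (forall (i : chart_index M) a b,
         smooth_on (chart_map i @` chart_dom i) (fun z => metric i z a b)) &
      (forall (i : chart_index M) a b l p, chart_dom i p ->
         dz l (fun z => metric i z a b) (chart_map i p) =
         dz a (fun z => metric i z l b) (chart_map i p))].

Definition embedding M N (f : M -> N) :=
  injective f /\ forall U : set M, open U ->
    exists2 V : set N, open V & U = f @^-1` V.

(* A complex submanifold with its induced metric, given by its inclusion map *)
Definition kahler_submanifold S M (f : S -> M) :=
  [/\ kahler S, embedding f, holomorphic_on setT f, immersion_on setT f &
      isometric_on setT f].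

Definition biholomorphic_isometry M N (F : M -> N) :=
  exists G : N -> M,
    [/\ cancel F G, cancel G F, holomorphic_on setT F, holomorphic_on setT G &
        isometric_on setT F].

Definition relatives M N :=
  exists (S1 S2 : hermitian_space R) (f : S1 -> M) (g : S2 -> N) (F : S1 -> S2),
    [/\ kahler_submanifold f, kahler_submanifold g,
        [set: S1] !=set0, (0 < cdim S1)%N & biholomorphic_isometry F].

Definition scale_metric (c : R) M : hermitian_space R :=
  @HermitianSpace R M (cdim M) (chart_index M) (@chart_dom R M) (@chart_map R M)
    (@chart_inv R M) (fun i z => (c%:C : Cplx R) *: metric i z).

Definition strongly_not_relative M N :=
  forall c : R, 0 < c -> ~ relatives (scale_metric c M) N.

End KahlerManifolds.

Section ProjectiveSpace.
Context {R : realType}.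
Local Notation C := (Cplx R).
Variable N : nat.

Definition nonzero_vectors : set 'rV[C]_N.+1 := [set v | v != 0].

Definition same_line (u v : nonzero_vectors) : bool :=
  (set_val u == set_val v)%MS.

Fact same_line_refl : reflexive same_line.
Proof. by move=> u; rewrite /same_line !submx_refl. Qed.

Fact same_line_sym : symmetric same_line.
Proof. by move=> u v; rewrite /same_line andbC. Qed.

Fact same_line_trans : transitive same_line.
Proof.
move=> v u w /andP[uv vu] /andP[vw wv].
by apply/andP; split; [exact: submx_trans vw|exact: submx_trans vu].
Qed.

Canonical same_line_equiv :=
  EquivRel same_line same_line_refl same_line_sym same_line_trans.

Definition CP_quot := {eq_quot same_line}.
Definition CP_space : topologicalType := quotient_topology CP_quot.

Definition homogeneous (x : CP_space) : 'rV[C]_N.+1 :=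
  set_val (repr (x : CP_quot)).

Definition affine_lift (k : 'I_N.+1) (z : 'rV[C]_N) : 'rV[C]_N.+1 :=
  \row_i (if unlift k i is Some j then z 0 j else 1).

Fact affine_lift_nonzero k z : affine_lift k z \in nonzero_vectors.
Proof.
apply/mem_set/eqP => /rowP/(_ k).
by rewrite !mxE unlift_none => /eqP; rewrite oner_eq0.
Qed.

(* The k-th chart is [v] |-> (v_j / v_k)_(j != k), on the set where v_k != 0. *)
Definition CP : hermitian_space R :=
  @HermitianSpace R CP_space N 'I_N.+1
    (fun k => [set x | homogeneous x 0 k != 0])
    (fun k x => \row_j (homogeneous x 0 (lift k j) / homogeneous x 0 k))
    (fun k z => \pi_CP_quot (exist _ (affine_lift k z) (affine_lift_nonzero k z)))
    (fun _ => complex_hessian (fun z : 'rV[C]_N => ln (1 + sqnorm z))).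

End ProjectiveSpace.

Arguments CP {R} N.

Definition projective_kahler (R : realType) (P : hermitian_space R) :=
  kahler P /\
  exists N : nat, forall p : P, exists (U : set P) (f : P -> CP N),
    [/\ open U, U p, holomorphic_on U f, immersion_on U f & isometric_on U f].

Section FockBargmannHartogs.
Context {R : realType}.
Local Notation C := (Cplx R).
Variables (n m : nat) (mu nu : R).

(* A point (z, w) of C^n x C^m is a row vector of size n + m. *)
Definition FBH_domain : set 'rV[C]_(n + m) :=
  [set p | sqnorm (rsubmx p) < expR (- mu * sqnorm (lsubmx p))].

Definition FBH_potential (p : 'rV[C]_(n + m)) : R :=
  nu * mu * sqnorm (lsubmx p)
    - ln (expR (- mu * sqnorm (lsubmx p)) - sqnorm (rsubmx p)).

Fact FBH_origin_subproof : 0 \in FBH_domain.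
Proof.
have sq0 k : sqnorm (0 : 'rV[C]_k) = 0.
  by apply: big1 => j _; rewrite mxE /= expr0n addr0.
by apply/mem_set; rewrite /FBH_domain /= !linear0 !sq0 mulr0 expR0 ltr01.
Qed.

(* Outside the domain, the inverse of the global chart takes a dummy value. *)
Definition FBH : hermitian_space R :=
  @HermitianSpace R FBH_domain (n + m) unit
    (fun _ => setT)
    (fun _ => set_val)
    (fun _ => insubd (exist _ 0 FBH_origin_subproof : FBH_domain))
    (fun _ => complex_hessian FBH_potential).

End FockBargmannHartogs.

(* Main.v *)
Require Import Defs.
From HB Require Import structures.
From mathcomp Require Import all_boot all_order all_algebra.
From mathcomp Require Import all_classical all_reals all_analysis.
From mathcomp Require Import complex ring lra.

Set Implicit Arguments.
Unset Strict Implicit.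
Unset Printing Implicit Defensive.

Import Order.TTheory GRing.Theory Num.Theory.
Import numFieldNormedType.Exports.

Local Open Scope classical_set_scope.
Local Open Scope ring_scope.

(** Suppose that a complex line in a chart of a common submanifold is mapped
    isometrically, by holomorphic curves, both into the scaled domain and into
    an affine chart of a projective space: g = (z, w) near g(0), with velocity
    g', and F with velocity F'.  Then c times the potential Phi of the domain
    along g and log(1 + |F|^2) have the same mixed second derivative, so that
    they differ by the real part of a holomorphic function.  It follows that
    g' vanishes at the origin, so that no immersion can produce g.

    Put zeta = z - z(0), twist w into w~ by a nonvanishing holomorphic factor
    so that e^(mu |z|^2) |w|^2 = e^(mu |zeta|^2) |w~|^2, and let W = w~(0),
    beta = 1 - |W|^2, D = 1 - <w~, W>.  An identity of the unit ball gives
    1 - e^(mu |zeta|^2) |w~|^2 = |D|^2 / beta * (1 - Y) with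
      Y = beta |(w~ - W) / D|^2 + |<w~ - W, W> / D|^2
          + beta (e^(mu |zeta|^2) - 1) |w~ / D|^2.
    Hence c Phi is, up to the real part of a holomorphic function,
      S = c (nu + 1) mu |zeta|^2 - c log(1 - Y).
    This is Calabi's diastasis, and both terms are sums of squared moduli of
    holomorphic functions vanishing at the origin, because -log(1 - Y) has
    nonnegative Taylor coefficients, nu > -1 and c > 0.

    If g'(0) is not zero, one of these squares is |u|^2 with u'(0) not zero:
    u is a multiple of a coordinate of zeta, or of (w~ - W) / D.  Then exp S
    contains all the squares |u^k|^2 / k!, so the matrix of its Taylor
    coefficients has infinite rank.  On the other hand, exp S equals
    |e^h|^2 (1 + |F|^2) for some holomorphic h: its rank is at most
    N + 1, where N is the dimension of the projective space.

    The comparison is made on Taylor jets, with sums of squares of polynomials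
    up to O(|t|^M).  [no_finite_rank] is the obstruction on exp S,
    [exp_rank_bound] the bound on its rank, [no_common_curve] brings them
    together, and [iso_curve] produces the curves from the manifolds.

    Holomorphic germs are handled through Wirtinger derivatives; the Taylor
    expansions come from Cauchy's formula, proved for complex-differentiable
    functions with bounded derivative by differentiating under the integral
    sign along a homotopy of circles.  The bound on the derivatives of g and F
    is itself a consequence of the isometry: the common metric is bounded near
    the origin, and it controls the velocity in both targets. *)

(** * Integrals of periodic functions over a period *)

Section RealIntegral.
Context {R : realType}.
Local Notation mu := (@lebesgue_measure R).

Definition cycle_int (f : R -> R) : R := \int[mu]_(t in `[0, pi *+ 2]) f t.

Lemma itv_integrable (f : R -> R) (a b : R) :
  continuous f -> mu.-integrable `[a, b] (EFin \o f).
Proof.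
move=> cf; apply: continuous_compact_integrable; first exact: segment_compact.
exact: continuous_subspaceT.
Qed.

(** The integral over a period does not depend on its starting point: by the
    fundamental theorem of calculus, its derivative in d is f (2 pi + d) - f
    d. *)
Lemma cycle_int_translate_cst (f : R -> R) :
  continuous f -> (forall x, f (x + pi *+ 2) = f x) ->
  is_derive (0 : R) 1 (fun d => cycle_int (fun t => f (t + d))) 0.
Proof.
move=> cf pf; have pi0 := @pi_gt0 R.
pose A x : R := \int[mu]_(t in `[(- 2), x]) f t.
have dA (x : R) : -2 < x -> is_derive x 1 A (f x).
  move=> x2; have xx1 : x < x + 1 by rewrite ltrDl.
  have [|||d e] := @continuous_FTC1_closed R f (-2) x (x + 1) xx1.

  - exact: itv_integrable.
  - exact: x2.
  - exact: cf.
  - by apply: DeriveDef; [exact: d|rewrite -derive1E].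
have E (d : R) : -1 < d -> cycle_int (fun t => f (t + d)) = A (pi *+ 2 + d) - A d.
  move=> d1; rewrite /cycle_int /Rintegral.
  have dF (x : R) : 0 <= x -> is_derive x 1 (fun t => A (t + d)) (f (x + d)).
    move=> x0; have h : is_derive (x + d) 1 A (f (x + d)) by apply: dA; lra.
    have := @is_derive1_comp R A (fun t => t + d) x _ _ h.
    rewrite /comp.
    move=> /(_ 1); rewrite mulr1; apply.
    rewrite -[X in is_derive _ _ _ X]addr0.
    by apply: is_deriveD.
  rewrite (@continuous_FTC2 R _ (fun t => A (t + d)) 0 (pi *+ 2)) /=.
  - by rewrite add0r.
  - by rewrite pmulrn_lgt0.
  - apply: continuous_subspaceT => x; apply: continuous_comp; last exact: cf.
    by apply: cvgD; [exact: cvg_id|exact: cvg_cst].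
  - have c x : 0 <= x -> {for x, continuous (fun t => A (t + d))}.
      move=> /dF h; apply: differentiable_continuous.
      by apply/derivable1_diffP; case: h.
    split.
    + by move=> x /andP[x0 _]; case: (dF x (ltW x0)).
    + exact/cvg_at_right_filter/c.
    + by apply/cvg_at_left_filter/c; rewrite pmulrn_lge0// ltW.
  - move=> x; rewrite in_itv /= => /andP[x0 _].
    by have [_ h] := dF x (ltW x0); rewrite derive1E.
have d0 : is_derive (0:R) 1 (fun d => A (pi *+ 2 + d) - A d) 0.
  rewrite [X in is_derive _ _ _ X](_ : 0 = f (pi *+ 2 + 0) - f 0); last first.
    by rewrite addr0 -[pi *+ 2]add0r pf subrr.
  apply: is_deriveB; last by apply: dA; lra.
  have h : is_derive (pi *+ 2 + 0) 1 A (f (pi *+ 2 + 0)).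
    by apply: dA; rewrite addr0 mulr2n; lra.
  have := @is_derive1_comp R A (fun t => pi *+ 2 + t) 0 _ _ h.
  rewrite /comp.
  move=> /(_ 1); rewrite mulr1; apply.
  rewrite -[X in is_derive _ _ _ X]add0r.
  by apply: is_deriveD.
apply: near_eq_is_derive d0.
near=> x; apply/esym/E; near: x.
apply: lt_nbhsr; lra.
Unshelve. all: by end_near. Qed.

(** Differentiate under the integral sign the integral of T (t + d), which is
    constant in d. The derivative T' is assumed bounded, not continuous, and
    this is why the fundamental theorem of calculus is not applied to T'
    itself. *)
Lemma cycle_int_periodic_derivative (T T' : R -> R) (B : R) :
  (forall x : R, is_derive x 1 T (T' x)) -> (forall x, T (x + pi *+ 2) = T x) ->
  (forall x, `|T' x| <= B) -> cycle_int T' = 0.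
Proof.
move=> dT pT bT.
have cT : continuous T.
  by move=> x; apply: differentiable_continuous; apply/derivable1_diffP; case: (dT x).
have dTs (x y : R) : is_derive x 1 (fun d => T (y + d)) (T' (y + x)).
  have h := dT (y + x).
  have := @is_derive1_comp R T (fun d => y + d) x _ _ h.
  rewrite /comp => /(_ 1); rewrite mulr1; apply.
  rewrite -[X in is_derive _ _ _ X]add0r.
  by apply: is_deriveD.
have d1 (x y : R) : derive1 (fun d => T (y + d)) x = T' (y + x).
  by have [_ h] := dTs x y; rewrite derive1E.
have := @differentiation_under_integral R _ _ mu (fun d t => T (t + d))
  `[0, pi *+ 2] _ 0 (-1) 1 _ _ _ (fun _ => B).
rewrite /partial1of2.
under [X in _ -> _ -> _ -> _ -> _ = X]eq_Rintegral do rewrite d1 addr0.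
rewrite -/(cycle_int _) => <- //=.
- have [_] := cycle_int_translate_cst cT pT.
  by rewrite -derive1E.
- by rewrite in_itv /= ltrN10 ltr01.
- move=> x _; apply: itv_integrable => y; apply: continuous_comp; last exact: cT.
  by apply: cvgD; [exact: cvg_id|exact: cvg_cst].
- by move=> _; exact: le_trans (normr_ge0 _) (bT 0).
- by apply: (@itv_integrable (fun=> B)); exact: cst_continuous.
- by move=> x y _ _; rewrite d1.
Qed.

(** This is the real form of Cauchy's theorem: the s-derivative of the
    integrand is also the t-derivative of a periodic function T, so that the
    integral of V s has derivative zero in s. *)
Lemma cycle_int_homotopy (V T V' : R -> R -> R) (u v B : R) :
  (forall s t : R, u < s < v -> is_derive s 1 (V ^~ t) (V' s t)) ->
  (forall s t : R, u < s < v -> is_derive t 1 (T s) (V' s t)) ->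
  (forall s, u < s < v -> continuous (V s)) ->
  (forall s t, u < s < v -> T s (t + pi *+ 2) = T s t) ->
  (forall s t, u < s < v -> `|V' s t| <= B) ->
  forall a b, u < a -> a < b -> b < v -> cycle_int (V a) = cycle_int (V b).
Proof.
move=> dV dT cV pT bV a b ua ab bv.
have uv : u < v by apply: lt_trans bv; exact: lt_trans ab.
have d0 (s : R) : u < s < v -> is_derive s 1 (fun s => cycle_int (V s)) 0.
  move=> us.
  have d1 (x y : R) : u < x < v -> derive1 (V ^~ y) x = V' x y.
    by move=> xuv; have [_ h'] := dV x y xuv; rewrite derive1E.
  have A1 : s \in `]u, v[ by rewrite in_itv.
  have A2 x : `]u, v[%classic x -> mu.-integrable `[0, pi *+ 2] (EFin \o V x).
    by rewrite /= in_itv /= => xuv; apply: itv_integrable; exact: cV.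
  have A3 x y : `]u, v[%classic x -> `[0, pi *+ 2]%classic y -> derivable (V ^~ y) x 1.
    by rewrite /= in_itv /= => xuv _; case: (dV x y xuv).
  have A4 (y : R) : 0 <= B.
    by apply: le_trans (normr_ge0 _) (bV ((u + v) / 2) 0 _); rewrite !midf_lt.
  have A5 : mu.-integrable `[0, pi *+ 2] (EFin \o fun _ : R => B).
    by apply: (@itv_integrable (fun=> B)); exact: cst_continuous.
  have A6 x y : `]u, v[%classic x -> `[0, pi *+ 2]%classic y ->
      `|derive1 (V ^~ y) x| <= B.
    by rewrite /= in_itv /= => xuv _; rewrite d1// bV.
  apply: DeriveDef.
    exact: (@derivable_under_integral R _ _ mu V `[0, pi *+ 2] _ s u v A1 A2 A3 (fun _ => B)).
  rewrite -derive1E.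
  rewrite (@differentiation_under_integral R _ _ mu V `[0, pi *+ 2] _ s u v A1 A2 A3 (fun _ => B))//.
  under eq_Rintegral do rewrite /partial1of2 d1//.
  rewrite -/(cycle_int _).
  by apply: (@cycle_int_periodic_derivative (T s) _ B) => x; [exact: dT|exact: pT|exact: bV].
have cF : {within `[a, b], continuous (fun s => cycle_int (V s))}.
  apply: derivable_within_continuous => x; rewrite in_itv /= => /andP[ax xb].
  by have [] : is_derive x 1 (fun s => cycle_int (V s)) 0
    by apply: d0; rewrite (lt_le_trans ua ax) (le_lt_trans xb bv).
have [|c _] := @MVT R (fun s => cycle_int (V s)) (fun=> 0) a b ab _ cF.
  move=> x; rewrite in_itv /= => /andP[ax xb].
  by apply: d0; rewrite (lt_trans ua ax) (lt_trans xb bv).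
by rewrite mul0r => /subr0_eq.
Qed.
End RealIntegral.

(** * Complex numbers, limits and Wirtinger derivatives *)

Section ComplexBasics.
Context {R : realType}.
Local Notation C := (Cplx R).
Local Notation "x %:C" := (real_complex_def (Phant R) x : C) (format "x %:C").
Local Notation Re := (@complex.Re R).
Local Notation Im := (@complex.Im R).

Lemma Re_normC (z : C) : (Re `|z|)%:C = `|z|.
Proof. by rewrite normc_def. Qed.

Lemma norm_rc (x : R) : `|x%:C| = `|x|%:C.
Proof. by rewrite normc_def /= expr0n addr0 sqrtr_sqr. Qed.

Lemma lerC (x y : R) : (x%:C <= y%:C) = (x <= y).
Proof. by rewrite lecR. Qed.

Lemma ltrC (x y : R) : (x%:C < y%:C) = (x < y).
Proof. by rewrite ltcR. Qed.

Lemma conj_rc (x : R) : (x%:C)^* = x%:C.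
Proof. exact: conjc_real. Qed.

Lemma rcD (x y : R) : (x + y)%:C = x%:C + y%:C.
Proof. by rewrite rmorphD. Qed.

Lemma rcN (x : R) : (- x)%:C = - x%:C.
Proof. by rewrite rmorphN. Qed.

Lemma rcB (x y : R) : (x - y)%:C = x%:C - y%:C.
Proof. by rewrite rmorphB. Qed.

Lemma rcM (x y : R) : (x * y)%:C = x%:C * y%:C.
Proof. by rewrite rmorphM. Qed.

Lemma rcX (x : R) n : (x ^+ n)%:C = x%:C ^+ n.
Proof. by rewrite rmorphXn. Qed.

Lemma rcV (x : R) : (x^-1)%:C = x%:C^-1.
Proof. by rewrite fmorphV. Qed.

Lemma rc0 : 0%:C = 0 :> C. Proof. by []. Qed.

Lemma rc1 : 1%:C = 1 :> C. Proof. by []. Qed.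

Lemma rc_sum (I : Type) (r : seq I) (P : pred I) (f : I -> R) :
  (\sum_(i <- r | P i) f i)%:C = \sum_(i <- r | P i) (f i)%:C.
Proof. by rewrite rmorph_sum. Qed.

Lemma conjD (z w : C) : (z + w)^* = z^* + w^*.
Proof. by rewrite rmorphD. Qed.

Lemma conjM (z w : C) : (z * w)^* = z^* * w^*.
Proof. by rewrite rmorphM. Qed.

Lemma norm_Re_le (z : C) : `|Re z|%:C <= `|z|.
Proof. exact: normc_ge_Re. Qed.

Lemma norm_Im_le (z : C) : `|Im z|%:C <= `|z|.
Proof.
have := norm_Re_le ('i * z); rewrite normrM normCi mul1r; congr (_ <= _).
by congr (_%:C); case: z => a b; rewrite -complexiE /= mul0r mul1r sub0r normrN.
Qed.

Lemma split_ReIm (z : C) : z = (Re z)%:C + 'i * (Im z)%:C.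
Proof. by rewrite -complexiE; exact: complexE. Qed.

Lemma mulC_conj (z : C) : z * z^* = (Re z ^+ 2 + Im z ^+ 2)%:C.
Proof. by rewrite -normCK -add_Re2_Im2. Qed.

Lemma ReD (z w : C) : Re (z + w) = Re z + Re w.
Proof. by rewrite raddfD. Qed.

Lemma ImD (z w : C) : Im (z + w) = Im z + Im w.
Proof. by rewrite raddfD. Qed.

Lemma Re_rcM (x : R) (z : C) : Re (x%:C * z) = x * Re z.
Proof. by case: z => a b /=; rewrite mul0r subr0. Qed.

Lemma Im_rcM (x : R) (z : C) : Im (x%:C * z) = x * Im z.
Proof. by case: z => a b /=; rewrite mul0r addr0. Qed.

Lemma Re_iM (z : C) : Re ('i * z) = - Im z.
Proof. by rewrite -complexiE; case: z => a b /=; rewrite mul0r sub0r mul1r. Qed.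

Lemma Im_iM (z : C) : Im ('i * z) = Re z.
Proof. by rewrite -complexiE; case: z => a b /=; rewrite mul0r add0r mul1r. Qed.

Lemma complex_ext (z w : C) : Re z = Re w -> Im z = Im w -> z = w.
Proof. by case: z w => [a b] [c d] /= -> ->. Qed.

Section Limits.
Variables (T : Type) (F : set_system T).
Hypothesis FF : Filter F.

Lemma cvg_Re (f : T -> C) (l : C) : f x @[x --> F] --> l -> Re (f x) @[x --> F] --> Re l.
Proof.
move=> /cvgrPdist_lt h; apply/cvgrPdist_lt => e e0.
have e0C : 0 < e%:C by rewrite -(rmorph0 (real_complex R)) ltrC.
apply: filterS (h _ e0C) => t ht.
by rewrite -raddfB -ltrC; exact: le_lt_trans (norm_Re_le _) ht.
Qed.

Lemma cvg_Im (f : T -> C) (l : C) : f x @[x --> F] --> l -> Im (f x) @[x --> F] --> Im l.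
Proof.
move=> /cvgrPdist_lt h; apply/cvgrPdist_lt => e e0.
have e0C : 0 < e%:C by rewrite -(rmorph0 (real_complex R)) ltrC.
apply: filterS (h _ e0C) => t ht.
by rewrite -raddfB -ltrC; exact: le_lt_trans (norm_Im_le _) ht.
Qed.

Lemma cvg_rc (f : T -> R) (l : R) : f x @[x --> F] --> l -> (f x)%:C @[x --> F] --> l%:C.
Proof.
move=> /cvgrPdist_lt h; apply/cvgrPdist_lt => e e0.
have e0R : 0 < Re e by rewrite -ltrC RRe_real ?gtr0_real.
apply: filterS (h _ e0R) => t ht.
by rewrite -rmorphB norm_rc -[e]RRe_real ?gtr0_real// ltrC.
Qed.

Lemma cvg_conj (f : T -> C) (l : C) : f x @[x --> F] --> l -> (f x)^* @[x --> F] --> l^*.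
Proof.
move=> /cvgrPdist_lt h; apply/cvgrPdist_lt => e e0.
by apply: filterS (h _ e0) => t; rewrite -rmorphB norm_conjC.
Qed.

End Limits.

Lemma Re_le_norm (z : C) (r : R) : `|z| <= r%:C -> `|Re z| <= r.
Proof. by move=> h; rewrite -lerC (le_trans (norm_Re_le _)). Qed.

Lemma Im_le_norm (z : C) (r : R) : `|z| <= r%:C -> `|Im z| <= r.
Proof. by move=> h; rewrite -lerC (le_trans (norm_Im_le _)). Qed.

(** A record rather than the bare convergence statement, so that unification
    does not unfold filters when these facts are combined. *)
Record tends (T : Type) (F : set_system T) (f : T -> C) (l : C) : Prop :=
  Tends { tends_cvg : f x @[x --> F] --> l }.

Section Tends.
Context {T : Type} {F : set_system T} {FF : Filter F}.
Implicit Types (f g : T -> C) (a b : C).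

Lemma tends_cst a : tends F (fun=> a) a.
Proof. split; exact: cvg_cst. Qed.

Lemma tendsD f g a b : tends F f a -> tends F g b -> tends F (fun s => f s + g s) (a + b).
Proof. by case=> cf [cg]; split; exact: (@cvgD C C T F FF f g a b cf cg). Qed.

Lemma tendsN f a : tends F f a -> tends F (fun s => - f s) (- a).
Proof. by case=> cf; split; exact: (@cvgN C C T F FF f a cf). Qed.

Lemma tendsB f g a b : tends F f a -> tends F g b -> tends F (fun s => f s - g s) (a - b).
Proof. by move=> cf /tendsN; exact: tendsD. Qed.

Lemma tendsM f g a b : tends F f a -> tends F g b -> tends F (fun s => f s * g s) (a * b).
Proof. by case=> cf [cg]; split; exact: (@cvgM C T F FF f g a b cf cg). Qed.

Lemma tendsV f a : tends F f a -> a != 0 -> tends F (fun s => (f s)^-1) a^-1.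
Proof. by case=> cf a0; split; exact: (@cvgV C T F FF f a a0 cf). Qed.

Lemma tends_conj f a : tends F f a -> tends F (fun s => (f s)^*) a^*.
Proof. by case=> cf; split; exact: (@cvg_conj T F FF f a cf). Qed.

Lemma tends_norm f a : tends F f a -> tends F (fun s => `|f s|) `|a|.
Proof. by case=> cf; split; exact: (@cvg_norm C C T F FF f a cf). Qed.

Lemma tends_ext f g a : (\forall s \near F, f s = g s) -> tends F f a -> tends F g a.
Proof.
move=> fg [cf]; split; apply: cvg_trans cf; apply: (@near_eq_cvg T C F FF).
by apply: filterS fg => s ->.
Qed.

Lemma tends_near f a (P : C -> Prop) : tends F f a -> (\forall x \near a, P x) ->
  \forall s \near F, P (f s).
Proof. by case=> cf; exact: cf. Qed.

Lemma tends_neq0 f a : tends F f a -> a != 0 -> \forall s \near F, f s != 0.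
Proof. by case=> cf a0; exact: (@cvgr_neq0 C C T F FF f a cf a0). Qed.

Lemma tends_bounded f a : tends F f a -> exists K : R, \forall s \near F, `|f s| <= K%:C.
Proof.
case=> cf; exists (Re `|a| + 1).
have /cvgrPdist_lt/(_ 1 ltr01) := cf; apply: filterS => s h.
rewrite rcD Re_normC -[f s](subrK a) addrC (le_trans (ler_normD _ _))//.
by rewrite lerD2l distrC; exact: ltW.
Qed.

End Tends.

Lemma tends_id (t : C) : tends (nbhs t) (fun s => s) t.
Proof. split; exact: (@cvg_id C (nbhs t)). Qed.

Lemma tends_comp (T : Type) (F : set_system T) (f : T -> C) (t : C) (g : C -> C) l :
  tends F f t -> tends (nbhs t) g l -> tends F (fun x => g (f x)) l.
Proof. by case=> cf [cg]; split; exact: (cvg_comp _ _ cf cg). Qed.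

(** Wirtinger derivatives in Caratheodory's form: a and b are the values at t
    of d/dz f and d/dzbar f. In contrast with the definition by two partial
    derivatives, this one contains real differentiability, hence the product
    and chain rules. Complex differentiability is the case b = 0. *)
Definition wder (f : C -> C) (t a b : C) :=
  exists A B : C -> C, [/\ tends (nbhs t) A a, tends (nbhs t) B b &
    \forall s \near t, f s = f t + A s * (s - t) + B s * (s - t)^*].

Lemma tends_sub t : tends (nbhs t) (fun s => s - t) 0.
Proof. by rewrite -(subrr t); apply: tendsB; [exact: tends_id|exact: tends_cst]. Qed.

Lemma wder_cont f t a b : wder f t a b -> tends (nbhs t) f (f t).
Proof.
move=> [A [B [cA cB E]]].
have : tends (nbhs t) (fun s => f t + A s * (s - t) + B s * (s - t)^*) (f t + a * 0 + b * 0^*).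
  apply: tendsD; first apply: tendsD.
  - exact: tends_cst.
  - exact: tendsM cA (tends_sub t).
  - exact: tendsM cB (tends_conj (tends_sub t)).
rewrite rmorph0 !mulr0 !addr0; apply: tends_ext.
by apply: filterS E => s ->.
Qed.

Lemma wder_ext f g t a b a' b' : wder f t a b -> a = a' -> b = b' ->
  (\forall s \near t, f s = g s) -> wder g t a' b'.
Proof.
move=> [A [B [cA cB E]]] <- <- fg; exists A, B; split=> //.
have <- : f t = g t by exact: nbhs_singleton fg.
by near=> s; rewrite -(near fg s)//; near: s.
Unshelve. all: by end_near. Qed.

Lemma wder_cst c t : wder (fun=> c) t 0 0.
Proof.
by exists (fun=> 0), (fun=> 0); split; [exact: tends_cst..|near=> s; rewrite !mul0r !addr0].
Unshelve. all: by end_near. Qed.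

Lemma wder_id t : wder (fun s => s) t 1 0.
Proof.
exists (fun=> 1), (fun=> 0); split; [exact: tends_cst..|near=> s].
by rewrite mul1r mul0r addr0 addrC subrK.
Unshelve. all: by end_near. Qed.

Lemma wderD f g t a b a' b' : wder f t a b -> wder g t a' b' ->
  wder (fun s => f s + g s) t (a + a') (b + b').
Proof.
move=> [A [B [cA cB E]]] [A' [B' [cA' cB' E']]].
exists (fun s => A s + A' s), (fun s => B s + B' s); split; [exact: tendsD cA cA'|exact: tendsD cB cB'|].
near=> s; rewrite (near E s)// (near E' s)//; ring.
Unshelve. all: by end_near. Qed.

Lemma wderM f g t a b a' b' : wder f t a b -> wder g t a' b' ->
  wder (fun s => f s * g s) t (a * g t + f t * a') (b * g t + f t * b').
Proof.
move=> [A [B [cA cB E]]] dg; have cg := wder_cont dg.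
move: dg => [A' [B' [cA' cB' E']]].
exists (fun s => A s * g s + f t * A' s), (fun s => B s * g s + f t * B' s).
split.
- exact: tendsD (tendsM cA cg) (tendsM (tends_cst (f t)) cA').
- exact: tendsD (tendsM cB cg) (tendsM (tends_cst (f t)) cB').
- near=> s; rewrite (near E s)// [in X in _ = f t * g t + X + _]mulrDl.
  rewrite !mulrDl [f t * g s](_ : _ = f t * (g t + A' s * (s - t) + B' s * (s - t)^*)); last first.
    by congr (_ * _); near: s.
  ring.
Unshelve. all: by end_near. Qed.

Lemma wder_conj f t a b : wder f t a b -> wder (fun s => (f s)^*) t b^* a^*.
Proof.
move=> [A [B [cA cB E]]].
exists (fun s => (B s)^*), (fun s => (A s)^*); split; [exact: tends_conj cB|exact: tends_conj cA|].
near=> s; rewrite (near E s)//; move: (s - t) => d.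
by rewrite !conjD !conjM conjCK addrAC.
Unshelve. all: by end_near. Qed.

Lemma wderN f t a b : wder f t a b -> wder (fun s => - f s) t (- a) (- b).
Proof.
move=> df; apply: wder_ext (wderM (wder_cst (-1) t) df) _ _ _; try ring.
by near=> s; ring.
Unshelve. all: by end_near. Qed.

Lemma wderB f g t a b a' b' : wder f t a b -> wder g t a' b' ->
  wder (fun s => f s - g s) t (a - a') (b - b').
Proof. by move=> df /wderN; exact: wderD. Qed.

Lemma wderZ c f t a b : wder f t a b -> wder (fun s => c * f s) t (c * a) (c * b).
Proof.
move=> df; apply: wder_ext (wderM (wder_cst c t) df) _ _ _; try ring.
by near=> s.
Unshelve. all: by end_near. Qed.

Lemma wderV f t a b : wder f t a b -> f t != 0 ->
  wder (fun s => (f s)^-1) t (- a / f t ^+ 2) (- b / f t ^+ 2).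
Proof.
move=> df ft0; have cf := wder_cont df.
have nf : \forall s \near t, f s != 0.
  exact: tends_neq0 cf ft0.
move: df => [A [B [cA cB E]]].
exists (fun s => - A s / (f s * f t)), (fun s => - B s / (f s * f t)); split.
- rewrite expr2; exact: tendsM (tendsN cA) (tendsV (tendsM cf (tends_cst (f t))) (mulf_neq0 ft0 ft0)).
- rewrite expr2; exact: tendsM (tendsN cB) (tendsV (tendsM cf (tends_cst (f t))) (mulf_neq0 ft0 ft0)).
- near=> s; have fs0 : f s != 0 by near: s.
  have Es : f s = f t + A s * (s - t) + B s * (s - t)^* by near: s.
  have -> : (f s)^-1 = (f t)^-1 - (f s - f t) / (f s * f t) by field; rewrite fs0 ft0.
  rewrite [in X in _ - X / _]Es; by field; rewrite fs0 ft0.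
Unshelve. all: by end_near. Qed.

Lemma wder_sum (I : Type) (r : seq I) (P : pred I) (f : I -> C -> C) t a b :
  (forall i, P i -> wder (f i) t (a i) (b i)) ->
  wder (fun s => \sum_(i <- r | P i) f i s) t (\sum_(i <- r | P i) a i) (\sum_(i <- r | P i) b i).
Proof.
move=> h; elim: r => [|i r IH].
  apply: wder_ext (wder_cst 0 t) _ _ _; rewrite ?big_nil//.
  by near=> s; rewrite big_nil.
rewrite !big_cons; case: ifPn => Pi.
  by apply: wder_ext (wderD (h i Pi) IH) _ _ _ => //; near=> s; rewrite big_cons Pi.
by apply: wder_ext IH _ _ _ => //; near=> s; rewrite big_cons (negbTE Pi).
Unshelve. all: by end_near. Qed.

(** A factor k continuous at x replaces the difference quotient, which makes
    the chain rule an algebraic computation. *)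
Lemma caratheodory (g : R -> R) (x g' : R) : is_derive x 1 g g' ->
  exists2 k : R -> R, k y @[y --> x] --> g' & forall y, g y = g x + k y * (y - x).
Proof.
move=> [dg <-]; pose k y := if y == x then 'D_1 g x else (g y - g x) / (y - x).
exists k; last first.
  move=> y; rewrite /k; case: eqVneq => [->|yx]; first by rewrite subrr mulr0 addr0.
  by rewrite divfK ?subr_eq0// addrC subrK.
apply/cvgrPdist_lt => e e0.
have /cvgrPdist_lt/(_ _ e0) := dg.
rewrite near_withinE near_simpl => /nbhs_ballP[d /= d0 H].
apply/nbhs_ballP; exists d => //= y; rewrite /ball /= => xy.
rewrite /k; case: eqVneq => [_|yx]; first by rewrite subrr normr0.
have := H (y - x); rewrite /ball /= sub0r normrN distrC => /(_ xy).
by rewrite subr_eq0 => /(_ yx); rewrite /= scaler1 subrK mulrC.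
Qed.

Lemma wder_comp_real (u : C -> R) (g : R -> R) t a b g' :
  wder (fun s => (u s)%:C) t a b -> is_derive (u t) 1 g g' ->
  wder (fun s => (g (u s))%:C) t (g'%:C * a) (g'%:C * b).
Proof.
move=> du /caratheodory[k ck Ek].
have cu : u s @[s --> t] --> u t := @cvg_Re C (nbhs t) (nbhs_filter t) _ _ (tends_cvg (wder_cont du)).
have cku : tends (nbhs t) (fun s => (k (u s))%:C) g'%:C.
  by split; apply: (@cvg_rc C (nbhs t) _); exact: (cvg_comp _ _ cu ck).
move: du => [A [B [cA cB E]]].
exists (fun s => (k (u s))%:C * A s), (fun s => (k (u s))%:C * B s).
split; [exact: tendsM cku cA|exact: tendsM cku cB|near=> s].
have Es : (u s)%:C = (u t)%:C + A s * (s - t) + B s * (s - t)^* by near: s.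
rewrite Ek rcD rcM rcB Es; ring.
Unshelve. all: by end_near. Qed.

End ComplexBasics.

(** * Complex functions of a real variable *)

Section CycleIntegral.
Context {R : realType}.
Local Notation C := (Cplx R).
Local Notation "x %:C" := (real_complex_def (Phant R) x : C) (format "x %:C").
Local Notation Re := (@complex.Re R).
Local Notation Im := (@complex.Im R).

Lemma is_derive_caratheodory (g k : R -> R) (x l : R) : k y @[y --> x] --> l ->
  (\forall y \near x, g y = g x + k y * (y - x)) -> is_derive x 1 g l.
Proof.
move=> ck E.
have cg : h^-1 *: (g (h *: 1 + x) - g x) @[h --> 0^'] --> l.
  apply/cvgrPdist_lt => e e0.
  have /cvgrPdist_lt/(_ _ e0) := ck.
  rewrite near_withinE near_simpl.
  move=> /nbhs_ballP[d /= d0 H1]; move/nbhs_ballP : E => [d' /= d'0 H2].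
  apply/nbhs_ballP; exists (Num.min d d') => /=; first by rewrite lt_min d0.
  move=> h; rewrite /ball /= sub0r normrN lt_min => /andP[hd hd'] h0.
  have E1 : x - (h + x) = - h by ring.
  have := H1 (h + x); rewrite /ball /= E1 normrN => /(_ hd).
  have := H2 (h + x); rewrite /ball /= E1 normrN => /(_ hd').
  rewrite [h *: 1]mulr1 => ->; congr (_ < _); congr (`|_ - _|).
  by rewrite -[_ *: _]/(_ * _); field.
split; first by apply/cvg_ex; exists l.
exact/cvg_lim.
Qed.

(** The same Caratheodory form for a complex function of a real variable. *)
Definition rder (g : R -> C) (x : R) (d : C) := exists2 A : R -> C,
  tends (nbhs x) A d & \forall y \near x, g y = g x + A y * (y - x)%:C.

Lemma rder_Re g (x : R) d : rder g x d -> is_derive x 1 (fun y => Re (g y)) (Re d).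
Proof.
move=> [A [cA] E]; apply: (@is_derive_caratheodory _ (fun y => Re (A y))).
  exact: cvg_Re.
by apply: filterS E => y ->; rewrite ReD mulrC Re_rcM mulrC.
Qed.

Lemma rder_Im g (x : R) d : rder g x d -> is_derive x 1 (fun y => Im (g y)) (Im d).
Proof.
move=> [A [cA] E]; apply: (@is_derive_caratheodory _ (fun y => Im (A y))).
  exact: cvg_Im.
by apply: filterS E => y ->; rewrite ImD mulrC Im_rcM mulrC.
Qed.

Lemma tends_subR (x : R) : tends (nbhs x) (fun y => (y - x)%:C) 0.
Proof.
split; apply: cvg_rc; rewrite -[X in _ --> X](subrr x).
by apply: cvgB; [exact: cvg_id|exact: cvg_cst].
Qed.

Lemma rder_cont g (x : R) d : rder g x d -> tends (nbhs x) g (g x).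
Proof.
move=> [A cA E].
have : tends (nbhs x) (fun y => g x + A y * (y - x)%:C) (g x + d * 0).
  exact: tendsD (tends_cst _) (tendsM cA (tends_subR x)).
by rewrite mulr0 addr0; apply: tends_ext; apply: filterS E => y ->.
Qed.

Lemma rder_ext f g (x : R) a a' : rder f x a -> a = a' ->
  (\forall y \near x, f y = g y) -> rder g x a'.
Proof.
move=> [A cA E] <- fg; exists A => //.
have <- : f x = g x by exact: nbhs_singleton fg.
by near=> y; rewrite -(near fg y)//; near: y.
Unshelve. all: by end_near. Qed.

Lemma rder_cst c (x : R) : rder (fun=> c) x 0.
Proof.
by exists (fun=> 0); [exact: tends_cst|near=> s; rewrite !mul0r !addr0].
Unshelve. all: by end_near. Qed.

Lemma rder_real (g : R -> R) (x g' : R) : is_derive x 1 g g' ->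
  rder (fun y => (g y)%:C) x g'%:C.
Proof.
move=> /caratheodory[k ck Ek]; exists (fun y => (k y)%:C); first by split; exact: cvg_rc.
by near=> y; rewrite Ek rcD rcM.
Unshelve. all: by end_near. Qed.

Lemma rder_id (x : R) : rder (fun y => y%:C) x 1.
Proof. by apply: rder_real; exact: is_derive_id. Qed.

Lemma rderD f g (x : R) a b : rder f x a -> rder g x b -> rder (fun y => f y + g y) x (a + b).
Proof.
move=> [A cA E] [B cB E']; exists (fun y => A y + B y); first exact: tendsD cA cB.
near=> y; rewrite (near E y)// (near E' y)//; ring.
Unshelve. all: by end_near. Qed.

Lemma rderM f g (x : R) a b : rder f x a -> rder g x b ->
  rder (fun y => f y * g y) x (a * g x + f x * b).
Proof.
move=> [A cA E] dg; have cg := rder_cont dg; move: dg => [B cB E'].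
exists (fun y => A y * g y + f x * B y).
  exact: tendsD (tendsM cA cg) (tendsM (tends_cst _) cB).
near=> y; rewrite (near E y)// [in LHS]mulrDl.
have -> : f x * g y = f x * (g x + B y * (y - x)%:C) by congr (_ * _); near: y.
ring.
Unshelve. all: by end_near. Qed.

Lemma rderZ c f (x : R) a : rder f x a -> rder (fun y => c * f y) x (c * a).
Proof.
move=> df; apply: rder_ext (rderM (rder_cst c x) df) _ _; first by ring.
by near=> s.
Unshelve. all: by end_near. Qed.

Lemma rder_comp f g (x : R) a b d : wder f (g x) a b -> rder g x d ->
  rder (fun y => f (g y)) x (a * d + b * d^*).
Proof.
move=> [A [B [cA cB E]]] dg; have cg := rder_cont dg; move: dg => [D cD E'].
exists (fun y => A (g y) * D y + B (g y) * (D y)^*).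
  apply: tendsD; first exact: tendsM (tends_comp cg cA) cD.
  exact: tendsM (tends_comp cg cB) (tends_conj cD).
have E2 := tends_near cg E; near=> y.
have -> : f (g y) = f (g x) + A (g y) * (g y - g x) + B (g y) * (g y - g x)^*.
  by near: y.
have -> : g y - g x = D y * (y - x)%:C.
  have -> : g y = g x + D y * (y - x)%:C by near: y.
  by rewrite [X in X - _]addrC addrK.
rewrite conjM conj_rc; ring.
Unshelve. all: by end_near. Qed.

Lemma wder_along f t a b v : wder f t a b ->
  rder (fun x => f (t + x%:C * v)) 0 (a * v + b * v^*).
Proof.
move=> df; apply: (@rder_comp _ (fun x => t + x%:C * v)).
  by rewrite rc0 mul0r addr0.
apply: rder_ext (rderD (rder_cst t 0) (rderM (rder_id 0) (rder_cst v 0))) _ _.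
  by ring.
by near=> s.
Unshelve. all: by end_near. Qed.

Definition cis (t : R) : C := (cos t)%:C + 'i * (sin t)%:C.

Lemma rder_cis (t : R) : rder cis t ('i * cis t).
Proof.
apply: rder_ext (rderD (rder_real (is_derive_cos t)) (rderZ 'i (rder_real (is_derive_sin t)))) _ _.
  by rewrite /cis rcN mulrDr mulrA -expr2 sqrCi mulN1r addrC.
by near=> s.
Unshelve. all: by end_near. Qed.

Lemma norm_cis t : `|cis t| = 1.
Proof.
apply/eqP; rewrite -(@eqrXn2 _ 2)// expr1n normCK mulC_conj.
rewrite !ReD !ImD !Re_iM !Im_iM /= oppr0 addr0 add0r.
by rewrite cos2Dsin2.
Qed.

Lemma cis_periodic t : cis (t + pi *+ 2) = cis t.
Proof. by rewrite /cis cosD2pi sinD2pi. Qed.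

Definition ccont (g : R -> C) := forall t : R, tends (nbhs t) g (g t).

Definition cintC (g : R -> C) : C :=
  (cycle_int (fun t => Re (g t)))%:C + 'i * (cycle_int (fun t => Im (g t)))%:C.

Lemma eq_cintC f g : f =1 g -> cintC f = cintC g.
Proof. by move=> /funext ->. Qed.

Lemma cintC_homotopy (V T V' : R -> R -> C) (u v B : R) :
  (forall s t : R, u < s < v -> rder (V ^~ t) s (V' s t)) ->
  (forall s t : R, u < s < v -> rder (T s) t (V' s t)) ->
  (forall s, u < s < v -> ccont (V s)) ->
  (forall s t, u < s < v -> T s (t + pi *+ 2) = T s t) ->
  (forall s t, u < s < v -> `|V' s t| <= B%:C) ->
  forall a b, u < a -> a < b -> b < v -> cintC (V a) = cintC (V b).
Proof.
move=> dV dT cV pT bV a b ua ab bv; rewrite /cintC; congr (_%:C + 'i * _%:C).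
- apply: (@cycle_int_homotopy R (fun s t => Re (V s t)) (fun s t => Re (T s t))
    (fun s t => Re (V' s t)) u v B) => // s.
  + by move=> t us; exact: rder_Re (dV _ _ us).
  + by move=> t us; exact: rder_Re (dT _ _ us).
  + by move=> us t; apply: cvg_Re; case: (cV _ us t).
  + by move=> t us; rewrite pT.
  + by move=> t us; apply: Re_le_norm; exact: bV.
- apply: (@cycle_int_homotopy R (fun s t => Im (V s t)) (fun s t => Im (T s t))
    (fun s t => Im (V' s t)) u v B) => // s.
  + by move=> t us; exact: rder_Im (dV _ _ us).
  + by move=> t us; exact: rder_Im (dT _ _ us).
  + by move=> us t; apply: cvg_Im; case: (cV _ us t).
  + by move=> t us; rewrite pT.
  + by move=> t us; apply: Im_le_norm; exact: bV.
Qed.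

Lemma cintCD f g : ccont f -> ccont g ->
  cintC (fun t => f t + g t) = cintC f + cintC g.
Proof.
move=> cf cg; rewrite /cintC.
have iR h : ccont h -> lebesgue_measure.-integrable `[0, pi *+ 2] (EFin \o (fun t => Re (h t))).
  by move=> ch; apply: (@itv_integrable R (fun t => Re (h t))) => t; apply: cvg_Re; case: (ch t).
have iI h : ccont h -> lebesgue_measure.-integrable `[0, pi *+ 2] (EFin \o (fun t => Im (h t))).
  by move=> ch; apply: (@itv_integrable R (fun t => Im (h t))) => t; apply: cvg_Im; case: (ch t).
rewrite /cycle_int.
under eq_Rintegral do rewrite ReD; under [X in _ + 'i * X%:C = _]eq_Rintegral do rewrite ImD.
by rewrite !RintegralD//; [ring|exact: iI..|exact: iR|exact: iR].
Qed.

Lemma cintCZ c f : ccont f -> cintC (fun t => c * f t) = c * cintC f.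
Proof.
move=> cf.
have iR r : lebesgue_measure.-integrable `[0, pi *+ 2] (EFin \o (fun t => r * Re (f t))).
  apply: (@itv_integrable R (fun t => r * Re (f t))) => t; apply: cvgM; first exact: cvg_cst.
  by apply: cvg_Re; case: (cf t).
have iI r : lebesgue_measure.-integrable `[0, pi *+ 2] (EFin \o (fun t => r * Im (f t))).
  apply: (@itv_integrable R (fun t => r * Im (f t))) => t; apply: cvgM; first exact: cvg_cst.
  by apply: cvg_Im; case: (cf t).
have iR1 : lebesgue_measure.-integrable `[0, pi *+ 2] (EFin \o (fun t => Re (f t))).
  by apply: (@itv_integrable R (fun t => Re (f t))) => t; apply: cvg_Re; case: (cf t).
have iI1 : lebesgue_measure.-integrable `[0, pi *+ 2] (EFin \o (fun t => Im (f t))).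
  by apply: (@itv_integrable R (fun t => Im (f t))) => t; apply: cvg_Im; case: (cf t).
rewrite /cintC /cycle_int.
have ReE t : Re (c * f t) = Re c * Re (f t) - Im c * Im (f t).
  by case: (c) (f t) => [? ?] [? ?].
have ImE t : Im (c * f t) = Re c * Im (f t) + Im c * Re (f t).
  by case: (c) (f t) => [? ?] [? ?].
under eq_Rintegral do rewrite ReE; under [X in _ + 'i * X%:C = _]eq_Rintegral do rewrite ImE.
rewrite RintegralB// RintegralD// !RintegralZl//.
rewrite [c in RHS]split_ReIm !rcD !rcN !rcM.
have i2 : 'i * 'i = -1 :> C by rewrite -expr2 sqrCi.
ring: i2.
Qed.

Lemma cintC_cst c : cintC (fun=> c) = (pi *+ 2)%:C * c.
Proof.
rewrite /cintC /cycle_int !Rintegral_cst//= lebesgue_measure_itv /= lte_fin pmulrn_lgt0 ?pi_gt0//.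
by rewrite oppr0 adde0 /= [c in RHS]split_ReIm !rcM; ring.
Qed.

Lemma norm_cintC f (B : R) : ccont f -> (forall t, `|f t| <= B%:C) ->
  `|cintC f| <= (pi *+ 4 * B)%:C.
Proof.
move=> cf bf; have B0 : 0 <= B by rewrite -lerC; exact: le_trans (normr_ge0 _) (bf 0).
have H (h : R -> R) : continuous h -> (forall t, `|h t| <= B) -> `|cycle_int h| <= pi *+ 2 * B.
  move=> ch bh; rewrite /cycle_int.
  have ih : lebesgue_measure.-integrable `[0, pi *+ 2] (EFin \o h) by exact: itv_integrable.
  apply: le_trans (le_normr_Rintegral _ ih) _ => //.
  apply: le_trans (le_Rintegral (f2 := fun=> B) _ _ _ _) _ => //.
  - apply: (@itv_integrable R (fun t => `|h t|)) => t.
    by apply: cvg_norm; exact: ch.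
  - by apply: (@itv_integrable R (fun=> B)); exact: cst_continuous.
  - rewrite Rintegral_cst//= lebesgue_measure_itv /= lte_fin pmulrn_lgt0 ?pi_gt0//.
    by rewrite oppr0 adde0 /= mulrC.
apply: le_trans (ler_normD _ _) _; rewrite normrM normCi mul1r !norm_rc -rcD lerC.
have -> : pi *+ 4 * B = pi *+ 2 * B + pi *+ 2 * B by ring.
apply: lerD; apply: H => t.
- by apply: cvg_Re; case: (cf t).
- exact: Re_le_norm.
- by apply: cvg_Im; case: (cf t).
- exact: Im_le_norm.
Qed.

End CycleIntegral.

(** * The Cauchy formula on a circle *)

Section Cauchy.
Context {R : realType}.
Local Notation C := (Cplx R).
Local Notation "x %:C" := (real_complex_def (Phant R) x : C) (format "x %:C").
Local Notation Re := (@complex.Re R).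

Lemma Re_norm_ge0 (z : C) : 0 <= Re `|z|.
Proof. by rewrite -lerC Re_normC rc0 normr_ge0. Qed.

Lemma rc_eq0 (x : R) : (x%:C == 0) = (x == 0).
Proof. by rewrite fmorph_eq0. Qed.

Lemma wder_inv (z : C) : z != 0 -> wder (fun s => s^-1) z (- 1 / z ^+ 2) 0.
Proof.
move=> z0; apply: wder_ext (wderV (wder_id z) z0) _ _ _ => //.
  by rewrite oppr0 mul0r.
by near=> s.
Unshelve. all: by end_near. Qed.

Lemma wder_unique f (t a a' : C) : wder f t a 0 -> wder f t a' 0 -> a = a'.
Proof.
move=> /wder_along - /(_ 1) h1 /wder_along - /(_ 1) h2.
have E (x : C) : x * 1 + 0 * 1^* = x by ring.
rewrite !E in h1 h2.
apply: complex_ext.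
  by have [_ <-] := rder_Re h1; have [_ <-] := rder_Re h2.
by have [_ <-] := rder_Im h1; have [_ <-] := rder_Im h2.
Qed.

Definition circ (r t : R) : C := r%:C * cis t.

Lemma rder_circ r (t : R) : rder (circ r) t ('i * circ r t).
Proof.
apply: rder_ext (rderZ r%:C (rder_cis t)) _ _; first by rewrite /circ; ring.
by near=> s.
Unshelve. all: by end_near. Qed.

Lemma norm_circ r t : 0 < r -> `|circ r t| = r%:C.
Proof. by move=> r0; rewrite normrM norm_cis mulr1 norm_rc gtr0_norm. Qed.

Lemma circ_periodic r t : circ r (t + pi *+ 2) = circ r t.
Proof. by rewrite /circ cis_periodic. Qed.

Lemma ccont_circ r : ccont (circ r).
Proof. by move=> t; exact: rder_cont (rder_circ r t). Qed.

Lemma circ_sub_neq0 r t (a : C) : 0 < r -> `|a| < r%:C -> circ r t - a != 0.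
Proof.
move=> r0 ar; rewrite subr_eq0; apply/eqP => E.
by move: ar; rewrite -E norm_circ// ltxx.
Qed.

Lemma ccontD (f g : R -> C) : ccont f -> ccont g -> ccont (fun t => f t + g t).
Proof. by move=> cf cg t; exact: tendsD. Qed.

Lemma ccontM (f g : R -> C) : ccont f -> ccont g -> ccont (fun t => f t * g t).
Proof. by move=> cf cg t; exact: tendsM. Qed.

Lemma ccont_cst (c : C) : ccont (fun=> c).
Proof. by move=> t; exact: tends_cst. Qed.

Lemma ccont_kernel r a : 0 < r -> `|a| < r%:C -> ccont (fun t => (circ r t - a)^-1).
Proof.
move=> r0 ar t; apply: tendsV; last exact: circ_sub_neq0.
exact: tendsB (ccont_circ r t) (tends_cst a).
Qed.

(** The point p s t = a + s (circ r t - a) contracts the circle to a.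
    Multiplying the s-derivative of f (p s t) by the Cauchy kernel gives f' (p
    s t) circ r t, which is also the t-derivative of f (p s t) / (i s). *)
Lemma cauchy_homotopy (f f' : C -> C) (r B : R) (a : C) : 0 < r ->
  (forall s, `|s| < (r * 4)%:C -> wder f s (f' s) 0 /\ `|f' s| <= B%:C) ->
  `|a| < r%:C ->
  cintC (fun t => f (circ r t) * (circ r t / (circ r t - a))) =
  cintC (fun t => f a * (circ r t / (circ r t - a))).
Proof.
move=> r0 df ar.
pose p (s t : R) := a + s%:C * (circ r t - a).
have pr s t : -1 < s < 2 -> `|p s t| < (r * 4)%:C.
  move=> /andP[s1 s2].
  have -> : p s t = (1 - s)%:C * a + s%:C * circ r t by rewrite /p rcB; ring.
  apply: le_lt_trans (ler_normD _ _) _.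
  rewrite normrM [X in _ + X]normrM norm_circ// !norm_rc -[`|a|]Re_normC -!rcM -rcD ltrC.
  have aR : Re `|a| < r by rewrite -ltrC Re_normC.
  have a0 : 0 <= Re `|a| by exact: Re_norm_ge0.
  have h1 : `|1 - s| < 2 by rewrite ltr_norml; lra.
  have h2 : `|s| <= 2 by rewrite ler_norml; lra.
  have : `|1 - s| * Re `|a| <= 2 * Re `|a| by rewrite ler_wpM2r// ltW.
  have : `|s| * r <= 2 * r by rewrite ler_wpM2r// ltW.
  lra.
have wa t := circ_sub_neq0 t r0 ar.
pose V s t := f (p s t) * (circ r t / (circ r t - a)).
pose V' s t := f' (p s t) * circ r t.
(* At s = 0 the primitive f (p s t) / (i s) is singular; the derivative f' a
   circ r t then has the primitive - i f' a (circ r t - a). *)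
pose T s t := if s == 0 then - 'i * (f' a * (circ r t - a))
  else f (p s t) * ('i * s%:C)^-1.
have i2 : 'i * 'i = -1 :> C by rewrite -expr2 sqrCi.
have dp1 (s t : R) : rder (p ^~ t) s (circ r t - a).
  apply: rder_ext (rderD (rder_cst a s) (rderM (rder_id s) (rder_cst (circ r t - a) s))) _ _.
    by ring.
  by near=> x.
have dp2 (s t : R) : rder (p s) t (s%:C * ('i * circ r t)).
  apply: rder_ext (rderD (rder_cst a t) (rderZ s%:C (rderD (rder_circ r t) (rder_cst (- a) t)))) _ _.
    by ring.
  by near=> x.
have H := @cintC_homotopy R V T V' (-1) 2 (B * r) _ _ _ _ _ 0 1.
have := H; move=> {H} H.
have -> : cintC (fun t => f (circ r t) * (circ r t / (circ r t - a))) = cintC (V 1).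
  by apply: eq_cintC => t; rewrite /V (_ : p 1 t = circ r t)//= /p rc1; ring.
have -> : cintC (fun t => f a * (circ r t / (circ r t - a))) = cintC (V 0).
  by apply: eq_cintC => t; rewrite /V (_ : p 0 t = a)//= /p rc0; ring.
symmetry; apply: H; rewrite ?ltrN10 ?ltr01 ?ltr1n// => s.
- move=> t us; have [d _] := df _ (pr s t us).
  apply: rder_ext (rderM (rder_comp (g := p ^~ t) d (dp1 s t)) (rder_cst (circ r t / (circ r t - a)) s)) _ _.
    by rewrite /V'; field; rewrite wa.
  by near=> x.
- move=> t us; have [d _] := df _ (pr s t us).
  rewrite /T; case: (eqVneq s 0) => [s0|s0].
    apply: rder_ext (rderZ (- 'i) (rderZ (f' a) (rderD (rder_circ r t) (rder_cst (- a) t)))) _ _.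
      rewrite /V' /p s0 rc0 mul0r addr0 addr0.
      transitivity (- ('i * 'i) * (f' a * circ r t)); [ring|rewrite i2; ring].
    by near=> x.
  apply: rder_ext (rderM (rder_comp (g := p s) d (dp2 s t)) (rder_cst ('i * s%:C)^-1 t)) _ _.
    rewrite /V'; by field; rewrite neq0Ci rc_eq0 s0.
  by near=> x.
- move=> us t; have [d _] := df _ (pr s t us).
  apply: tendsM; first exact: rder_cont (rder_comp (g := p s) d (dp2 s t)).
  exact: tendsM (ccont_circ r t) (ccont_kernel r0 ar t).
- by move=> t us; rewrite /T /p circ_periodic.
- move=> t us; have [_ b] := df _ (pr s t us).
  by rewrite /V' normrM norm_circ// rcM ler_wpM2r// -rc0 lerC ltW.
Unshelve. all: by end_near. Qed.

(** The same homotopy principle, now moving a to the center: the s-derivative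
    of the kernel at s a is the t-derivative of i a / (circ r t - s a). *)
Lemma cauchy_kernel (r : R) (a : C) : 0 < r -> `|a| < (r / 2)%:C ->
  cintC (fun t => circ r t / (circ r t - a)) = (pi *+ 2)%:C.
Proof.
move=> r0 ar.
have aR : Re `|a| < r / 2 by rewrite -ltrC Re_normC.
have a0 : 0 <= Re `|a| by exact: Re_norm_ge0.
pose dlt := r - 2 * Re `|a|; have dlt0 : 0 < dlt by rewrite /dlt; lra.
have ws s t : -2 < s < 2 -> dlt%:C <= `|circ r t - s%:C * a|.
  move=> /andP[s1 s2]; apply: le_trans (lerB_dist _ _).
  rewrite norm_circ// normrM norm_rc -[`|a|]Re_normC -rcM -rcB lerC /dlt.
  have h2 : `|s| <= 2 by rewrite ler_norml; lra.
  have : `|s| * Re `|a| <= 2 * Re `|a| by rewrite ler_wpM2r// ltW.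
  lra.
have dC : 0 < dlt%:C by rewrite -rc0 ltrC.
have wn s t : -2 < s < 2 -> circ r t - s%:C * a != 0.
  by move=> us; rewrite -normr_gt0; exact: lt_le_trans (ws s t us).
pose V s t := circ r t / (circ r t - s%:C * a).
pose V' s t := a * circ r t / (circ r t - s%:C * a) ^+ 2.
pose T s t := 'i * a / (circ r t - s%:C * a).
have i2 : 'i * 'i = -1 :> C by rewrite -expr2 sqrCi.
have dp1 (s t : R) : rder (fun s => circ r t - s%:C * a) s (- a).
  apply: rder_ext (rderD (rder_cst (circ r t) s) (rderZ (-1) (rderM (rder_id s) (rder_cst a s)))) _ _.
    by ring.
  by near=> x; ring.
have dp2 (s t : R) : rder (fun t => circ r t - s%:C * a) t ('i * circ r t).
  apply: rder_ext (rderD (rder_circ r t) (rder_cst (- (s%:C * a)) t)) _ _.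
    by ring.
  by near=> x.
have H := @cintC_homotopy R V T V' (-2) 2 (r * r / dlt ^+ 2) _ _ _ _ _ 0 1.
have -> : cintC (fun t => circ r t / (circ r t - a)) = cintC (V 1).
  by apply: eq_cintC => t; rewrite /V rc1 mul1r.
have -> : (pi *+ 2)%:C = cintC (V 0).
  rewrite -[LHS]mulr1 -cintC_cst; apply: eq_cintC => t.
  by rewrite /V rc0 mul0r subr0 divff// -normr_gt0 norm_circ// -rc0 ltrC.
symmetry; apply: H; rewrite ?ltr01 ?ltr1n ?oppr_lt0// => s.
- move=> t us.
  apply: rder_ext (rderM (rder_cst (circ r t) s) (rder_comp (g := fun s => circ r t - s%:C * a) (wder_inv (wn s t us)) (dp1 s t))) _ _.
    by rewrite /V'; field; rewrite wn.
  by near=> x.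
- move=> t us.
  apply: rder_ext (rderM (rder_cst ('i * a) t) (rder_comp (g := fun t => circ r t - s%:C * a) (wder_inv (wn s t us)) (dp2 s t))) _ _.
    rewrite /V'; transitivity (- ('i * 'i) * a * circ r t / (circ r t - s%:C * a) ^+ 2).
      by field; rewrite wn.
    by rewrite i2; ring.
  by near=> x.
- move=> us t.
  exact: tendsM (ccont_circ r t) (rder_cont (rder_comp (g := fun t => circ r t - s%:C * a) (wder_inv (wn s t us)) (dp2 s t))).
- by move=> t us; rewrite /T circ_periodic.
- move=> t us; rewrite /V' normf_div normrM norm_circ// normrX !rcM rcV rcX.
  apply: ler_pM.
  + by rewrite mulr_ge0// -rc0 lerC ltW.
  + by rewrite invr_ge0 exprn_ge0.
  + apply: ler_wpM2r; first by rewrite -rc0 lerC ltW.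
    by apply: ltW; apply: lt_trans ar _; rewrite ltrC; lra.
  + rewrite lef_pV2 ?posrE ?exprn_gt0//; last exact: lt_le_trans (ws s t us).
    by apply: lerXn2r; rewrite ?nnegrE ?normr_ge0//; [exact: ltW|exact: ws].
Unshelve. all: by end_near. Qed.

Lemma cauchy_formula (f f' : C -> C) (r B : R) (a : C) : 0 < r ->
  (forall s, `|s| < (r * 4)%:C -> wder f s (f' s) 0 /\ `|f' s| <= B%:C) ->
  `|a| < (r / 2)%:C ->
  f a = cintC (fun t => (f (circ r t) * circ r t / (pi *+ 2)%:C) * (circ r t - a)^-1).
Proof.
move=> r0 df ar.
have ar' : `|a| < r%:C by apply: lt_trans ar _; rewrite ltrC; lra.
have r4 : r%:C < (r * 4)%:C by rewrite ltrC; lra.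
have cw : ccont (fun t => circ r t / (circ r t - a)).
  exact: ccontM (ccont_circ r) (ccont_kernel r0 ar').
have cf : ccont (fun t => f (circ r t)).
  move=> t; apply: tends_comp (ccont_circ r t) _.
  by have [|d _] := df (circ r t); [rewrite norm_circ|exact: wder_cont d].
have p0 : (pi *+ 2)%:C != 0 :> C by rewrite rc_eq0 mulrn_eq0 /= gt_eqF ?pi_gt0.
have := cauchy_homotopy r0 df ar'.
rewrite [RHS]cintCZ// cauchy_kernel// => E.
apply: (mulIf p0); rewrite -E mulrC -cintCZ; last first.
  apply: ccontM; last exact: ccont_kernel.
  by apply: ccontM; [exact: ccontM cf (ccont_circ r)|exact: ccont_cst].
apply: eq_cintC => t; move: ((pi *+ 2)%:C : C) p0 => q p0.
by field; rewrite p0 circ_sub_neq0.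
Qed.

Lemma ccontB (f g : R -> C) : ccont f -> ccont g -> ccont (fun t => f t - g t).
Proof. by move=> cf cg t; exact: tendsB. Qed.

Lemma cintCB (f g : R -> C) : ccont f -> ccont g ->
  cintC (fun t => f t - g t) = cintC f - cintC g.
Proof.
move=> cf cg; rewrite -[in RHS]mulN1r -cintCZ// -cintCD//.
  by apply: eq_cintC => t; rewrite mulN1r.
exact: ccontM (ccont_cst _) cg.
Qed.

(** The difference quotient passes to the integral because psi converges to q
    uniformly in t. *)
Lemma wder_param (p psi : C -> R -> C) (q : R -> C) (a : C) (K : R) :
  (\forall b \near a, [/\ ccont (p b), ccont (psi b) &
     forall t, p b t = p a t + psi b t * (b - a) /\ `|psi b t - q t| <= K%:C * `|b - a|]) ->
  ccont q -> wder (fun b => cintC (p b)) a (cintC q) 0.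
Proof.
move=> H cq; exists (fun b => cintC (psi b)), (fun=> 0); split; last 1 first.
- have [cpa _ _] : [/\ ccont (p a), ccont (psi a) &
     forall t, p a t = p a t + psi a t * (a - a) /\ `|psi a t - q t| <= K%:C * `|a - a|].
    exact: nbhs_singleton H.
  apply: filterS H => b [cpb cpsi E]; rewrite mul0r addr0 mulrC -cintCZ//.
  rewrite -cintCD//; last exact: ccontM (ccont_cst _) cpsi.
  by apply: eq_cintC => t; rewrite (E t).1 mulrC.
- have c0 : tends (nbhs a) (fun b => (pi *+ 4 * K)%:C * `|b - a|) 0.
    rewrite -(mulr0 (pi *+ 4 * K)%:C); apply: tendsM; first exact: tends_cst.
    by rewrite -[X in tends _ _ X](@normr0 C C); exact: tends_norm (tends_sub a).
  have [/cvgrPdist_lt c0'] := c0; split; apply/cvgrPdist_lt => e e0.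
  have := c0' _ e0; apply: filterS2 H => b [cpb cpsi E].
  rewrite sub0r normrN => h; apply: le_lt_trans h.
  rewrite distrC -cintCB//; apply: le_trans (norm_cintC (B := K * Re `|b - a|) _ _) _.
  - exact: ccontB.
  - by move=> t; rewrite rcM Re_normC; exact: (E t).2.
  - rewrite normrM normr_id norm_rc -[X in _ <= _ * X]Re_normC -rcM lerC mulrA.
    by rewrite ler_wpM2r ?Re_norm_ge0// ler_norm.
- exact: tends_cst.
Qed.

End Cauchy.

(** * Holomorphic germs: derivatives and Taylor jets *)

Section HoloGerms.
Context {R : realType}.
Local Notation C := (Cplx R).
Local Notation "x %:C" := (real_complex_def (Phant R) x : C) (format "x %:C").
Local Notation Re := (@complex.Re R).

Lemma near_norm_lt (a : C) (r : R) : `|a| < r%:C -> \forall b \near a, `|b| < r%:C.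
Proof.
move=> ar; apply/nbhs_ballP; exists (r%:C - `|a|) => /=; first by rewrite subr_gt0.
move=> b; rewrite /ball /= => h; rewrite -[b](subrK a) addrC.
by apply: le_lt_trans (ler_normD _ _) _; rewrite addrC -ltrBrDr distrC.
Qed.

Lemma near0_disc (P : C -> Prop) : (\forall s \near (0 : C), P s) ->
  exists2 r : R, 0 < r & forall s, `|s| < r%:C -> P s.
Proof.
move=> /nbhs_ballP[e /= e0 H]; exists (Re e).
  by rewrite -ltrC RRe_real ?gtr0_real.
move=> s; rewrite RRe_real ?gtr0_real// => hs.
by apply: H; rewrite /ball /= sub0r normrN.
Qed.

Section Kernel.
Variables (r G : R) (g : R -> C).
Hypotheses (r0 : 0 < r) (cg : ccont g) (bg : forall t, `|g t| <= G%:C).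

Let u (b : C) t := (circ r t - b)^-1.

Let lt_r (b : C) : `|b| < (r / 2)%:C -> `|b| < r%:C.
Proof. by move=> h; apply: lt_trans h _; rewrite ltrC; have := r0; lra. Qed.

Let cu (b : C) : `|b| < (r / 2)%:C -> ccont (u b).
Proof. by move=> h; apply: ccont_kernel => //; exact: lt_r. Qed.

Let un (b : C) t : `|b| < (r / 2)%:C -> circ r t - b != 0.
Proof. by move=> h; apply: circ_sub_neq0 => //; exact: lt_r. Qed.

Let bu (b : C) t : `|b| < (r / 2)%:C -> `|u b t| <= (2 / r)%:C.
Proof.
move=> h; rewrite normfV.
have h2 : (r / 2)%:C <= `|circ r t - b|.
  apply: le_trans (lerB_dist _ _); rewrite norm_circ//.
  rewrite lerBrDr -lerBrDl -rcB; apply: ltW; apply: lt_le_trans h _.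
  by rewrite lerC; have := r0; lra.
have -> : (2 / r)%:C = (r / 2)%:C^-1 by rewrite -rcV invf_div.
by rewrite lef_pV2// posrE ?(lt_le_trans _ h2)// -rc0 ltrC divr_gt0.
Qed.

Let udiff (a b : C) t : `|a| < (r / 2)%:C -> `|b| < (r / 2)%:C ->
  u b t = u a t + u a t * u b t * (b - a).
Proof. by move=> ha hb; rewrite /u; field; rewrite !un. Qed.

Lemma wder_kernel1 (a : C) : `|a| < (r / 2)%:C ->
  wder (fun b => cintC (fun t => g t * (circ r t - b)^-1)) a
    (cintC (fun t => g t * (circ r t - a)^-1 ^+ 2)) 0.
Proof.
move=> ha; apply: (@wder_param R (fun b t => g t * u b t)
  (fun b t => g t * (u a t * u b t)) (fun t => g t * u a t ^+ 2) a (G * (2 / r) ^+ 3)).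
  apply: filterS (near_norm_lt ha) => b hb; split.
  - exact: ccontM cg (cu hb).
  - exact: ccontM cg (ccontM (cu ha) (cu hb)).
  - move=> t; split; first by rewrite [in LHS](udiff t ha hb); ring.
    have -> : g t * (u a t * u b t) - g t * u a t ^+ 2 =
        g t * (u a t * u a t * u b t) * (b - a) by rewrite [in LHS](udiff t ha hb); ring.
    rewrite normrM ler_wpM2r//.
    rewrite !normrM rcM rcX.
    apply: ler_pM => //; rewrite ?mulr_ge0//.
    rewrite !exprS expr0 mulr1 mulrA; apply: ler_pM; rewrite ?mulr_ge0 ?bu//.
    by apply: ler_pM; rewrite ?bu.
exact: ccontM cg (ccontM (cu ha) (cu ha)).
Qed.

Lemma wder_kernel2 (a : C) : `|a| < (r / 2)%:C ->
  wder (fun b => cintC (fun t => g t * (circ r t - b)^-1 ^+ 2)) a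
    (cintC (fun t => g t * (2 * (circ r t - a)^-1 ^+ 3))) 0.
Proof.
move=> ha; apply: (@wder_param R (fun b t => g t * u b t ^+ 2)
  (fun b t => g t * (u a t * u b t ^+ 2 + u a t ^+ 2 * u b t))
  (fun t => g t * (2 * u a t ^+ 3)) a (G * (3 * (2 / r) ^+ 4))).
  apply: filterS (near_norm_lt ha) => b hb; split.
  - exact: ccontM cg (ccontM (cu hb) (cu hb)).
  - apply: ccontM cg (ccontD (ccontM (cu ha) (ccontM (cu hb) (cu hb))) _).
    exact: ccontM (ccontM (cu ha) (cu ha)) (cu hb).
  - move=> t; have E : u b t - u a t = u a t * u b t * (b - a).
      by rewrite [in LHS](udiff t ha hb); ring.
    split.
      have -> : g t * u b t ^+ 2 = g t * u a t ^+ 2 + g t * (u b t + u a t) * (u b t - u a t).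
        by ring.
      by rewrite E; ring.
    have -> : g t * (u a t * u b t ^+ 2 + u a t ^+ 2 * u b t) - g t * (2 * u a t ^+ 3) =
        g t * (u a t * u b t + u a t * u a t + u a t * u a t) * (u b t - u a t) by ring.
    rewrite E [X in `|X|](_ : _ = g t * (((u a t * u b t) * (u a t * u b t + u a t * u a t
      + u a t * u a t))) * (b - a)); last by ring.
    rewrite normrM ler_wpM2r// normrM rcM; apply: ler_pM => //.
    have B2 x y : `|x| < (r / 2)%:C -> `|y| < (r / 2)%:C -> `|u x t * u y t| <= (2 / r)%:C ^+ 2.
      by move=> hx hy; rewrite normrM expr2; apply: ler_pM; rewrite ?bu.
    have -> : (3 * (2 / r) ^+ 4)%:C = (2 / r)%:C ^+ 2 * ((2 / r)%:C ^+ 2 + (2 / r)%:C ^+ 2 + (2 / r)%:C ^+ 2).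
      by rewrite rcM rcX; ring.
    rewrite normrM; apply: ler_pM; rewrite ?B2//.
    apply: le_trans (ler_normD _ _) _; apply: lerD; last exact: B2.
    by apply: le_trans (ler_normD _ _) _; apply: lerD; exact: B2.
exact: ccontM cg (ccontM (ccont_cst _) (ccontM (cu ha) (ccontM (cu ha) (cu ha)))).
Qed.

Lemma norm_kernel3 (a : C) : `|a| < (r / 2)%:C ->
  `|cintC (fun t => g t * (2 * (circ r t - a)^-1 ^+ 3))| <=
    (pi *+ 4 * (G * (2 * (2 / r) ^+ 3)))%:C.
Proof.
move=> ha; apply: norm_cintC.
  exact: ccontM cg (ccontM (ccont_cst _) (ccontM (cu ha) (ccontM (cu ha) (cu ha)))).
move=> t; rewrite normrM rcM; apply: ler_pM => //.
have -> : (2 * (2 / r) ^+ 3)%:C = 2 * (2 / r)%:C ^+ 3 :> C by rewrite rcM rcX; ring.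
rewrite normrM normr_nat; apply: ler_wpM2l => //; rewrite normrX.
by apply: lerXn2r; rewrite ?nnegrE//; [exact: le_trans (normr_ge0 _) (bu 0 ha)|exact: bu].
Qed.

Lemma norm_kernel1 (a : C) : `|a| < (r / 2)%:C ->
  `|cintC (fun t => g t * (circ r t - a)^-1)| <= (pi *+ 4 * (G * (2 / r)))%:C.
Proof.
move=> ha; apply: norm_cintC; first exact: ccontM cg (cu ha).
by move=> t; rewrite normrM rcM; apply: ler_pM => //; exact: bu.
Qed.

End Kernel.

(** Iterating 1 / (w - a) = 1 / w + a / w * 1 / (w - a): the remainder is
    again a Cauchy integral. *)
Lemma kernel_expand (r G : R) (g : R -> C) (n : nat) : 0 < r -> ccont g ->
  (forall t, `|g t| <= G%:C) ->
  exists (p : {poly C}) (h : R -> C) (G' : R), [/\ ccont h, (forall t, `|h t| <= G'%:C) &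
    forall a, `|a| < (r / 2)%:C -> cintC (fun t => g t * (circ r t - a)^-1) =
      p.[a] + a ^+ n * cintC (fun t => h t * (circ r t - a)^-1)].
Proof.
move=> r0 cg bg; elim: n => [|n [p [h [G' [ch bh E]]]]].
  by exists 0, g, G; split=> // a _; rewrite horner0 add0r mul1r.
have c0 : ccont (fun t => (circ r t)^-1).
  have -> : (fun t => (circ r t)^-1) = (fun t => (circ r t - 0)^-1).
    by apply/funext => t; rewrite subr0.
  by apply: ccont_kernel => //; rewrite normr0 -rc0 ltrC.
have w0 t : circ r t != 0 by rewrite -normr_gt0 norm_circ// -rc0 ltrC.
pose h' t := h t * (circ r t)^-1.
have ch' : ccont h' by exact: ccontM.
exists (p + (cintC h') *: 'X^n), h', (G' * r^-1); split=> //.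
  by move=> t; rewrite normrM normfV norm_circ// rcM rcV ler_wpM2r// -rc0 -rcV lerC invr_ge0 ltW.
move=> a ha; rewrite E// hornerD hornerZ hornerXn -addrA; congr (_ + _).
have ar : `|a| < r%:C by apply: lt_trans ha _; rewrite ltrC; lra.
transitivity (a ^+ n * (cintC h' + a * cintC (fun t => h' t * (circ r t - a)^-1))); last first.
  by rewrite exprS; ring.
congr (_ * _).
have ck := ccont_kernel r0 ar.
rewrite -cintCZ; last exact: ccontM.
rewrite -cintCD//; last exact: ccontM (ccont_cst _) (ccontM ch' ck).
by apply: eq_cintC => t; rewrite /h'; field; rewrite w0 circ_sub_neq0.
Qed.

(** A bounded complex derivative near the origin is all that Cauchy's formula
    asks for; its continuity then follows. *)
Definition holo (f f' : C -> C) := exists K : R,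
  \forall s \near (0 : C), wder f s (f' s) 0 /\ `|f' s| <= K%:C.

Lemma holo_cauchy f f' : holo f f' -> exists (r G : R) (g : R -> C),
  [/\ 0 < r, ccont g, (forall t, `|g t| <= G%:C) &
    forall a, `|a| < (r / 2)%:C -> wder f a (f' a) 0 /\
      f a = cintC (fun t => g t * (circ r t - a)^-1)].
Proof.
move=> [K H0]; have [d0 _] := nbhs_singleton H0.
have [K1 H1] := tends_bounded (wder_cont d0).
have /near0_disc[rho rho0 H] : \forall s \near (0 : C),
    [/\ wder f s (f' s) 0, `|f' s| <= K%:C & `|f s| <= K1%:C].
  by apply: filterS2 H0 H1 => s [].
(* The homotopy in the Cauchy formula runs over the parameters ]-1, 2[, hence
   over points of norm less than 4 r; 5 r = rho leaves room. *)
pose r := rho / 5; have r0 : 0 < r by rewrite /r divr_gt0.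
have H4 s : `|s| < (r * 4)%:C -> [/\ wder f s (f' s) 0, `|f' s| <= K%:C & `|f s| <= K1%:C].
  by move=> hs; apply: H; apply: lt_trans hs _; rewrite ltrC /r; lra.
have H5 s : `|s| < (r * 4)%:C -> wder f s (f' s) 0 /\ `|f' s| <= K%:C.
  by move=> /H4[].
pose g t := f (circ r t) * circ r t / (pi *+ 2)%:C.
have r4 t : `|circ r t| < (r * 4)%:C by rewrite norm_circ// ltrC; lra.
have cf : ccont (fun t => f (circ r t)).
  move=> t; apply: tends_comp (ccont_circ r t) _.
  by have [d _ _] := H4 _ (r4 t); exact: wder_cont d.
have cg : ccont g by exact: ccontM (ccontM cf (ccont_circ r)) (ccont_cst _).
exists r, (K1 * r / (pi *+ 2)), g; split=> //.
- move=> t; have Epi : `|(pi *+ 2)%:C : C| = (pi *+ 2)%:C.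
    by rewrite norm_rc ger0_norm// mulrn_wge0// pi_ge0.
  rewrite /g normrM normrM normfV Epi norm_circ// rcM rcM rcV; apply: ler_wpM2r.
    by rewrite invr_ge0 -rc0 lerC mulrn_wge0// pi_ge0.
  by apply: ler_wpM2r; [rewrite -rc0 lerC ltW|case: (H4 _ (r4 t))].
- move=> a ha; have ha4 : `|a| < (r * 4)%:C by apply: lt_trans ha _; rewrite ltrC; lra.
  have [d _] := H5 a ha4.
  by split=> //; exact: (cauchy_formula r0 H5 ha).
Qed.

Lemma near0_norm_lt (r : R) : 0 < r -> \forall s \near (0 : C), `|s| < r%:C.
Proof. by move=> r0; apply: near_norm_lt; rewrite normr0 -rc0 ltrC. Qed.

Lemma near_near (t : C) (P : C -> Prop) : (\forall s \near t, P s) ->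
  \forall s \near t, \forall u \near s, P u.
Proof. by move=> h; near=> s; near: s; exact: (nbhs_interior h). Unshelve. all: by end_near. Qed.

(** Differentiate the Cauchy kernel twice under the integral sign. *)
Lemma holo_derivative f f' : holo f f' -> exists f'', holo f' f''.
Proof.
move=> /holo_cauchy[r [G [g [r0 cg bg H]]]].
exists (fun a => cintC (fun t => g t * (2 * (circ r t - a)^-1 ^+ 3))).
exists (pi *+ 4 * (G * (2 * (2 / r) ^+ 3))).
have r2 : 0 < r / 2 by rewrite divr_gt0.
have E a : `|a| < (r / 2)%:C -> f' a = cintC (fun t => g t * (circ r t - a)^-1 ^+ 2).
  move=> ha; have [d _] := H a ha; apply: (wder_unique d).
  apply: wder_ext (wder_kernel1 r0 cg bg ha) _ _ _ => //.
  by apply: filterS (near_norm_lt ha) => b /H[_ ->].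
apply: filterS (near0_norm_lt r2) => a ha; split; last exact: norm_kernel3.
apply: wder_ext (wder_kernel2 r0 cg bg ha) _ _ _ => //.
by apply: filterS (near_norm_lt ha) => b /E ->.
Qed.

Lemma holo_taylor f f' (n : nat) : holo f f' -> exists (p : {poly C}) (K : R),
  \forall a \near (0 : C), `|f a - p.[a]| <= K%:C * `|a| ^+ n.
Proof.
move=> /holo_cauchy[r [G [g [r0 cg bg H]]]].
have [p [h [G' [ch bh E]]]] := kernel_expand n r0 cg bg.
exists p, (pi *+ 4 * (G' * (2 / r))).
have r2 : 0 < r / 2 by rewrite divr_gt0.
apply: filterS (near0_norm_lt r2) => a ha.
rewrite (H a ha).2 E// addrAC subrr add0r normrM normrX mulrC.
by apply: ler_wpM2r; [rewrite exprn_ge0|exact: norm_kernel1].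
Qed.

End HoloGerms.

(** * Calculus of germs *)

Section Germs.
Context {R : realType}.
Local Notation C := (Cplx R).
Local Notation "x %:C" := (real_complex_def (Phant R) x : C) (format "x %:C").
Local Notation Re := (@complex.Re R).
Local Notation Im := (@complex.Im R).

Lemma nearC (t : C) (P : C -> Prop) : (forall s, P s) -> \forall s \near t, P s.
Proof. by move=> h; near=> s; exact: h. Unshelve. all: by end_near. Qed.

Lemma wder_uniq f (t a b a' b' : C) : wder f t a b -> wder f t a' b' -> a = a' /\ b = b'.
Proof.
move=> d d'.
have E v : a * v + b * v^* = a' * v + b' * v^*.
  have h := wder_along v d; have h' := wder_along v d'.
  apply: complex_ext.
    by have [_ <-] := rder_Re h; have [_ <-] := rder_Re h'.
  by have [_ <-] := rder_Im h; have [_ <-] := rder_Im h'.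
have := E 1; rewrite rmorph1 !mulr1 => E1.
have := E 'i; rewrite conjCi !mulrN -!mulNr -!mulrDl => /(mulIf (@neq0Ci C)) E2.
have a2 : a *+ 2 = a' *+ 2.
  have -> : a *+ 2 = (a + b) + (a - b) by ring.
  by rewrite E1 E2; ring.
have aa : a = a' by apply/eqP; rewrite -(eqr_pMn2r (n := 2))//; apply/eqP.
by split=> //; move: E1; rewrite aa => /addrI.
Qed.

Lemma wder_comp f g (t a a' b' : C) : wder f (g t) a 0 -> wder g t a' b' ->
  wder (fun s => f (g s)) t (a * a') (a * b').
Proof.
move=> [A [B [cA cB E]]] dg; have cg := wder_cont dg; have E2 := tends_near cg E.
move: dg => [A' [B' [cA' cB' E']]].
exists (fun s => A (g s) * A' s + B (g s) * (B' s)^*),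
       (fun s => A (g s) * B' s + B (g s) * (A' s)^*).
have h x y : a * x + 0 * y = a * x by rewrite mul0r addr0.
split.
- rewrite -(h a' b'^*); apply: tendsD; first exact: tendsM (tends_comp cg cA) cA'.
  exact: tendsM (tends_comp cg cB) (tends_conj cB').
- rewrite -(h b' a'^*); apply: tendsD; first exact: tendsM (tends_comp cg cA) cB'.
  exact: tendsM (tends_comp cg cB) (tends_conj cA').
- near=> s.
  have -> : f (g s) = f (g t) + A (g s) * (g s - g t) + B (g s) * (g s - g t)^* by near: s.
  have -> : g s - g t = A' s * (s - t) + B' s * (s - t)^*.
    have -> : g s = g t + A' s * (s - t) + B' s * (s - t)^* by near: s.
    by ring.
  by move: (s - t) => d; rewrite conjD !conjM conjCK; ring.
Unshelve. all: by end_near. Qed.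

(** The bound makes products of such germs stay in the class, and a germ with
    b = 0 is a holomorphic one. *)
Definition wgerm (f a b : C -> C) := exists K : R,
  \forall s \near (0 : C), [/\ wder f s (a s) (b s), `|a s| <= K%:C & `|b s| <= K%:C].

Lemma wgerm_wder f a b : wgerm f a b -> wder f 0 (a 0) (b 0).
Proof. by move=> [K /nbhs_singleton[]]. Qed.

Lemma wgerm_near f a b : wgerm f a b -> \forall s \near (0 : C), wder f s (a s) (b s).
Proof. by move=> [K]; apply: filterS => s []. Qed.

Lemma wgerm_bounded f a b : wgerm f a b ->
  exists K : R, \forall s \near (0 : C), `|f s| <= K%:C.
Proof. by move=> /wgerm_wder/wder_cont; exact: tends_bounded. Qed.

Lemma holo_wgerm (f f' : C -> C) : holo f f' <-> wgerm f f' (fun=> 0).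
Proof.
split=> [[K H]|[K H]]; exists K; apply: filterS H => s []; last by [].
by move=> d b; split=> //; rewrite normr0; exact: le_trans b.
Qed.

Lemma wgerm_ext f g a b a' b' : wgerm f a b ->
  (\forall s \near (0 : C), [/\ f s = g s, a s = a' s & b s = b' s]) -> wgerm g a' b'.
Proof.
move=> [K H] E; exists K; apply: filterS3 H E (near_near E) => s [d ba bb] [_ <- <-] E'.
by split=> //; apply: wder_ext d _ _ _ => //; apply: filterS E' => u [].
Qed.

Lemma wgerm_cst c : wgerm (fun=> c) (fun=> 0) (fun=> 0).
Proof.
exists 0; apply: nearC => s; rewrite normr0; split=> //; exact: wder_cst.
Qed.

Lemma wgerm_id : wgerm (fun s => s) (fun=> 1) (fun=> 0).
Proof.
exists 1; apply: nearC => s; rewrite normr0 normr1; split=> //; exact: wder_id.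
Qed.

Lemma wgermD f g a b a' b' : wgerm f a b -> wgerm g a' b' ->
  wgerm (fun s => f s + g s) (fun s => a s + a' s) (fun s => b s + b' s).
Proof.
move=> [K H] [K' H']; exists (K + K'); apply: filterS2 H H' => s [d h1 h2] [d' h1' h2'].
rewrite rcD; split; first exact: wderD.
- by apply: le_trans (ler_normD _ _) _; exact: lerD.
- by apply: le_trans (ler_normD _ _) _; exact: lerD.
Qed.

Lemma bounded_mul (f g : C -> C) (K K' : R) (s : C) :
  `|f s| <= K%:C -> `|g s| <= K'%:C -> `|f s * g s| <= (K * K')%:C.
Proof. by move=> h h'; rewrite normrM rcM; exact: ler_pM. Qed.

Lemma wgermM f g a b a' b' : wgerm f a b -> wgerm g a' b' ->
  wgerm (fun s => f s * g s) (fun s => a s * g s + f s * a' s) (fun s => b s * g s + f s * b' s).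
Proof.
move=> hf hg; have [Kf bf] := wgerm_bounded hf; have [Kg bg] := wgerm_bounded hg.
move: hf hg => [K H] [K' H']; exists (K * Kg + Kf * K').
near=> s; have [d h1 h2] : [/\ wder f s (a s) (b s), `|a s| <= K%:C & `|b s| <= K%:C] by near: s.
have [d' h1' h2'] : [/\ wder g s (a' s) (b' s), `|a' s| <= K'%:C & `|b' s| <= K'%:C] by near: s.
have fs : `|f s| <= Kf%:C by near: s.
have gs : `|g s| <= Kg%:C by near: s.
rewrite rcD; split; first exact: wderM.
- by apply: le_trans (ler_normD _ _) _; apply: lerD; exact: bounded_mul.
- by apply: le_trans (ler_normD _ _) _; apply: lerD; exact: bounded_mul.
Unshelve. all: by end_near. Qed.

Lemma wgerm_conj f a b : wgerm f a b ->
  wgerm (fun s => (f s)^*) (fun s => (b s)^*) (fun s => (a s)^*).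
Proof.
move=> [K H]; exists K; apply: filterS H => s [d h1 h2].
by split; rewrite ?norm_conjC//; exact: wder_conj.
Qed.

Lemma wgermZ c f a b : wgerm f a b ->
  wgerm (fun s => c * f s) (fun s => c * a s) (fun s => c * b s).
Proof.
move=> h; apply: wgerm_ext (wgermM (wgerm_cst c) h) _.
by apply: nearC => s; split; ring.
Qed.

Lemma wgermN f a b : wgerm f a b ->
  wgerm (fun s => - f s) (fun s => - a s) (fun s => - b s).
Proof.
move=> h; apply: wgerm_ext (wgermZ (-1) h) _.
by apply: nearC => s; split; ring.
Qed.

Lemma wgermB f g a b a' b' : wgerm f a b -> wgerm g a' b' ->
  wgerm (fun s => f s - g s) (fun s => a s - a' s) (fun s => b s - b' s).
Proof. by move=> hf /wgermN; exact: wgermD. Qed.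

Lemma wgermV f a b : wgerm f a b -> f 0 != 0 ->
  wgerm (fun s => (f s)^-1) (fun s => - a s / f s ^+ 2) (fun s => - b s / f s ^+ 2).
Proof.
move=> hf f0; have c := wder_cont (wgerm_wder hf).
have [K' bV] := tends_bounded (tendsV c f0); have nz : \forall s \near (0 : C), f s != 0 by exact: tends_neq0 c f0.
move: hf => [K H]; exists (K * (K' * K')).
near=> s; have [d h1 h2] : [/\ wder f s (a s) (b s), `|a s| <= K%:C & `|b s| <= K%:C] by near: s.
have fs : `|(f s)^-1| <= K'%:C by near: s.
have fn : f s != 0 by near: s.
split; first exact: wderV.
- rewrite mulNr normrN -exprVn normrM rcM; apply: ler_pM => //.
  by rewrite expr2; exact: (@bounded_mul (fun s => (f s)^-1) (fun s => (f s)^-1)).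
- rewrite mulNr normrN -exprVn normrM rcM; apply: ler_pM => //.
  by rewrite expr2; exact: (@bounded_mul (fun s => (f s)^-1) (fun s => (f s)^-1)).
Unshelve. all: by end_near. Qed.

Lemma wgerm_sum (I : Type) (r : seq I) (f a b : I -> C -> C) :
  (forall i, wgerm (f i) (a i) (b i)) ->
  wgerm (fun s => \sum_(i <- r) f i s) (fun s => \sum_(i <- r) a i s) (fun s => \sum_(i <- r) b i s).
Proof.
move=> h; elim: r => [|i r IH].
  by apply: wgerm_ext (wgerm_cst 0) _; apply: nearC => s; rewrite !big_nil.
by apply: wgerm_ext (wgermD (h i) IH) _; apply: nearC => s; rewrite !big_cons.
Qed.

Lemma wgerm_real (u : C -> R) (g g' : R -> R) a b :
  wgerm (fun s => (u s)%:C) a b -> (\forall y \near u 0, is_derive (y : R) 1 g (g' y)) ->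
  {for u 0, continuous g'} ->
  wgerm (fun s => (g (u s))%:C) (fun s => (g' (u s))%:C * a s) (fun s => (g' (u s))%:C * b s).
Proof.
move=> hu dg cg'; have cu : u s @[s --> (0 : C)] --> u 0.
  exact: (@cvg_Re R C (nbhs (0 : C)) (nbhs_filter _) _ _ (tends_cvg (wder_cont (wgerm_wder hu)))).
have tg : tends (nbhs (0 : C)) (fun s => (g' (u s))%:C) (g' (u 0))%:C.
  by split; apply: (@cvg_rc R C (nbhs (0 : C)) _); exact: (cvg_comp _ _ cu cg').
have [K' bg] := tends_bounded tg; have dgu := cu _ dg.
move: hu => [K H]; exists (K' * K).
near=> s; have [d h1 h2] : [/\ wder (fun s => (u s)%:C) s (a s) (b s), `|a s| <= K%:C & `|b s| <= K%:C] by near: s.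
have gs : `|(g' (u s))%:C| <= K'%:C by near: s.
have ds : is_derive (u s) 1 g (g' (u s)) by near: s.
split; first exact: wder_comp_real.
- exact: (@bounded_mul (fun s => (g' (u s))%:C) a).
- exact: (@bounded_mul (fun s => (g' (u s))%:C) b).
Unshelve. all: by end_near. Qed.

Lemma holo_ext (f g a a' : C -> C) : holo f a ->
  (\forall s \near (0 : C), f s = g s /\ a s = a' s) -> holo g a'.
Proof.
move=> /holo_wgerm h E; apply/holo_wgerm; apply: wgerm_ext h _.
by apply: filterS E => s [].
Qed.

Lemma holo_cst (c : C) : holo (fun=> c) (fun=> 0).
Proof. by apply/holo_wgerm; exact: wgerm_cst. Qed.

Lemma holo_id : holo (fun s : C => s) (fun=> 1).
Proof. by apply/holo_wgerm; exact: wgerm_id. Qed.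

Lemma holoD (f g a a' : C -> C) : holo f a -> holo g a' -> holo (fun s => f s + g s) (fun s => a s + a' s).
Proof.
move=> /holo_wgerm h /holo_wgerm h'; apply/holo_wgerm; apply: wgerm_ext (wgermD h h') _.
by apply: nearC => s; rewrite addr0.
Qed.

Lemma holoM (f g a a' : C -> C) : holo f a -> holo g a' ->
  holo (fun s => f s * g s) (fun s => a s * g s + f s * a' s).
Proof.
move=> /holo_wgerm h /holo_wgerm h'; apply/holo_wgerm; apply: wgerm_ext (wgermM h h') _.
by apply: nearC => s; split=> //; ring.
Qed.

Lemma holoZ (c : C) (f a : C -> C) : holo f a -> holo (fun s => c * f s) (fun s => c * a s).
Proof.
move=> h; apply: holo_ext (holoM (holo_cst c) h) _.
by apply: nearC => s; split=> //; ring.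
Qed.

Lemma holoB (f g a a' : C -> C) : holo f a -> holo g a' -> holo (fun s => f s - g s) (fun s => a s - a' s).
Proof.
move=> h h'; apply: holo_ext (holoD h (holoZ (-1) h')) _.
by apply: nearC => s; split; ring.
Qed.

Lemma holoV (f a : C -> C) : holo f a -> f 0 != 0 -> holo (fun s => (f s)^-1) (fun s => - a s / f s ^+ 2).
Proof.
move=> /holo_wgerm h f0; apply/holo_wgerm; apply: wgerm_ext (wgermV h f0) _.
by apply: nearC => s; split=> //; ring.
Qed.

Lemma holo_sum (I : Type) (r : seq I) (f a : I -> C -> C) :
  (forall i, holo (f i) (a i)) ->
  holo (fun s => \sum_(i <- r) f i s) (fun s => \sum_(i <- r) a i s).
Proof.
move=> h; apply/holo_wgerm.
apply: wgerm_ext (wgerm_sum r (fun i => (holo_wgerm _ _).1 (h i))) _.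
by apply: nearC => s; split=> //; rewrite big1.
Qed.

Lemma holo_poly (p : {poly C}) : exists p', holo (fun s => p.[s]) p'.
Proof.
elim/poly_ind: p => [|p c [p' h]].
  by exists (fun=> 0); apply: holo_ext (holo_cst 0) _; apply: nearC => s; rewrite horner0.
eexists; apply: holo_ext (holoD (holoM h holo_id) (holo_cst c)) _.
by apply: nearC => s; split; [rewrite hornerMXaddC|].
Qed.

Definition cexp (z : C) : C := (expR (Re z))%:C * cis (Im z).

Lemma wder_Re t : wder (fun s => (Re s)%:C) t (1 / 2) (1 / 2).
Proof.
apply: wder_ext (wderZ (1 / 2) (wderD (wder_id t) (wder_conj (wder_id t)))) _ _ _.
- by rewrite rmorph0 addr0 mulr1.
- by rewrite rmorph1 add0r mulr1.
- by apply: nearC => s; rewrite [LHS](_ : _ = (s + s^*) / 2) ?ReJ_add//; ring.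
Qed.

Lemma wder_Im t : wder (fun s => (Im s)%:C) t (- 'i / 2) ('i / 2).
Proof.
have i2 : 'i * 'i = -1 :> C by rewrite -expr2 sqrCi.
apply: wder_ext (wderZ (- 'i) (wderB (wder_id t) (wder_Re t))) _ _ _.
- by field.
- by field.
- apply: nearC => s; rewrite [X in X - _]split_ReIm.
  transitivity (- ('i * 'i) * (Im s)%:C); first by ring.
  by rewrite i2; ring.
Qed.

Lemma normsq_cexp z : cexp z * (cexp z)^* = (expR (2 * Re z))%:C.
Proof.
have -> : cexp z * (cexp z)^* = `|cexp z| ^+ 2 by rewrite normCK.
by rewrite /cexp normrM norm_cis mulr1 norm_rc -rcX ger0_norm ?expR_ge0// -expRM_natl.
Qed.

Lemma cexp_neq0 z : cexp z != 0.
Proof.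
rewrite -normr_eq0 /cexp normrM norm_cis mulr1 norm_rc rc_eq0 normr_eq0.
by rewrite gt_eqF ?expR_gt0.
Qed.

Lemma wder_cexp t : wder cexp t (cexp t) 0.
Proof.
have i2 : 'i * 'i = -1 :> C by rewrite -expr2 sqrCi.
have d1 := wder_comp_real (wder_Re t) (is_derive_expR (Re t)).
have d2 := wder_comp_real (wder_Im t) (is_derive_cos (Im t)).
have d3 := wder_comp_real (wder_Im t) (is_derive_sin (Im t)).
apply: wder_ext (wderM d1 (wderD d2 (wderZ 'i d3))) _ _ _; last exact: nearC.
- rewrite /cexp /cis rcN.
  transitivity ((expR (Re t))%:C * (((cos (Im t))%:C + 'i * (sin (Im t))%:C) / 2
    + 'i / 2 * (sin (Im t))%:C - ('i * 'i) / 2 * (cos (Im t))%:C)); first by field.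
  by rewrite i2; field.
- rewrite rcN.
  transitivity ((expR (Re t))%:C * (((cos (Im t))%:C + 'i * (sin (Im t))%:C) / 2
    - 'i / 2 * (sin (Im t))%:C + ('i * 'i) / 2 * (cos (Im t))%:C)); first by field.
  by rewrite i2; field.
Qed.

Lemma holo_cexp (h h' : C -> C) : holo h h' -> holo (fun s => cexp (h s)) (fun s => cexp (h s) * h' s).
Proof.
move=> [K H]; have d0 := (nbhs_singleton H).1.
have [K' b] : exists K' : R, \forall s \near (0 : C), `|cexp (h s)| <= K'%:C.
  exact: tends_bounded (tends_comp (wder_cont d0) (wder_cont (wder_cexp _))).
exists (K' * K); apply: filterS2 H b => s [d bh] be; split.
  by apply: wder_ext (wder_comp (wder_cexp (h s)) d) _ _ _; rewrite ?mulr0//; exact: nearC.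
exact: (@bounded_mul (fun s => cexp (h s)) h').
Qed.

End Germs.

(** * Orders of vanishing and sums of squares *)

Section Jets.
Context {R : realType}.
Local Notation C := (Cplx R).
Local Notation "x %:C" := (real_complex_def (Phant R) x : C) (format "x %:C").
Local Notation Re := (@complex.Re R).

Definition nsq (z : C) : C := z * z^*.

Lemma nsq_ge0 z : 0 <= nsq z.
Proof. exact: mul_conjC_ge0. Qed.

Lemma nsq_eq0 z : (nsq z == 0) = (z == 0).
Proof. exact: mul_conjC_eq0. Qed.

Lemma nsqM z w : nsq (z * w) = nsq z * nsq w.
Proof. by rewrite /nsq conjM; ring. Qed.

Lemma le_linear_eq0 (c : C) (D d : R) : 0 < d ->
  (forall x : R, 0 < x < d -> `|c| <= (D * x)%:C) -> c = 0.
Proof.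
move=> d0 H; apply/eqP; rewrite -normr_eq0 -Re_normC rc_eq0; apply/eqP.
have y0 := Re_norm_ge0 c; apply/eqP; rewrite eq_le y0 andbT leNgt; apply/negP => y1.
set y := Re `|c| in y0 y1 *.
have D1 : 0 < `|D| + 1 by rewrite ltr_wpDl.
pose x := Num.min (d / 2) (y / (2 * (`|D| + 1))).
have x0 : 0 < x by rewrite lt_min !divr_gt0// mulr_gt0.
have xd : x < d by rewrite /x gt_min; apply/orP; left; lra.
have := H x; rewrite x0 xd => /(_ isT); rewrite -Re_normC lerC -/y.
apply/negP; rewrite -ltNge.
have h : D * x <= `|D| * x by rewrite ler_wpM2r ?ler_norm// ltW.
have h1 : (`|D| + 1) * x <= y / 2.
  have : x <= y / (2 * (`|D| + 1)) by rewrite /x ge_min lexx orbT.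
  rewrite -(ler_pM2l D1) => /le_trans; apply.
  by rewrite le_eqVlt; apply/orP; left; apply/eqP; field; rewrite gt_eqF.
have h2 : 0 <= x by exact: ltW.
lra.
Qed.

(** The constant term is O(x), hence zero; divide by the variable and repeat.
    *)
Lemma poly_small_coef (M : nat) (e : {poly C}) (K d : R) : 0 < d ->
  (forall x : R, 0 < x < d -> `|e.[x%:C]| <= (K * x ^+ M)%:C) ->
  forall k, (k < M)%N -> e`_k = 0.
Proof.
move=> d0; elim: M e => [//|M IH] e; elim/poly_ind: e => [|p c _] H k kM.
  by rewrite coef0.
have [B bp] : exists B : R, \forall s \near (0 : C), `|p.[s]| <= B%:C.
  have [p' [K' h]] := holo_poly p; exact: tends_bounded (wder_cont (nbhs_singleton h).1).
have [d' d'0 bp'] := near0_disc bp.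
have c0 : c = 0.
  pose dd := Num.min (Num.min d d') 1.
  have dd0 : 0 < dd by rewrite !lt_min d0 d'0 ltr01.
  apply: (@le_linear_eq0 c (`|K| + B) dd dd0) => x /andP[x0].
  rewrite !lt_min => /andP[/andP[xd xd'] x1].
  have := H x; rewrite x0 xd => /(_ isT); rewrite hornerMXaddC => h.
  have pb : `|p.[x%:C]| <= B%:C by apply: bp'; rewrite norm_rc ltrC gtr0_norm.
  rewrite -[c](addKr (p.[x%:C] * x%:C)) addrC.
  apply: le_trans (ler_normB _ _) _; rewrite mulrDl rcD; apply: lerD.
    apply: le_trans h _; rewrite lerC exprS.
    have xM : 0 <= x ^+ M <= 1.
      by rewrite exprn_ge0 ?exprn_ile1// ltW.
    have : K * (x * x ^+ M) <= `|K| * (x * x ^+ M).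
      by rewrite ler_wpM2r ?ler_norm// mulr_ge0 ?exprn_ge0// ltW.
    move/le_trans; apply; apply: ler_wpM2l => //.
    by apply: ler_piMr; [exact: ltW|case/andP: xM].
  by rewrite normrM norm_rc (gtr0_norm x0) rcM ler_wpM2r// -rc0 lerC ltW.
rewrite c0 addr0 coefMX; case: k kM => [//|k kM] /=.
apply: IH => // x xd; have := H x xd; rewrite c0 hornerMXaddC addr0 normrM norm_rc.
case/andP: xd => x0 _; rewrite (gtr0_norm x0) exprSr mulrA rcM.
by rewrite ler_pM2r// -rc0 ltrC.
Qed.

(** O(|t|^n) at the origin. *)
Definition vanish (n : nat) (f : C -> C) := exists K : R,
  \forall t \near (0 : C), `|f t| <= K%:C * `|t| ^+ n.

Section HermitianCoefficients.
Variable (L : seq (C * {poly C})).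

Let f (t : C) := \sum_(l <- L) l.1 * nsq l.2.[t].
Let c (a b : nat) := \sum_(l <- L) l.1 * (l.2`_a * (l.2`_b)^*).

(** On the real line spanned by w, the homogeneous part of degree d of f is
    the sum of c i (d - i) w^i wbar^(d - i), so that this sum vanishes for
    every w when d < M. Then w = 1 + i k gives infinitely many roots w / wbar
    of the polynomial with coefficients c i (d - i). *)
Lemma hermitian_coef (M a b : nat) : vanish M f -> (a + b < M)%N -> c a b = 0.
Proof.
move=> [K /near0_disc[rho rho0 H]].
have S w d : (d < M)%N -> \sum_(i < d.+1) c i (d - i) * (w ^+ i * w^* ^+ (d - i)) = 0.
  (* Restriction of the form to the line spanned by w is a polynomial e in the
     real parameter. *)
  move=> dM; pose sc (p : {poly C}) (u : C) := \poly_(i < size p) (p`_i * u ^+ i).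
  have scE p u i : (sc p u)`_i = p`_i * u ^+ i.
    rewrite coef_poly; case: ltnP => // h; by rewrite nth_default ?mul0r.
  have scH p u x : (sc p u).[x] = p.[x * u].
    rewrite horner_poly horner_coef; apply: eq_bigr => i _; rewrite exprMn; ring.
  pose e := \sum_(l <- L) l.1 *: (sc l.2 w * sc (map_poly Num.conj l.2) w^*).
  have eH (x : R) : e.[x%:C] = f (x%:C * w).
    rewrite /e horner_sum; apply: eq_bigr => l _.
    rewrite hornerZ hornerM !scH; congr (_ * (_ * _)).
    by rewrite -horner_map /= conjM conj_rc.
  have eC : e`_d = \sum_(i < d.+1) c i (d - i) * (w ^+ i * w^* ^+ (d - i)).
    rewrite coef_sum.
    under eq_bigr => l _.
      rewrite coefZ coefM mulr_sumr.
      under eq_bigr => i _.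
        rewrite !scE coef_map.
        over.
      over.
    rewrite exchange_big; apply: eq_bigr => i _ /=; rewrite /c mulr_suml.
    by apply: eq_bigr => l _ /=; ring.
  rewrite -eC.
  have w1 : 0 < Re `|w| + 1 by rewrite ltr_wpDl ?Re_norm_ge0.
  have dl0 : 0 < rho / (Re `|w| + 1) by rewrite divr_gt0.
  apply: (@poly_small_coef M e (K * (Re `|w|) ^+ M) _ dl0) => // x /andP[x0 xd].
  rewrite eH.
  have Ex : `|x%:C * w| = (x * Re `|w|)%:C by rewrite normrM norm_rc (gtr0_norm x0) -Re_normC rcM.
  apply: le_trans (H _ _) _.
    rewrite Ex ltrC; move: xd; rewrite ltr_pdivlMr// => h; apply: le_lt_trans h.
    by apply: ler_wpM2l; [exact: ltW|lra].
  rewrite Ex -rcX -rcM lerC le_eqVlt; apply/orP; left; apply/eqP.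
  by rewrite exprMn; ring.
move=> abM; pose d := (a + b)%N.
pose P := \poly_(i < d.+1) c i (d - i).
have ii : 'i * 'i = -1 :> C by rewrite -expr2 sqrCi.
pose w k : C := 1 + 'i * k%:R; pose w' k : C := 1 - 'i * k%:R.
have ww k : (w k)^* = w' k.
  by rewrite /w /w' conjD conjM conjCi rmorph1 conjC_nat mulNr.
have w'0 k : w' k != 0.
  have E : w k * w' k = 1 + (k * k)%:R.
    rewrite natrM /w /w'; transitivity (1 - ('i * 'i) * (k%:R * k%:R) : C); first by ring.
    by rewrite ii; ring.
  apply/eqP => h; move: E; rewrite h mulr0 => /esym/eqP.
  by rewrite -[1]/(1%:R) -natrD pnatr_eq0.
have Pr k : root P (w k / w' k).
  apply/rootP; rewrite horner_poly.
  have := S (w k) d abM; rewrite ww => h.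
  apply: (mulIf (expf_neq0 d (w'0 k))); rewrite mul0r -[RHS]h mulr_suml.
  apply: eq_bigr => i _; rewrite -mulrA; congr (_ * _).
  have id : (i <= d)%N by rewrite -ltnS.
  rewrite -{2}(subnK id) addnC exprD expr_div_n; field.
  by rewrite expf_neq0.
have inj : injective (fun k => w k / w' k).
  move=> j k /= /eqP; rewrite eqr_div// => /eqP E.
  have : 2 * 'i * (j%:R - k%:R) = 0 :> C.
    have -> : 2 * 'i * (j%:R - k%:R) = w j * w' k - w k * w' j :> C by rewrite /w /w'; ring.
    by rewrite E; ring.
  by move/eqP; rewrite !mulf_eq0 (negbTE (@neq0Ci C)) pnatr_eq0 /= subr_eq0 eqr_nat => /eqP.
have P0 : P = 0.
  apply/eqP/negPn/negP => Pn.
  pose rs := map (fun k => w k / w' k) (iota 0 d.+1).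
  have a1 : all (root P) rs by apply/allP => _ /mapP[k _ ->]; exact: Pr.
  have a2 : uniq rs by rewrite map_inj_uniq// iota_uniq.
  by have := max_poly_roots Pn a1 a2; rewrite size_map size_iota ltnNge size_poly.
have : P`_a = 0 by rewrite P0 coef0.
by rewrite coef_poly ltnS leq_addr addKn.
Qed.

(** Pairing the Taylor coefficients of f with v and its conjugate only
    involves monomials t^a tbar^b with a, b < n. *)
Lemma hermitian_pairing (n : nat) (v : 'I_n -> C) : vanish (n + n) f ->
  \sum_(l <- L) l.1 * nsq (\sum_(a < n) v a * l.2`_a) = 0.
Proof.
move=> Of; transitivity (\sum_(a < n) \sum_(b < n) v a * (v b)^* * c a b).
  under [RHS]eq_bigr => a _ do (under eq_bigr => b _ do rewrite mulr_sumr).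
  under [RHS]eq_bigr => a _ do rewrite exchange_big.
  rewrite exchange_big /=; apply: eq_bigr => l _.
  rewrite /nsq rmorph_sum /= mulr_suml mulr_sumr; apply: eq_bigr => a _.
  rewrite mulr_sumr mulr_sumr; apply: eq_bigr => b _.
  by rewrite conjM; ring.
rewrite big1// => a _; rewrite big1// => b _.
rewrite (hermitian_coef Of) ?mulr0//.
have := ltn_ord b; rewrite -(ltn_add2l a) => /ltn_trans; apply.
by rewrite ltn_add2r.
Qed.

End HermitianCoefficients.

(** The matrices of Taylor coefficients of the two sums would agree up to
    order n. The n polynomials q k, of lowest degree k, are in echelon form
    and make a Hermitian matrix of rank n, to which ps adds a nonnegative one;
    fewer than n squares cannot produce it. *)
Lemma hermitian_rank (n : nat) (q : nat -> {poly C}) (ps bs : seq {poly C}) :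
  (forall k a, (a < k)%N -> (q k)`_a = 0) -> (forall k, (q k)`_k != 0) ->
  (size bs < n)%N ->
  ~ vanish (n + n) (fun t => \sum_(0 <= k < n) nsq (q k).[t]
       + \sum_(p <- ps) nsq p.[t] - \sum_(b <- bs) nsq b.[t]).
Proof.
move=> qlow qlead sb Of.
pose Bm := \matrix_(a < n, j < size bs) (bs`_j)`_a.
(* A vector v orthogonal to the jets of all bs: there are fewer of them than
   coordinates. *)
have : kermx Bm != 0.
  rewrite kermx_eq0 /row_free; apply/eqP => h.
  by move: sb; rewrite -h ltnNge rank_leq_col.
move=> /rowV0Pn[v /sub_kermxP vB v0].
pose L := [seq ((1 : C), q k) | k <- index_iota 0 n] ++ [seq ((1 : C), p) | p <- ps]
  ++ [seq ((- 1 : C), b) | b <- bs].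
have OL : vanish (n + n) (fun t => \sum_(l <- L) l.1 * nsq l.2.[t]).
  have -> : (fun t => \sum_(l <- L) l.1 * nsq l.2.[t]) = (fun t => \sum_(0 <= k < n) nsq (q k).[t]
       + \sum_(p <- ps) nsq p.[t] - \sum_(b <- bs) nsq b.[t]).
    apply/funext => t; rewrite !big_cat !big_map /= addrA -sumrN.
    by congr (_ + _ + _); apply: eq_bigr => i _; rewrite ?mul1r ?mulN1r.
  exact: Of.
have := hermitian_pairing (v 0) OL.
rewrite !big_cat !big_map /=.
rewrite [X in _ + (_ + X)]big_seq [X in _ + (_ + X)]big1 => [|b bin]; last first.
  have ib : (index b bs < size bs)%N by rewrite index_mem.
  have /rowP/(_ (Ordinal ib)) := vB; rewrite !mxE => h.
  have -> : \sum_(a < n) v 0 a * b`_a = 0.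
    by rewrite -[RHS]h; apply: eq_bigr => a _; rewrite mxE /= nth_index.
  by rewrite /nsq mul0r mulr0.
rewrite addr0 => /eqP; rewrite paddr_eq0; last 2 first.
- by apply: sumr_ge0 => k _; rewrite mul1r nsq_ge0.
- by apply: sumr_ge0 => k _; rewrite mul1r nsq_ge0.
case/andP=> /eqP h _.
have {}h k : (k < n)%N -> \sum_(a < n) v 0 a * (q k)`_a = 0.
  move=> kn; move: h; rewrite big_mkord => /eqP; rewrite psumr_eq0; last first.
    by move=> i _; rewrite mul1r nsq_ge0.
  by move=> /allP/(_ (Ordinal kn) (mem_index_enum _)); rewrite /= mul1r nsq_eq0 => /eqP.
(* Pairing v with q k for the last k such that v k is not zero leaves the
   single term v k times the leading coefficient of q k. *)
have [k vk kmax] : exists2 k : 'I_n, v 0 k != 0 & forall a : 'I_n, (k < a)%N -> v 0 a = 0.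
  have [i vi] : exists i : 'I_n, v 0 i != 0 by apply/rV0Pn.
  case: (@arg_maxnP _ i (fun i => v 0 i != 0) (fun i => i : nat) vi) => k vk kmax.
  exists k => // a ka; apply/eqP/negPn/negP => /kmax ak.
  by have : (a <= k)%N by []; rewrite leqNgt ka.
have := h k (ltn_ord k); rewrite (bigD1 k)//= big1 => [|a ak].
  by rewrite addr0 => /eqP; rewrite mulf_eq0 (negbTE vk) (negbTE (qlead k)).
have [ka|ka|ka] := ltngtP k a.
- by rewrite kmax// mul0r.
- by rewrite qlow ?mulr0.
- by move: ak; rewrite (ord_inj ka) eqxx.
Qed.

Lemma vanish_ext n (f g : C -> C) : vanish n f -> (\forall t \near (0 : C), f t = g t) -> vanish n g.
Proof. by move=> [K H] E; exists K; apply: filterS2 H E => t h <-. Qed.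

Lemma vanish_le n m (f : C -> C) : (m <= n)%N -> vanish n f -> vanish m f.
Proof.
move=> mn [K H]; have h1 := near0_norm_lt (@ltr01 R).
have K0 : 0 <= K%:C \/ \forall t \near (0 : C), f t = 0.
  case: (leP 0 K) => K0; first by left; rewrite -rc0 lerC.
  right; apply: filterS H => t h; apply/eqP; rewrite -normr_le0.
  by apply: le_trans h _; rewrite mulr_le0_ge0// -rc0 lerC ltW.
case: K0 => [K0|f0].
  exists K; apply: filterS2 H h1 => t h t1; apply: le_trans h _; apply: ler_wpM2l => //.
  by apply: ler_wiXn2l => //; rewrite -rc1; exact: ltW.
exists (0 : R); by apply: filterS f0 => t ->; rewrite normr0 mul0r.
Qed.

Lemma vanish_bounded (f : C -> C) : vanish 0 f <-> exists K : R, \forall t \near (0 : C), `|f t| <= K%:C.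
Proof. by split=> -[K H]; exists K; apply: filterS H => t; rewrite expr0 mulr1. Qed.

Lemma vanish0 n : vanish n (fun=> 0).
Proof. by exists (0 : R); apply: nearC => t; rewrite normr0 mul0r. Qed.

Lemma vanishD n (f g : C -> C) : vanish n f -> vanish n g -> vanish n (fun t => f t + g t).
Proof.
move=> [K H] [K' H']; exists (K + K'); apply: filterS2 H H' => t h h'.
by apply: le_trans (ler_normD _ _) _; rewrite rcD mulrDl; exact: lerD.
Qed.

Lemma vanishM n m (f g : C -> C) : vanish n f -> vanish m g -> vanish (n + m) (fun t => f t * g t).
Proof.
move=> [K H] [K' H']; exists (K * K'); apply: filterS2 H H' => t h h'.
rewrite normrM rcM exprD mulrACA; exact: ler_pM.
Qed.

Lemma vanishMl n (f g : C -> C) : vanish n f -> vanish 0 g -> vanish n (fun t => f t * g t).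
Proof. by move=> hf hg; have := vanishM hf hg; rewrite addn0. Qed.

Lemma vanish_cst (c : C) : vanish 0 (fun=> c).
Proof. by exists (Re `|c|); apply: nearC => t; rewrite Re_normC expr0 mulr1. Qed.

Lemma vanishZ n (c : C) (f : C -> C) : vanish n f -> vanish n (fun t => c * f t).
Proof. by move=> h; exact: vanishM (vanish_cst c) h. Qed.

Lemma vanishN n (f : C -> C) : vanish n f -> vanish n (fun t => - f t).
Proof. by move=> /(vanishZ (-1)) h; apply: vanish_ext h _; apply: nearC => t; rewrite mulN1r. Qed.

Lemma vanishB n (f g : C -> C) : vanish n f -> vanish n g -> vanish n (fun t => f t - g t).
Proof. by move=> hf /vanishN; exact: vanishD. Qed.

Lemma vanish_conj n (f : C -> C) : vanish n f -> vanish n (fun t => (f t)^*).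
Proof. by move=> [K H]; exists K; apply: filterS H => t; rewrite norm_conjC. Qed.

Lemma vanish_sum n (I : Type) (r : seq I) (f : I -> C -> C) :
  (forall i, vanish n (f i)) -> vanish n (fun t => \sum_(i <- r) f i t).
Proof.
move=> h; elim: r => [|i r IH].
  by apply: vanish_ext (vanish0 n) _; apply: nearC => t; rewrite big_nil.
by apply: vanish_ext (vanishD (h i) IH) _; apply: nearC => t; rewrite big_cons.
Qed.

Lemma vanishX n m (f : C -> C) : vanish n f -> vanish (n * m) (fun t => f t ^+ m).
Proof.
move=> h; elim: m => [|m IH]; first by rewrite muln0; exact: vanish_cst.
rewrite mulnS; apply: vanish_ext (vanishM h IH) _; apply: nearC => t; by rewrite exprS.
Qed.

Lemma wder_vanish f (a b : C) : wder f 0 a b -> f 0 = 0 -> vanish 1 f.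
Proof.
move=> [A [B [cA cB E]]] f0; have [K HA] := tends_bounded cA; have [K' HB] := tends_bounded cB.
exists (K + K'); near=> t.
have -> : f t = f 0 + A t * (t - 0) + B t * (t - 0)^* by near: t.
rewrite f0 add0r subr0 expr1 rcD mulrDl.
have hA : `|A t| <= K%:C by near: t.
have hB : `|B t| <= K'%:C by near: t.
apply: le_trans (ler_normD _ _) _; rewrite !normrM norm_conjC.
by apply: lerD; exact: ler_wpM2r.
Unshelve. all: by end_near. Qed.

Lemma wder_vanish0 f (a b : C) : wder f 0 a b -> vanish 0 f.
Proof. by move=> /wder_cont/tends_bounded/vanish_bounded. Qed.

Lemma poly_vanish0 (p : {poly C}) : vanish 0 (fun t => p.[t]).
Proof. by have [p' [K /nbhs_singleton[d _]]] := holo_poly p; exact: wder_vanish0 d. Qed.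

(** Nonnegativity in the sense of Hermitian forms, checked on jets of order M:
    being a sum of squared moduli is stable under products and positive
    combinations. *)
Definition sos (M : nat) (f : C -> C) := exists ps : seq {poly C},
  vanish M (fun t => f t - \sum_(p <- ps) nsq p.[t]).

Lemma sos_ext M f g : sos M f -> vanish M (fun t => f t - g t) -> sos M g.
Proof.
move=> [ps h] E; exists ps; apply: vanish_ext (vanishB h E) _.
by apply: nearC => t; ring.
Qed.

Lemma sosD M f g : sos M f -> sos M g -> sos M (fun t => f t + g t).
Proof.
move=> [ps h] [qs h']; exists (ps ++ qs); apply: vanish_ext (vanishD h h') _.
by apply: nearC => t; rewrite big_cat /=; ring.
Qed.

Lemma nsq_vanish0 (ps : seq {poly C}) : vanish 0 (fun t => \sum_(p <- ps) nsq p.[t]).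
Proof.
apply: vanish_sum => p.
exact: vanishM (poly_vanish0 p) (vanish_conj (poly_vanish0 p)).
Qed.

Lemma sos_bounded M f : sos M f -> vanish 0 f.
Proof.
move=> [ps h]; apply: vanish_ext (vanishD (vanish_le (leq0n M) h) (nsq_vanish0 ps)) _.
by apply: nearC => t; ring.
Qed.

Lemma sosM M f g : sos M f -> sos M g -> sos M (fun t => f t * g t).
Proof.
move=> sf sg; have bf := sos_bounded sf; move: sf sg => [ps h] [qs h'].
exists [seq p * q | p <- ps, q <- qs].
apply: vanish_ext (vanishD (vanishMl h' bf) (vanishMl h (nsq_vanish0 qs))) _.
apply: nearC => t; rewrite big_allpairs_dep /=.
have -> : \sum_(p <- ps) \sum_(q <- qs) nsq (p * q).[t] =
   (\sum_(p <- ps) nsq p.[t]) * (\sum_(q <- qs) nsq q.[t]).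
  rewrite mulr_suml; apply: eq_bigr => p _; rewrite mulr_sumr; apply: eq_bigr => q _.
  by rewrite hornerM nsqM.
ring.
Qed.

Lemma sos0 M : sos M (fun=> 0).
Proof. by exists [::]; apply: vanish_ext (vanish0 M) _; apply: nearC => t; rewrite big_nil subr0. Qed.

Lemma sos_cst M (r : R) : 0 <= r -> sos M (fun=> r%:C).
Proof.
move=> r0; exists [:: (Num.sqrt r)%:C%:P]; apply: vanish_ext (vanish0 M) _; apply: nearC => t.
by rewrite big_seq1 hornerC /nsq conj_rc -rcM -expr2 sqr_sqrtr// subrr.
Qed.

Lemma sosZ M (r : R) f : 0 <= r -> sos M f -> sos M (fun t => r%:C * f t).
Proof. by move=> r0; exact: sosM (sos_cst M r0). Qed.

Lemma sosX M f k : sos M f -> sos M (fun t => f t ^+ k).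
Proof.
move=> h; elim: k => [|k IH]; first by exact: (sos_cst M (@ler01 R)).
apply: sos_ext (sosM h IH) _; apply: vanish_ext (vanish0 M) _; apply: nearC => t.
by rewrite exprS subrr.
Qed.

Lemma sos_sum M (I : Type) (r : seq I) (f : I -> C -> C) :
  (forall i, sos M (f i)) -> sos M (fun t => \sum_(i <- r) f i t).
Proof.
move=> h; elim: r => [|i r IH].
  by apply: sos_ext (sos0 M) _; apply: vanish_ext (vanish0 M) _; apply: nearC => t; rewrite big_nil subrr.
apply: sos_ext (sosD (h i) IH) _; apply: vanish_ext (vanish0 M) _; apply: nearC => t.
by rewrite big_cons subrr.
Qed.

Lemma nsq_jet M f (p : {poly C}) : vanish M (fun t => f t - p.[t]) ->
  vanish M (fun t => nsq (f t) - nsq p.[t]).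
Proof.
move=> h; have bp := poly_vanish0 p.
have bf : vanish 0 f.
  apply: vanish_ext (vanishD (vanish_le (leq0n M) h) bp) _.
  by apply: nearC => t; ring.
apply: vanish_ext (vanishD (vanishMl h (vanish_conj bf)) (vanishMl (vanish_conj h) bp)) _.
by apply: nearC => t; rewrite /nsq rmorphB /=; ring.
Qed.

Lemma holo_jet M (f f' : C -> C) : holo f f' -> exists p : {poly C}, vanish M (fun t => f t - p.[t]).
Proof. by move=> /(holo_taylor M)[p h]; exists p. Qed.

Lemma sos_holo M (f f' : C -> C) : holo f f' -> sos M (fun t => nsq (f t)).
Proof.
move=> /(holo_jet M)[p h]; exists [:: p].
by apply: vanish_ext (nsq_jet h) _; apply: nearC => t; rewrite big_seq1.
Qed.

End Jets.

(** * Exponential and logarithm of sums of squares *)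

Section Expansions.
Context {R : realType}.
Local Notation C := (Cplx R).
Local Notation "x %:C" := (real_complex_def (Phant R) x : C) (format "x %:C").
Local Notation Re := (@complex.Re R).

Lemma derive_bound (g g' : R -> R) (K : R) (M : nat) :
  (forall y, `|y| <= 1 / 2 -> is_derive (y : R) 1 g (g' y) /\ `|g' y| <= K * `|y| ^+ M) ->
  g 0 = 0 -> forall y, `|y| <= 1 / 2 -> `|g y| <= K * `|y| ^+ M.+1.
Proof.
move=> H g0 y hy; have K0 : 0 <= K * (1 / 2) ^+ M.
  have E : `|1 / 2 : R| = 1 / 2 by rewrite ger0_norm//; lra.
  have [|_ h] := H (1 / 2); first by rewrite E.
  by rewrite E in h; exact: le_trans (normr_ge0 _) h.
have {}K0 : 0 <= K by move: K0; rewrite pmulr_lge0// exprn_gt0//; lra.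
have cg a b : (forall x, a <= x <= b -> `|x| <= 1 / 2) -> {within `[a, b], continuous g}.
  move=> ab; apply: derivable_within_continuous => x; rewrite in_itv /= => /ab hx.
  by have [[]] := H x hx.
have bnd c : `|c| <= `|y| -> `|g' c * y| <= K * `|y| ^+ M.+1.
  move=> cy; rewrite normrM exprSr mulrA ler_wpM2r//.
  have [_ h] := H c (le_trans cy hy); apply: le_trans h _.
  by rewrite ler_wpM2l//; apply: lerXn2r; rewrite ?nnegrE.
have [y0|y0|y0] := ltgtP y 0.
- have hh x : y <= x <= 0 -> `|x| <= `|y|.
    by move=> /andP[h1 h2]; rewrite !ler0_norm// ?lerN2//; exact: ltW.
  have [x|c] := @MVT R g g' y 0 y0 _ (cg _ _ (fun x h => le_trans (hh x h) hy)).
    by rewrite in_itv /= => /andP[h1 h2]; have [] := H x _; rewrite ?(le_trans (hh x _) hy) ?(ltW h1) ?(ltW h2).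
  rewrite in_itv /= => /andP[h1 h2]; rewrite g0 !sub0r mulrN => /oppr_inj ->.
  by apply: bnd; apply: hh; rewrite !ltW.
- have hh x : 0 <= x <= y -> `|x| <= `|y|.
    by move=> /andP[h1 h2]; rewrite !ger0_norm//; exact: ltW.
  have [x|c] := @MVT R g g' 0 y y0 _ (cg _ _ (fun x h => le_trans (hh x h) hy)).
    by rewrite in_itv /= => /andP[h1 h2]; have [] := H x _; rewrite ?(le_trans (hh x _) hy) ?(ltW h1) ?(ltW h2).
  rewrite in_itv /= => /andP[h1 h2]; rewrite g0 !subr0 => ->.
  by apply: bnd; apply: hh; rewrite !ltW.
- by rewrite y0 g0 !normr0 mulr_ge0// exprn_ge0.
Qed.

Lemma is_derive_powZ (c : R) n (y : R) :
  is_derive y 1 (fun x : R => c * x ^+ n.+1) (c * (n.+1%:R * y ^+ n)).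
Proof.
have h : is_derive y 1 (fun x : R => x ^+ n.+1) (n.+1%:R * y ^+ n).
  have := @is_deriveX R R (@id R) n.+1 y 1 1 (is_derive_id y 1).
  by rewrite exprfctE -[_ *: _]/(_ * _) mulr1.
exact: (is_deriveZ c h).
Qed.

Definition exp_sum (M : nat) (y : R) : R := \sum_(0 <= k < M) (k`!%:R)^-1 * y ^+ k.

Lemma is_derive_exp_sum M (y : R) : is_derive y 1 (exp_sum M.+1) (exp_sum M y).
Proof.
elim: M => [|M IH].
  have -> : exp_sum 1 = fun=> 1.
    by apply/funext => x; rewrite /exp_sum big_nat1 fact0 invr1 mul1r.
  by rewrite /exp_sum big_geq//; exact: is_derive_cst.
have -> : exp_sum M.+2 = (fun x => exp_sum M.+1 x + (M.+1`!%:R)^-1 * x ^+ M.+1).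
  by apply/funext => x; rewrite /exp_sum big_nat_recr.
have -> : exp_sum M.+1 y = exp_sum M y + (M.+1`!%:R)^-1 * (M.+1%:R * y ^+ M).
  rewrite {1}/exp_sum big_nat_recr//=; congr (_ + _); rewrite factS natrM; field.
  by rewrite pnatr_eq0 -lt0n fact_gt0 /= -[1]/(1%:R) -natrD pnatr_eq0.
by apply: is_deriveD; exact: is_derive_powZ.
Qed.

(** Induction on M: the derivative of the remainder at order M + 1 is the
    remainder at order M. *)
Lemma exp_taylor (M : nat) : exists K : R, forall y : R, `|y| <= 1 / 2 ->
  `|expR y - exp_sum M y| <= K * `|y| ^+ M.
Proof.
exists (expR 1); elim: M => [|M IH] y hy.
  rewrite /exp_sum big_geq// subr0 expr0 mulr1 ger0_norm ?expR_ge0// ler_expR.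
  by have := ler_norm y; lra.
apply: (@derive_bound (fun y => expR y - exp_sum M.+1 y) (fun y => expR y - exp_sum M y)) => //.
  move=> x hx; split; last exact: IH.
  by apply: is_deriveB; exact: is_derive_exp_sum.
rewrite expR0 /exp_sum big_nat_recl// big1_seq ?addr0.
  by rewrite expr0 fact0 invr1 mulr1 subrr.
by move=> i _; rewrite exprS mul0r mulr0.
Qed.

Definition nlog_sum (M : nat) (y : R) : R := \sum_(0 <= k < M) (k.+1%:R)^-1 * y ^+ k.+1.

(** The derivative of the remainder is 1 / (1 - y) minus a geometric sum, that
    is y^M / (1 - y), at most 2 |y|^M in absolute value. *)
Lemma nlog_taylor (M : nat) : forall y : R, `|y| <= 1 / 2 ->
  `|- ln (1 - y) - nlog_sum M y| <= 2 * `|y| ^+ M.+1.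
Proof.
have dS (y : R) : is_derive y 1 (nlog_sum M) (\sum_(0 <= k < M) y ^+ k).
  elim: M => [|M' IH].
    have -> : nlog_sum 0 = fun=> 0 by apply/funext => x; rewrite /nlog_sum big_geq.
    by rewrite big_geq//; exact: is_derive_cst.
  have -> : nlog_sum M'.+1 = (fun x => nlog_sum M' x + (M'.+1%:R)^-1 * x ^+ M'.+1).
    by apply/funext => x; rewrite /nlog_sum big_nat_recr.
  rewrite big_nat_recr//=; apply: is_deriveD.
  apply: is_derive_eq; first exact: is_derive_powZ.
  by rewrite mulrA mulVf ?mul1r// pnatr_eq0.
have geo (y : R) : (1 - y) * (\sum_(0 <= k < M) y ^+ k) = 1 - y ^+ M.
  elim: (M) => [|M' IH]; first by rewrite big_geq// mulr0 expr0 subrr.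
  by rewrite big_nat_recr//= mulrDr IH exprS; ring.
apply: (@derive_bound (fun y => - ln (1 - y) - nlog_sum M y) (fun y => y ^+ M / (1 - y))).
  move=> y; rewrite ler_norml => /andP[h1 h2]; have y1 : 0 < 1 - y by lra.
  have y1n : 1 - y != 0 by rewrite gt_eqF.
  split.
    have -> : y ^+ M / (1 - y) = - (((1 - y)^-1) * (0 - 1)) - \sum_(0 <= k < M) y ^+ k.
      apply: (mulIf y1n); rewrite divfK//.
      transitivity (1 - (1 - y) * (\sum_(0 <= k < M) y ^+ k)); first by rewrite geo; ring.
      by field.
    apply: is_deriveB; apply: is_deriveN.
    have dl := is_derive1_ln y1.
    have := @is_derive1_comp R (@ln R) (fun y => 1 - y) y _ _ dl.
    by rewrite /comp; apply.
  rewrite normrM normfV [`|1 - y|]gtr0_norm// normrX mulrC ler_wpM2r ?exprn_ge0//.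
  by rewrite -[leRHS]invrK lef_pV2 ?posrE//; lra.
rewrite subr0 ln1 oppr0 sub0r /nlog_sum big1 ?oppr0// => i _.
by rewrite exprS mul0r mulr0.
Qed.

Lemma near_half (u : C -> R) : vanish 1 (fun t => (u t)%:C) ->
  \forall t \near (0 : C), `|u t| <= 1 / 2.
Proof.
move=> [K H]; pose d : R := 1 / (2 * (`|K| + 1)).
have K1 : 0 < `|K| + 1 by rewrite ltr_wpDl.
have d0 : 0 < d by rewrite divr_gt0// mulr_gt0.
apply: filterS2 H (near0_norm_lt d0) => t; rewrite norm_rc expr1 -Re_normC -rcM lerC ltrC => h td.
apply: le_trans h _; apply: (@le_trans _ _ (`|K| * Re `|t|)).
  by rewrite ler_wpM2r ?ler_norm// Re_norm_ge0.
apply: (@le_trans _ _ ((`|K| + 1) * d)).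
  by apply: ler_pM; rewrite ?Re_norm_ge0 ?normr_ge0 ?lerDl// ltW.
by rewrite le_eqVlt; apply/orP; left; apply/eqP; rewrite /d; field; rewrite gt_eqF.
Qed.

Lemma vanish_real_comp (g : R -> R) (K : R) (M : nat) (u : C -> R) :
  (forall y, `|y| <= 1 / 2 -> `|g y| <= K * `|y| ^+ M) -> vanish 1 (fun t => (u t)%:C) ->
  vanish M (fun t => (g (u t))%:C).
Proof.
move=> H Ou; have hu := near_half Ou.
have := vanishX M Ou; rewrite mul1n => -[K' H'].
have K0 : 0 <= K.
  have := H (1 / 2); have E : `|1 / 2 : R| = 1 / 2 by rewrite ger0_norm//; lra.
  rewrite E lexx => /(_ isT) h; have : 0 <= K * (1 / 2) ^+ M by exact: le_trans h.
  by rewrite pmulr_lge0// exprn_gt0//; lra.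
exists (K * K'); apply: filterS2 hu H' => t ht h.
rewrite norm_rc; apply: (@le_trans _ _ (K * `|u t| ^+ M)%:C); first by rewrite lerC H.
rewrite !rcM -mulrA ler_wpM2l//; first by rewrite -rc0 lerC.
by move: h; rewrite normrX norm_rc -rcX.
Qed.

Lemma sos_natV M n : sos M (fun=> ((n%:R : R)^-1)%:C).
Proof. by apply: sos_cst; rewrite invr_ge0. Qed.

Lemma vanish_refl M (f g : C -> C) : f =1 g -> vanish M (fun t => f t - g t).
Proof.
by move=> E; apply: vanish_ext (vanish0 M) _; apply: nearC => t; rewrite E subrr.
Qed.

Lemma vanish_exp M (u : C -> R) : vanish 1 (fun t => (u t)%:C) ->
  vanish M (fun t => (expR (u t))%:C - \sum_(0 <= k < M) (k`!%:R^-1)%:C * (u t)%:C ^+ k).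
Proof.
move=> Ou; have [K H] := exp_taylor M.
apply: vanish_ext (vanish_real_comp H Ou) _; apply: nearC => t.
rewrite rcB /exp_sum rc_sum; congr (_ - _); apply: eq_bigr => k _.
by rewrite rcM rcX.
Qed.

(** The Taylor coefficients of exp are nonnegative, and u vanishes at the
    origin: only finitely many powers of u matter. *)
Lemma sos_expB1 M (u : C -> R) : vanish 1 (fun t => (u t)%:C) -> sos M.+1 (fun t => (u t)%:C) ->
  sos M.+1 (fun t => (expR (u t))%:C - 1).
Proof.
move=> Ou su; have E := vanish_exp M.+1 Ou.
have s1 : sos M.+1 (fun t => \sum_(0 <= k < M) (k.+1`!%:R^-1)%:C * (u t)%:C ^+ k.+1).
  by apply: sos_sum => k; apply: sosM; [exact: sos_natV|exact: sosX].
apply: sos_ext s1 _; apply: vanish_ext (vanishN E) _; apply: nearC => t.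
by rewrite big_nat_recl//= fact0 invr1 expr0 rc1 mulr1; ring.
Qed.

(** As for exp, the Taylor coefficients of - log (1 - y) are nonnegative; the
    linear term is removed so that it can be used separately. *)
Lemma sos_nlogB M (u : C -> R) : vanish 1 (fun t => (u t)%:C) -> sos M (fun t => (u t)%:C) ->
  sos M (fun t => (- ln (1 - u t) - u t)%:C).
Proof.
move=> Ou su; have E := vanish_le (leqW (leqnSn M)) (vanish_real_comp (@nlog_taylor M.+1) Ou).
have s1 : sos M (fun t => \sum_(0 <= k < M) (k.+2%:R^-1)%:C * (u t)%:C ^+ k.+2).
  by apply: sos_sum => k; apply: sosM; [exact: sos_natV|exact: sosX].
apply: sos_ext s1 _; apply: vanish_ext (vanishN E) _; apply: nearC => t.
rewrite rcB /nlog_sum rc_sum big_nat_recl//= invr1 mul1r expr1 !rcB.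
under [X in _ = X - _]eq_bigr do rewrite -rcX -rcM.
ring.
Qed.

End Expansions.

(** * An obstruction to finite rank *)

Section FiniteRank.
Context {R : realType}.
Local Notation C := (Cplx R).
Local Notation "x %:C" := (real_complex_def (Phant R) x : C) (format "x %:C").
Local Notation Re := (@complex.Re R).

Lemma vanish2_wder (f : C -> C) : vanish 2 f -> wder f 0 0 0.
Proof.
move=> [K H].
have f0 : f 0 = 0.
  have := nbhs_singleton H; rewrite normr0 expr0n mulr0 => h.
  by apply/eqP; rewrite -normr_le0.
pose A t := if t == 0 then 0 else f t / t.
exists A, (fun=> 0); split; last 1 first.
- apply: nearC => t; rewrite f0 add0r subr0 mul0r addr0 /A.
  by case: eqVneq => [->|t0]; rewrite ?f0 ?mulr0// divfK.
- have cK : tends (nbhs (0 : C)) (fun t => K%:C * `|t|) 0.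
    rewrite -[X in tends _ _ X](mulr0 K%:C); apply: tendsM; first exact: tends_cst.
    have h : tends (nbhs (0 : C)) (fun t => `|t|) `|0 : C|.
      by apply: tends_norm; exact: tends_id.
    by rewrite normr0 in h.
  have [/cvgrPdist_lt c0'] := cK; split; apply/cvgrPdist_lt => e e0.
  have := c0' _ e0; apply: filterS2 H => t h.
  rewrite !sub0r !normrN => lte; rewrite /A; case: eqVneq => [_|t0]; first by rewrite normr0.
  apply: le_lt_trans lte; rewrite normrM normfV ler_pdivrMr ?normr_gt0//.
  rewrite normrM normr_id -mulrA -expr2; apply: le_trans h _; apply: ler_wpM2r.
    by rewrite exprn_ge0.
  by rewrite norm_rc lerC ler_norm.
- exact: tends_cst.
Qed.

(** The jet of u has no constant term; dividing it by the variable leaves a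
    constant term u' 0, since otherwise u would be O(|t|^2). *)
Lemma jet_factor (M : nat) (u u' : C -> C) : holo u u' -> u 0 = 0 -> u' 0 != 0 ->
  exists2 r : {poly C}, r`_0 != 0 & vanish M.+2 (fun t => u t - (r * 'X).[t]).
Proof.
move=> hu u0 u'0; have [p hp] := holo_jet M.+2 hu.
have [r E] : exists r : {poly C}, p = r * 'X.
  have : root p 0.
    have [K H] := hp; have := nbhs_singleton H.
    rewrite u0 sub0r normrN normr0 expr0n mulr0 => h.
    by apply/rootP/eqP; rewrite -normr_le0.
  by case/factor_theorem => r ->; exists r; rewrite oppr0 addr0.
subst p; exists r => //; apply/negP => /eqP r0.
have [r2 E2] : exists r2 : {poly C}, r = r2 * 'X.
  have : root r 0 by apply/rootP; rewrite horner_coef0.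
  by case/factor_theorem => r2 ->; exists r2; rewrite oppr0 addr0.
have vX : vanish 2 (fun t : C => t ^+ 2).
  by apply: (@vanishX _ 1 2 (fun t => t)); exists 1; apply: nearC => t; rewrite rc1 mul1r expr1.
have vu : vanish 2 u.
  apply: vanish_ext (vanishD (vanish_le (leq_addr M 2) hp) (vanishMl vX (poly_vanish0 r2))) _.
  by apply: nearC => t; rewrite E2 !hornerE; ring.
have [K H] := hu; have [d _] := nbhs_singleton H.
by have [E3 _] := wder_uniq d (vanish2_wder vu); move: u'0; rewrite E3 eqxx.
Qed.

(** exp S = exp |u|^2 * exp S2, where exp |u|^2 contains the squares of u^k /
    sqrt k! for all k < n and exp S2 is 1 plus a sum of squares. The jets of
    the u^k have lowest degree k, so the Hermitian matrix of exp S has rank at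
    least n, and less than n squares cannot give exp S. *)
Theorem no_finite_rank (n : nat) (u u' : C -> C) (S S2 : C -> R) :
  holo u u' -> u 0 = 0 -> u' 0 != 0 ->
  (forall t, (S t)%:C = nsq (u t) + (S2 t)%:C) ->
  (forall M, sos M (fun t => (S2 t)%:C)) -> vanish 1 (fun t => (S2 t)%:C) ->
  ~ (forall M, exists2 bs : seq {poly C}, (size bs < n)%N &
      vanish M (fun t => (expR (S t))%:C - \sum_(b <- bs) nsq b.[t])).
Proof.
move=> hu u0 u'0 SE sS2 vS2 H.
(* The pairing used in the rank argument needs an error O(|t|^(2 n)). *)
pose M := (n + n).+1; have [bs sb vb] := H M.+1.
have [r r0 vr] := jet_factor M hu u0 u'0.
pose U t := Re (nsq (u t)).
have UE t : (U t)%:C = nsq (u t) by rewrite /U /nsq mulC_conj.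
have d0 := wgerm_wder ((holo_wgerm _ _).1 hu).
have vu1 : vanish 1 u by exact: wder_vanish d0 u0.
have vU : vanish 1 (fun t => (U t)%:C).
  apply: vanish_ext (vanishMl vu1 (vanish_conj (wder_vanish0 d0))) _.
  by apply: nearC => t; rewrite UE.
pose ck k : R := Num.sqrt (k`!%:R^-1).
pose q k : {poly C} := (ck k)%:C%:P * (r * 'X) ^+ k.
have qX k : q k = ((ck k)%:C%:P * r ^+ k) * 'X^k by rewrite /q exprMn mulrA.
have vq k : vanish M.+1 (fun t => (k`!%:R^-1)%:C * nsq (u t) ^+ k - nsq (q k).[t]).
  have vk : vanish M.+1 (fun t => u t ^+ k - ((r * 'X) ^+ k).[t]).
    have vr' := vanish_le (leqnSn M.+1) vr.
    elim: k => [|k IH].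
      by apply: vanish_ext (vanish0 _) _; apply: nearC => t; rewrite !expr0 hornerE subrr.
    apply: vanish_ext (vanishD (vanishMl IH (wder_vanish0 d0)) (vanishMl vr' (poly_vanish0 ((r * 'X) ^+ k)))) _.
    by apply: nearC => t; rewrite !exprS !hornerE; ring.
  apply: vanish_ext (vanishZ ((k`!%:R^-1)%:C) (nsq_jet vk)) _.
  apply: nearC => t.
  have E1 : nsq (u t ^+ k) = nsq (u t) ^+ k.
    by elim: k {vk} => [|k IH]; rewrite ?expr0 ?exprS ?nsqM ?IH// /nsq rmorph1 mulr1.
  have E2 : nsq (q k).[t] = (k`!%:R^-1)%:C * nsq ((r * 'X) ^+ k).[t].
    rewrite /q hornerM hornerC nsqM; congr (_ * _).
    by rewrite /nsq conj_rc -rcM -expr2 sqr_sqrtr// invr_ge0.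
  by rewrite E2 -E1; ring.
have eU : exists2 g : C -> C, sos M.+1 g &
    vanish M.+1 (fun t => (expR (U t))%:C - (\sum_(0 <= k < n) nsq (q k).[t] + g t)).
  exists (fun t => \sum_(n <= k < M.+1) (k`!%:R^-1)%:C * nsq (u t) ^+ k).
    apply: sos_sum => k; apply: sosM; first exact: sos_natV.
    by apply: sosX; exact: sos_holo hu.
  have vs : vanish M.+1 (fun t => \sum_(0 <= k < n) ((k`!%:R^-1)%:C * nsq (u t) ^+ k - nsq (q k).[t])).
    by apply: vanish_sum.
  apply: vanish_ext (vanishD (vanish_exp M.+1 vU) vs) _; apply: nearC => t.
  rewrite (@big_cat_nat _ _ _ n)//=; last by rewrite /M; apply: leqW; apply: leqW; exact: leq_addr.
  rewrite sumrB; under [X in _ - (X + _) + _]eq_bigr do rewrite UE.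
  under [X in _ - (_ + X) + _]eq_bigr do rewrite UE.
  by ring.
have [g sg vg] := eU.
have s1 := sos_expB1 vS2 (sS2 M.+1).
have sq : sos M.+1 (fun t => \sum_(0 <= k < n) nsq (q k).[t]).
  by exists [seq q k | k <- index_iota 0 n]; apply: vanish_refl => t; rewrite big_map.
have [ps vps] : sos M.+1 (fun t => g t + (\sum_(0 <= k < n) nsq (q k).[t] + g t) * ((expR (S2 t))%:C - 1)).
  exact: sosD sg (sosM (sosD sq sg) s1).
have b2 : vanish 0 (fun t => (expR (S2 t))%:C).
  apply: vanish_ext (vanishD (sos_bounded s1) (vanish_cst 1)) _.
  by apply: nearC => t; ring.
have qlow k a : (a < k)%N -> (q k)`_a = 0.
  by move=> ak; rewrite qX coefMXn ak.
have qlead k : (q k)`_k != 0.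
  rewrite qX coefMXn ltnn subnn coefCM mulf_neq0//.
    by rewrite rc_eq0 gt_eqF// sqrtr_gt0 invr_gt0 ltr0n fact_gt0.
  by rewrite -horner_coef0 horner_exp expf_neq0// horner_coef0.
apply: (@hermitian_rank R n q ps bs qlow qlead sb).
apply: (@vanish_le _ M.+1); first by rewrite /M; exact: leqW.
apply: vanish_ext (vanishB (vanishB vb vps) (vanishMl vg b2)) _.
apply: nearC => t.
have -> : (expR (S t))%:C = (expR (U t))%:C * (expR (S2 t))%:C.
  rewrite -rcM -expRD; congr (expR _)%:C; apply: (@complexI R).
  by rewrite rmorphD; apply: (etrans (SE t)); rewrite -UE.
ring.
Qed.

End FiniteRank.

(** * Kahler potentials and the Fubini-Study metric *)

Section Potentials.
Context {R : realType}.
Local Notation C := (Cplx R).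
Local Notation "x %:C" := (real_complex_def (Phant R) x : C) (format "x %:C").

Lemma conjN (z : C) : (- z)^* = - z^*.
Proof. by rewrite rmorphN. Qed.

Lemma conjB (z w : C) : (z - w)^* = z^* - w^*.
Proof. by rewrite rmorphB. Qed.

Lemma conjV (z : C) : (z^-1)^* = (z^*)^-1.
Proof. by rewrite fmorphV. Qed.

Lemma conj1 : (1 : C)^* = 1.
Proof. by rewrite rmorph1. Qed.

Lemma conj0 : (0 : C)^* = 0.
Proof. by rewrite rmorph0. Qed.

Definition curve n (g : C -> 'rV[C]_n) (t : C) (v : 'rV[C]_n) :=
  forall i, wder (fun s => g s 0 i) t (v 0 i) 0.

Lemma curve_line n (p v : 'rV[C]_n) t : curve (fun s => p + s *: v) t v.
Proof.
move=> i; apply: wder_ext (wderD (wder_cst (p 0 i) t) (wderM (wder_id t) (wder_cst (v 0 i) t))) _ _ _.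
- by ring.
- by ring.
- by apply: nearC => s; rewrite !mxE.
Qed.

Lemma curve_lsubmx n m (g : C -> 'rV[C]_(n + m)) t v : curve g t v ->
  curve (fun s => lsubmx (g s)) t (lsubmx v).
Proof.
move=> cg i; rewrite mxE; apply: wder_ext (cg (lshift m i)) _ _ _ => //.
by apply: nearC => s; rewrite mxE.
Qed.

Lemma curve_rsubmx n m (g : C -> 'rV[C]_(n + m)) t v : curve g t v ->
  curve (fun s => rsubmx (g s)) t (rsubmx v).
Proof.
move=> cg i; rewrite mxE; apply: wder_ext (cg (rshift n i)) _ _ _ => //.
by apply: nearC => s; rewrite mxE.
Qed.

(** The Hermitian product, conjugate linear in the second argument. *)
Definition hdot n (v p : 'rV[C]_n) : C := \sum_(j < n) v 0 j * (p 0 j)^*.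

Lemma hdot_conj n (v p : 'rV[C]_n) : (hdot v p)^* = hdot p v.
Proof. by rewrite rmorph_sum; apply: eq_bigr => j _ /=; rewrite conjM conjCK mulrC. Qed.

Lemma hdotDl n (u v p : 'rV[C]_n) : hdot (u + v) p = hdot u p + hdot v p.
Proof. by rewrite -big_split; apply: eq_bigr => j _; rewrite mxE mulrDl. Qed.

Lemma hdotZl n a (v p : 'rV[C]_n) : hdot (a *: v) p = a * hdot v p.
Proof. by rewrite mulr_sumr; apply: eq_bigr => j _; rewrite mxE mulrA. Qed.

Lemma hdotDr n (u v p : 'rV[C]_n) : hdot p (u + v) = hdot p u + hdot p v.
Proof. by rewrite -hdot_conj hdotDl conjD !hdot_conj. Qed.

Lemma hdotZr n a (v p : 'rV[C]_n) : hdot p (a *: v) = a^* * hdot p v.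
Proof. by rewrite -hdot_conj hdotZl conjM hdot_conj. Qed.

Lemma hdotNl n (v p : 'rV[C]_n) : hdot (- v) p = - hdot v p.
Proof. by rewrite -scaleN1r hdotZl mulN1r. Qed.

Lemma hdotNr n (v p : 'rV[C]_n) : hdot p (- v) = - hdot p v.
Proof. by rewrite -hdot_conj hdotNl conjN hdot_conj. Qed.

Lemma hdot_row_mx n m (x x' : 'rV[C]_n) (y y' : 'rV[C]_m) :
  hdot (row_mx x y) (row_mx x' y') = hdot x x' + hdot y y'.
Proof.
rewrite /hdot big_split_ord; congr (_ + _); apply: eq_bigr => j _;
  by rewrite ?row_mxEl ?row_mxEr.
Qed.

Lemma hdot_nsq n (v : 'rV[C]_n) : hdot v v = \sum_(j < n) nsq (v 0 j).
Proof. by []. Qed.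

Lemma sqnormE n (v : 'rV[C]_n) : (sqnorm v)%:C = hdot v v.
Proof. by rewrite rc_sum; apply: eq_bigr => j _; rewrite -mulC_conj. Qed.

Lemma sqnorm_ge0 n (v : 'rV[C]_n) : 0 <= sqnorm v.
Proof. by apply: sumr_ge0 => j _; rewrite addr_ge0// sqr_ge0. Qed.

Lemma hdot_ge0 n (v : 'rV[C]_n) : 0 <= hdot v v.
Proof. by rewrite -sqnormE -rc0 lerC sqnorm_ge0. Qed.

Lemma nsq_le_hdot n (v : 'rV[C]_n) j : nsq (v 0 j) <= hdot v v.
Proof.
rewrite hdot_nsq (bigD1 j)//= lerDl; apply: sumr_ge0 => i _; exact: nsq_ge0.
Qed.

Lemma quad_form n (A : 'M[C]_n) (v : 'rV[C]_n) :
  (v *m A *m adjmx v) 0 0 = hdot (v *m A) v.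
Proof. by rewrite mxE; apply: eq_bigr => j _; rewrite !mxE. Qed.

Lemma wder_hdot n (g h : C -> 'rV[C]_n) t v w : curve g t v -> curve h t w ->
  wder (fun s => hdot (g s) (h s)) t (hdot v (h t)) (hdot (g t) w).
Proof.
move=> cg ch; apply: wder_ext (@wder_sum R _ (index_enum _) predT
  (fun j s => g s 0 j * (h s 0 j)^*) t _ _ (fun j _ => wderM (cg j) (wder_conj (ch j)))) _ _ _.
- by apply: eq_bigr => j _; rewrite rmorph0 mulr0 addr0.
- by apply: eq_bigr => j _; rewrite mul0r add0r.
- exact: nearC.
Qed.

Lemma wder_sqnorm n (g : C -> 'rV[C]_n) t v : curve g t v ->
  wder (fun s => (sqnorm (g s))%:C) t (hdot v (g t)) (hdot (g t) v).
Proof.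
move=> cg; apply: wder_ext (wder_hdot cg cg) _ _ _ => //.
by apply: nearC => s; rewrite sqnormE.
Qed.

(** A potential given through its behavior on holomorphic curves: Pb p has
    coordinates dPhi/dzbar_k, and L p v is the derivative of Pb at p in the
    holomorphic direction v. Along curves these are what the chain rule
    computes, and on coordinate lines they give back the complex Hessian. *)
Record potential n (U : set 'rV[C]_n) (Phi : 'rV[C]_n -> R)
    (Pb : 'rV[C]_n -> 'rV[C]_n) (L : 'rV[C]_n -> 'rV[C]_n -> 'rV[C]_n) := {
  pot_near : forall g t v, curve g t v -> U (g t) -> \forall s \near t, U (g s);
  pot_der1 : forall g t v, curve g t v -> U (g t) ->
    wder (fun s => (Phi (g s))%:C) t (hdot v (Pb (g t))) (hdot (Pb (g t)) v);
  pot_der2 : forall g t v k, curve g t v -> U (g t) ->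
    exists b, wder (fun s => Pb (g s) 0 k) t (L (g t) v 0 k) b;
  pot_lin : forall p a u v, L p (a *: u + v) = a *: L p u + L p v
}.

(** The derivative along c v is the combination of the two Wirtinger
    derivatives along v; c = 1 and c = i recover dz and dzbar. *)
Lemma rderiv_wder n (f : 'rV[C]_n -> C) (z v : 'rV[C]_n) a b c :
  wder (fun s => f (z + s *: v)) 0 a b -> rderiv (c *: v) f z = a * c + b * c^*.
Proof.
move=> d; have h := wder_along c d.
have {}h : rder (along f (c *: v) z) 0 (a * c + b * c^*).
  by apply: rder_ext h _ _ => //; near=> x; rewrite /along add0r scalerA.
apply: complex_ext; rewrite /= derive1E.
  by have [_ ->] := rder_Re h.
by have [_ ->] := rder_Im h.
Unshelve. all: by end_near. Qed.

Lemma dz_wder n (f : 'rV[C]_n -> C) (z : 'rV[C]_n) j a b :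
  wder (fun s => f (z + s *: delta_mx 0 j)) 0 a b -> dz j f z = a.
Proof.
move=> d; rewrite /dz -[X in rderiv X f z](scale1r (delta_mx 0 j)).
rewrite !(rderiv_wder _ d) rmorph1 conjCi.
have i2 : 'i * 'i = -1 :> C by rewrite -expr2 sqrCi.
transitivity ((a + b - ('i * 'i) * a + ('i * 'i) * b) / 2); first by field.
by rewrite i2; field.
Qed.

Lemma dzbar_wder n (f : 'rV[C]_n -> C) (z : 'rV[C]_n) j a b :
  wder (fun s => f (z + s *: delta_mx 0 j)) 0 a b -> dzbar j f z = b.
Proof.
move=> d; rewrite /dzbar -[X in rderiv X f z](scale1r (delta_mx 0 j)).
rewrite !(rderiv_wder _ d) rmorph1 conjCi.
have i2 : 'i * 'i = -1 :> C by rewrite -expr2 sqrCi.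
transitivity ((a + b + ('i * 'i) * a - ('i * 'i) * b) / 2); first by field.
by rewrite i2; field.
Qed.

Lemma hdot_delta n (p : 'rV[C]_n) k : hdot p (delta_mx 0 k) = p 0 k.
Proof.
rewrite /hdot (bigD1 k)//= big1 => [|j jk]; rewrite mxE ?eqxx ?rmorph1 ?mulr1 ?addr0//.
by rewrite (negbTE jk) rmorph0 mulr0.
Qed.

Section Hessian.
Variables (n : nat) (U : set 'rV[C]_n) (Phi : 'rV[C]_n -> R).
Variables (Pb : 'rV[C]_n -> 'rV[C]_n) (L : 'rV[C]_n -> 'rV[C]_n -> 'rV[C]_n).
Hypothesis pot : potential U Phi Pb L.

Lemma dzbar_potential p k : U p -> dzbar k (fun x => (Phi x)%:C) p = Pb p 0 k.
Proof.
move=> Up; have E : p + 0 *: delta_mx 0 k = p by rewrite scale0r addr0.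
have := @pot_der1 _ _ _ _ _ pot _ _ _ (curve_line p (delta_mx 0 k) 0).
rewrite E => /(_ Up) d; rewrite (dzbar_wder d).
exact: hdot_delta.
Qed.

Lemma pot_lin_sum p v : L p v = \sum_j v 0 j *: L p (delta_mx 0 j).
Proof.
have L0 : L p 0 = 0.
  have := pot_lin pot p (-1) 0 0; rewrite scaler0 addr0 scaleN1r => /eqP.
  by rewrite addNr => /eqP.
have LD u w : L p (u + w) = L p u + L p w.
  by have := pot_lin pot p 1 u w; rewrite !scale1r.
have LZ a u : L p (a *: u) = a *: L p u.
  by have := pot_lin pot p a u 0; rewrite L0 !addr0.
rewrite {1}(row_sum_delta v) (big_morph (L p) LD L0).
by apply: eq_bigr => j _; rewrite LZ.
Qed.

(** The Hessian matrix, as a linear map, is the L of any description of the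
    potential. *)
Lemma complex_hessian_potential p v : U p ->
  v *m complex_hessian Phi p = L p v.
Proof.
move=> Up; rewrite pot_lin_sum; apply/rowP => k; rewrite mxE summxE.
apply: eq_bigr => j _; rewrite !mxE; congr (_ * _).
have E : p + 0 *: delta_mx 0 j = p by rewrite scale0r addr0.
have Up0 : U (p + 0 *: delta_mx 0 j) by rewrite E.
have cl := curve_line p (delta_mx 0 j) 0.
have [b] := pot_der2 pot k cl Up0; rewrite E => d.
apply: dz_wder; apply: wder_ext d _ _ _ => //.
by apply: filterS (pot_near pot cl Up0) => s Us; rewrite dzbar_potential.
Qed.

End Hessian.

Section FubiniStudy.
Variable n : nat.

Definition fs_pot (z : 'rV[C]_n) : R := ln (1 + sqnorm z).
Definition fs_grad (p : 'rV[C]_n) : 'rV[C]_n := (1 + hdot p p)^-1 *: p.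
Definition fs_hess (p v : 'rV[C]_n) : 'rV[C]_n :=
  (1 + hdot p p)^-1 *: v - (hdot v p / (1 + hdot p p) ^+ 2) *: p.

Lemma fs_denom_gt0 (p : 'rV[C]_n) : 0 < 1 + hdot p p.
Proof. by rewrite ltr_wpDr ?hdot_ge0. Qed.

Lemma fs_potential : potential setT fs_pot fs_grad fs_hess.
Proof.
have D0 (p : 'rV[C]_n) : 1 + hdot p p != 0 by rewrite gt_eqF // fs_denom_gt0.
have dD (g : C -> 'rV[C]_n) t v : curve g t v ->
    wder (fun s => 1 + hdot (g s) (g s)) t (hdot v (g t)) (hdot (g t) v).
  by move=> cg; apply: wder_ext (wderD (wder_cst 1 t) (wder_hdot cg cg)) _ _ _;
    rewrite ?add0r//; exact: nearC.
split.
- by move=> g t v _ _; exact: nearC.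
- move=> g t v cg _.
  have d : wder (fun s => (1 + sqnorm (g s))%:C) t (hdot v (g t)) (hdot (g t) v).
    by apply: wder_ext (dD g t v cg) _ _ _ => //; apply: nearC => s; rewrite rcD sqnormE.
  have p1 : 0 < 1 + sqnorm (g t) by rewrite ltr_wpDr ?sqnorm_ge0.
  apply: wder_ext (wder_comp_real d (is_derive1_ln p1)) _ _ _.
  + by rewrite /fs_grad hdotZr conjV conjD conj1 hdot_conj rcV rcD sqnormE.
  + by rewrite /fs_grad hdotZl rcV rcD sqnormE.
  + exact: nearC.
- move=> g t v k cg _; eexists.
  apply: wder_ext (wderM (wderV (dD g t v cg) (D0 (g t))) (cg k)) _ (erefl _) _.
    by rewrite /fs_hess !mxE; field.
  by apply: nearC => s; rewrite mxE.
- move=> p a u v; rewrite /fs_hess hdotDl hdotZl; apply/rowP => k; rewrite !mxE.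
  by ring.
Qed.

(** Written as a sum of nonnegative terms, the metric bounds both k = <v, p> /
    (1 + |p|^2) and v - k p, hence v. *)
Lemma fs_quad (p v : 'rV[C]_n) : hdot (fs_hess p v) v =
  (hdot (v - (hdot v p / (1 + hdot p p)) *: p) (v - (hdot v p / (1 + hdot p p)) *: p)
    + nsq (hdot v p / (1 + hdot p p))) / (1 + hdot p p).
Proof.
have D0 : 1 + hdot p p != 0 by rewrite gt_eqF // fs_denom_gt0.
have Dc : (1 + hdot p p)^* = 1 + hdot p p by rewrite conjD conj1 hdot_conj.
rewrite /fs_hess /nsq !(hdotDl, hdotDr, hdotNl, hdotNr, hdotZl, hdotZr) !conjM.
rewrite conjV Dc hdot_conj; field.
by [].
Qed.

End FubiniStudy.

End Potentials.

(** * The metric of the Fock-Bargmann-Hartogs domain *)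

Section FBHPotential.
Context {R : realType}.
Local Notation C := (Cplx R).
Local Notation "x %:C" := (real_complex_def (Phant R) x : C) (format "x %:C").

Lemma tends_gt (u : C -> R) (t : C) (x l : R) :
  tends (nbhs t) (fun s => (u s)%:C) l%:C -> x < l -> \forall s \near t, x < u s.
Proof.
move=> c xl.
have cR : u s @[s --> t] --> l.
  exact: (@cvg_Re R C (nbhs t) (nbhs_filter t) _ _ (tends_cvg c)).
exact: (@cvgr_gt _ _ (nbhs t) (nbhs_filter t) u l cR x xl).
Qed.

Variables (n m : nat) (mu nu : R).
Local Notation T := 'rV[C]_(n + m).

Definition fbh_exp (p : T) : R := expR (- mu * sqnorm (lsubmx p)).
(** The logarithm of the gap is the singular part of the potential: the domain
    is where the gap is positive. *)
Definition fbh_gap (p : T) : R := fbh_exp p - sqnorm (rsubmx p).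

Lemma FBH_domainE p : @FBH_domain R n m mu p <-> 0 < fbh_gap p.
Proof. by rewrite /FBH_domain /fbh_gap /= subr_gt0. Qed.

Definition fbh_grad (p : T) : T :=
  row_mx ((nu * mu + mu * (fbh_exp p / fbh_gap p))%:C *: lsubmx p)
         ((fbh_gap p)^-1%:C *: rsubmx p).

Definition gap_der (p v : T) : C :=
  - mu%:C * (fbh_exp p)%:C * hdot (lsubmx v) (lsubmx p) - hdot (rsubmx v) (rsubmx p).

Definition fbh_hess (p v : T) : T :=
  let q := (fbh_exp p)%:C in let g := (fbh_gap p)%:C in
  let h := hdot (lsubmx v) (lsubmx p) in
  row_mx ((nu%:C * mu%:C + mu%:C * (q / g)) *: lsubmx v
            + (mu%:C * (- mu%:C * q * h / g - q * gap_der p v / g ^+ 2)) *: lsubmx p)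
         (g^-1 *: rsubmx v - (gap_der p v / g ^+ 2) *: rsubmx p).

Lemma wder_fbh_exp g t v : curve g t v ->
  wder (fun s => (fbh_exp (g s))%:C) t
    (- mu%:C * (fbh_exp (g t))%:C * hdot (lsubmx v) (lsubmx (g t)))
    (- mu%:C * (fbh_exp (g t))%:C * hdot (lsubmx (g t)) (lsubmx v)).
Proof.
move=> cg.
have d : wder (fun s => (- mu * sqnorm (lsubmx (g s)))%:C) t
    (- mu%:C * hdot (lsubmx v) (lsubmx (g t))) (- mu%:C * hdot (lsubmx (g t)) (lsubmx v)).
  apply: wder_ext (wderZ (- mu%:C) (wder_sqnorm (curve_lsubmx cg))) _ _ _ => //.
  by apply: nearC => s; rewrite rcM rcN.
apply: wder_ext (wder_comp_real d (is_derive_expR _)) _ _ _.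
- by rewrite -/(fbh_exp _); ring.
- by rewrite -/(fbh_exp _); ring.
- exact: nearC.
Qed.

Lemma gap_der_conj p v : (gap_der p v)^* =
  - mu%:C * (fbh_exp p)%:C * hdot (lsubmx p) (lsubmx v) - hdot (rsubmx p) (rsubmx v).
Proof. by rewrite conjB !conjM conjN !conj_rc !hdot_conj. Qed.

Lemma wder_fbh_gap g t v : curve g t v ->
  wder (fun s => (fbh_gap (g s))%:C) t (gap_der (g t) v) (gap_der (g t) v)^*.
Proof.
move=> cg.
apply: wder_ext (wderB (wder_fbh_exp cg) (wder_sqnorm (curve_rsubmx cg))) _ _ _ => //.
  by rewrite gap_der_conj.
by apply: nearC => s; rewrite rcB.
Qed.

Lemma fbh_grad_l p k : fbh_grad p 0 (lshift m k) =
  (nu%:C * mu%:C + mu%:C * ((fbh_exp p)%:C / (fbh_gap p)%:C)) * lsubmx p 0 k.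
Proof. by rewrite row_mxEl mxE rcD !rcM rcV. Qed.

Lemma fbh_grad_r p k : fbh_grad p 0 (rshift n k) = (fbh_gap p)%:C^-1 * rsubmx p 0 k.
Proof. by rewrite row_mxEr mxE rcV. Qed.

Lemma hdot_split (u v : T) : hdot u v = hdot (lsubmx u) (lsubmx v) + hdot (rsubmx u) (rsubmx v).
Proof. by rewrite -{1}(hsubmxK u) -{1}(hsubmxK v) hdot_row_mx. Qed.

Lemma hdot_fbh_grad p v : hdot (fbh_grad p) v =
  (nu%:C * mu%:C + mu%:C * ((fbh_exp p)%:C / (fbh_gap p)%:C)) * hdot (lsubmx p) (lsubmx v)
    + (fbh_gap p)%:C^-1 * hdot (rsubmx p) (rsubmx v).
Proof.
by rewrite hdot_split row_mxKl row_mxKr !hdotZl rcD !rcM !rcV.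
Qed.

Lemma fbh_potential :
  potential (@FBH_domain R n m mu) (@FBH_potential R n m mu nu) fbh_grad fbh_hess.
Proof.
have gap0 p : @FBH_domain R n m mu p -> (fbh_gap p)%:C != 0.
  by move=> /FBH_domainE h; rewrite rc_eq0 gt_eqF.
split.
- move=> g t v cg /FBH_domainE gt0.
  have c := wder_cont (wder_fbh_gap cg).
  by apply: filterS (tends_gt c gt0) => s /FBH_domainE.
- move=> g t v cg Ut; have /FBH_domainE gt0 := Ut.
  have d1 := wderZ (nu * mu)%:C (wder_sqnorm (curve_lsubmx cg)).
  have d2 := wder_comp_real (wder_fbh_gap cg) (is_derive1_ln gt0).
  apply: wder_ext (wderB d1 d2) _ _ _.
  + rewrite -[RHS]hdot_conj hdot_fbh_grad conjD !conjM conjD !conjM conjV !conj_rc !hdot_conj.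
    by rewrite /gap_der rcV rcM; field; exact: gap0.
  + by rewrite hdot_fbh_grad gap_der_conj rcV rcM; field; exact: gap0.
  + by apply: nearC => s; rewrite -rcM -rcB.
- move=> g t v k cg Ut.
  case: (split_ordP k) => j ->; eexists.
  + apply: wder_ext (wderM (wderD (wder_cst (nu%:C * mu%:C) t)
      (wderZ mu%:C (wderM (wder_fbh_exp cg) (wderV (wder_fbh_gap cg) (gap0 _ Ut))))) (curve_lsubmx cg j)) _ (erefl _) _.
      rewrite row_mxEl !mxE; field; exact: gap0.
    by apply: nearC => s; rewrite fbh_grad_l.
  + apply: wder_ext (wderM (wderV (wder_fbh_gap cg) (gap0 _ Ut)) (curve_rsubmx cg j)) _ (erefl _) _.
      by rewrite row_mxEr !mxE; field; exact: gap0.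
    by apply: nearC => s; rewrite fbh_grad_r.
- move=> p a u v.
  have El : lsubmx (a *: u + v) = a *: lsubmx u + lsubmx v by rewrite linearP.
  have Er : rsubmx (a *: u + v) = a *: rsubmx u + rsubmx v by rewrite linearP.
  rewrite /fbh_hess /gap_der El Er !hdotDl !hdotZl.
  apply/rowP => k; rewrite [RHS]mxE [X in _ = X + _]mxE; case: (split_ordP k) => j ->.
    by rewrite !row_mxEl !mxE; ring.
  by rewrite !row_mxEr !mxE; ring.
Qed.

(** All the terms on the right are nonnegative when nu > -1. The vector y is
    the covariant derivative, for the Chern connection of the Hermitian norm
    e^(mu |z|^2) |w|^2 on the trivial bundle with fiber C^m. *)
Lemma fbh_quad p v : @FBH_domain R n m mu p ->
  let a := mu%:C * hdot (lsubmx v) (lsubmx p) in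
  let y := rsubmx v + a *: rsubmx p in
  hdot (fbh_hess p v) v =
    (nu + 1)%:C * mu%:C * hdot (lsubmx v) (lsubmx v)
    + (mu%:C * hdot (lsubmx v) (lsubmx v) * hdot (rsubmx p) (rsubmx p)
       + hdot y y) / (fbh_gap p)%:C
    + nsq (hdot y (rsubmx p)) / (fbh_gap p)%:C ^+ 2.
Proof.
move=> /FBH_domainE gt0 a y; have g0 : (fbh_gap p)%:C != 0 :> C by rewrite rc_eq0 gt_eqF.
rewrite hdot_split /fbh_hess row_mxKl row_mxKr.
have -> : (fbh_exp p)%:C = (fbh_gap p)%:C + hdot (rsubmx p) (rsubmx p).
  by rewrite -sqnormE -rcD /fbh_gap subrK.
have E : (fbh_exp p)%:C = (fbh_gap p)%:C + hdot (rsubmx p) (rsubmx p).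
  by rewrite -sqnormE -rcD /fbh_gap subrK.
rewrite /gap_der E /nsq /y !(hdotDl, hdotDr, hdotNl, hdotNr, hdotZl, hdotZr).
rewrite /a !(conjD, conjM, conj_rc, hdot_conj) rcD rc1.
by field.
Qed.

End FBHPotential.

(** * Velocities of isometric curves *)

Section CurveGerms.
Context {R : realType}.
Local Notation C := (Cplx R).
Local Notation "x %:C" := (real_complex_def (Phant R) x : C) (format "x %:C").
Local Notation Re := (@complex.Re R).

(** From x^2 <= B one gets |x| <= B + 1 without a square root. *)
Lemma norm_le_nsq (x : C) (B : R) : nsq x <= B%:C -> `|x| <= (B + 1)%:C.
Proof.
rewrite /nsq -normCK -[`|x|]Re_normC -rcX !lerC => h.
have := sqr_ge0 (Re `|x| - 1); rewrite sqrrB1 => h2.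
have := Re_norm_ge0 x; lra.
Qed.

Lemma near_forall (I : finType) (t : C) (P : I -> C -> Prop) :
  (forall i, \forall s \near t, P i s) -> \forall s \near t, forall i, P i s.
Proof. exact: (@filter_forall C I P (nbhs t) (nbhs_filter t)). Qed.

Definition holo_curve n (g g' : C -> 'rV[C]_n) :=
  forall i, holo (fun s => g s 0 i) (fun s => g' s 0 i).

Lemma holo_curve_near n (g g' : C -> 'rV[C]_n) : holo_curve g g' ->
  \forall s \near (0 : C), curve g s (g' s).
Proof.
move=> h; apply: near_forall => i.
by have [K H] := h i; apply: filterS H => s [].
Qed.

Lemma holo_curve_bounded n (g g' : C -> 'rV[C]_n) (K : R) :
  (\forall s \near (0 : C), curve g s (g' s) /\ forall i, `|g' s 0 i| <= K%:C) ->
  holo_curve g g'.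
Proof. by move=> H i; exists K; apply: filterS H => s [cg b]; split. Qed.

Lemma norm_hdot n (u v : 'rV[C]_n) (A B : R) : (forall i, `|u 0 i| <= A%:C) ->
  (forall i, `|v 0 i| <= B%:C) -> `|hdot u v| <= (A * B *+ n)%:C.
Proof.
move=> hu hv; apply: le_trans (ler_norm_sum _ _ _) _.
apply: (@le_trans _ _ (\sum_(i < n) (A * B)%:C)).
  by apply: ler_sum => i _; rewrite normrM norm_conjC rcM; exact: ler_pM.
by rewrite -rc_sum sumr_const card_ord.
Qed.

Lemma curve_bounded n (g : C -> 'rV[C]_n) v : curve g 0 v ->
  exists P : R, \forall s \near (0 : C), hdot (g s) (g s) <= P%:C.
Proof.
move=> cg; have [P H] := tends_bounded (wder_cont (wder_hdot cg cg)).
by exists P; apply: filterS H => s; rewrite ger0_norm ?hdot_ge0.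
Qed.

Lemma norm_coord_le n (p : 'rV[C]_n) (P : R) i : hdot p p <= P%:C -> `|p 0 i| <= (P + 1)%:C.
Proof. by move=> h; apply: norm_le_nsq; exact: le_trans (nsq_le_hdot p i) h. Qed.

(** On a bounded set of points the Fubini-Study metric dominates a multiple of
    the Euclidean one. *)
Lemma fs_velocity_bounded n (p v : 'rV[C]_n) (P G : R) i :
  hdot p p <= P%:C -> `|hdot (fs_hess p v) v| <= G%:C ->
  `|v 0 i| <= ((G * (1 + P) + 1) + (G * (1 + P) + 1) * (P + 1))%:C.
Proof.
move=> hp hG; have D0 := fs_denom_gt0 p.
set k := hdot v p / (1 + hdot p p); set y := v - k *: p.
have G0 : 0 <= G%:C by exact: le_trans hG.
have tot : hdot y y + nsq k <= (G * (1 + P))%:C.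
  have E := fs_quad p v; rewrite -/k -/y in E.
  have -> : hdot y y + nsq k = hdot (fs_hess p v) v * (1 + hdot p p).
    by rewrite E divfK// gt_eqF.
  apply: (@le_trans _ _ (G%:C * (1 + hdot p p))).
    apply: ler_wpM2r; first exact: ltW.
    apply: le_trans hG; rewrite E ger0_norm// divr_ge0// ?addr_ge0 ?hdot_ge0 ?nsq_ge0//.
  by rewrite rcM rcD rc1 ler_wpM2l// lerD2l.
have hk : `|k| <= (G * (1 + P) + 1)%:C.
  by apply: norm_le_nsq; apply: le_trans tot; rewrite lerDr hdot_ge0.
have hy : `|y 0 i| <= (G * (1 + P) + 1)%:C.
  by apply: norm_coord_le; apply: le_trans tot; rewrite lerDl nsq_ge0.
have -> : v 0 i = y 0 i + k * p 0 i by rewrite /y !mxE; ring.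
apply: le_trans (ler_normD _ _) _; rewrite rcD; apply: lerD => //.
by rewrite normrM rcM; apply: ler_pM => //; exact: norm_coord_le.
Qed.

Section FBHVelocity.
Variables (n m : nat) (mu nu : R).
Hypotheses (mu0 : 0 < mu) (nu1 : -1 < nu).

(** The first term of [fbh_quad] controls the horizontal part of the velocity,
    where nu > -1 makes its coefficient positive. The term |y|^2 / gap
    controls y, the gap being at most 1, and the vertical part differs from y
    by a multiple of a, itself controlled by the horizontal part. *)
Lemma fbh_velocity_bounded (p v : 'rV[C]_(n + m)) (P G : R) :
  FBH_domain mu p -> hdot p p <= P%:C -> `|hdot (fbh_hess mu nu p v) v| <= G%:C ->
  let X := G / ((nu + 1) * mu) + 1 in let A := mu * (X * (P + 1) *+ n) in
  forall i, `|v 0 i| <= (X + (G + 1) + A * (P + 1))%:C.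
Proof.
move=> Up hp hG X A i; have gap0 := (FBH_domainE _ _).1 Up.
set a := mu%:C * hdot (lsubmx v) (lsubmx p); set y := rsubmx v + a *: rsubmx p.
have E := fbh_quad nu v Up; rewrite /= -/a -/y in E.
have nup : 0 < nu + 1 by have := nu1; lra.
have gapC : 0 < (fbh_gap mu p)%:C by rewrite -rc0 ltrC.
have muC : 0 <= mu%:C by rewrite -rc0 lerC ltW.
have nuC : 0 < (nu + 1)%:C * mu%:C by rewrite -rcM -rc0 ltrC mulr_gt0.
have t1 : 0 <= (nu + 1)%:C * mu%:C * hdot (lsubmx v) (lsubmx v).
  by rewrite mulr_ge0 ?hdot_ge0// ltW.
have t2 : 0 <= mu%:C * hdot (lsubmx v) (lsubmx v) * hdot (rsubmx p) (rsubmx p) / (fbh_gap mu p)%:C.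
  by rewrite divr_ge0 ?mulr_ge0 ?hdot_ge0// ltW.
have t3 : 0 <= hdot y y / (fbh_gap mu p)%:C by rewrite divr_ge0 ?hdot_ge0// ltW.
have t4 : 0 <= nsq (hdot y (rsubmx p)) / (fbh_gap mu p)%:C ^+ 2.
  by rewrite divr_ge0 ?nsq_ge0// exprn_ge0// ltW.
rewrite mulrDl in E.
have hq : hdot (fbh_hess mu nu p v) v <= G%:C.
  by apply: le_trans hG; rewrite E ger0_norm// !addr_ge0.
have G0 : 0 <= G by rewrite -lerC; exact: le_trans (normr_ge0 _) hG.
have hX : hdot (lsubmx v) (lsubmx v) <= (G / ((nu + 1) * mu))%:C.
  rewrite rcM rcV rcM ler_pdivlMr// mulrC; apply: le_trans hq.
  by rewrite E -!addrA lerDl !addr_ge0.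
have gap1 : fbh_gap mu p <= 1.
  apply: (@le_trans _ _ (fbh_exp mu p)); first by rewrite gerBl sqnorm_ge0.
  by rewrite /fbh_exp -expR0 ler_expR mulNr oppr_le0 mulr_ge0 ?sqnorm_ge0// ltW.
have hy : hdot y y <= G%:C.
  apply: (@le_trans _ _ (hdot y y / (fbh_gap mu p)%:C)).
    by rewrite ler_pdivlMr// ler_piMr ?hdot_ge0// -rc1 lerC.
  apply: le_trans hq; rewrite E -subr_ge0.
  rewrite [X in 0 <= X](_ : _ = (nu + 1)%:C * mu%:C * hdot (lsubmx v) (lsubmx v)
    + mu%:C * hdot (lsubmx v) (lsubmx v) * hdot (rsubmx p) (rsubmx p) / (fbh_gap mu p)%:C
    + nsq (hdot y (rsubmx p)) / (fbh_gap mu p)%:C ^+ 2); last by ring.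
  by rewrite !addr_ge0.
have hl : hdot (lsubmx p) (lsubmx p) <= P%:C.
  by apply: le_trans hp; rewrite [X in _ <= X]hdot_split lerDl hdot_ge0.
have hr : hdot (rsubmx p) (rsubmx p) <= P%:C.
  by apply: le_trans hp; rewrite [X in _ <= X]hdot_split lerDr hdot_ge0.
have P0 : 0 <= P by rewrite -lerC; exact: le_trans (hdot_ge0 _) hp.
have X0 : 0 <= X by rewrite /X addr_ge0// divr_ge0// mulr_ge0// ltW.
have hx j : `|lsubmx v 0 j| <= X%:C by exact: norm_coord_le.
have ha : `|a| <= A%:C.
  rewrite normrM norm_rc (gtr0_norm mu0) rcM ler_wpM2l//.
  by apply: norm_hdot => // j; exact: norm_coord_le.
have A0 : 0 <= A by rewrite -lerC; exact: le_trans (normr_ge0 _) ha.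
case: (split_ordP i) => j ->.
  have -> : v 0 (lshift m j) = lsubmx v 0 j by rewrite mxE.
  apply: le_trans (hx j) _; rewrite lerC.
  have : 0 <= A * (P + 1) by rewrite mulr_ge0// addr_ge0.
  lra.
have -> : v 0 (rshift n j) = y 0 j - a * rsubmx p 0 j by rewrite /y !mxE; ring.
apply: le_trans (ler_normB _ _) _; rewrite rcD; apply: lerD.
  apply: (@le_trans _ _ (G + 1)%:C); first exact: norm_coord_le.
  by rewrite lerC; lra.
by rewrite normrM rcM; apply: ler_pM => //; exact: norm_coord_le.
Qed.

End FBHVelocity.

End CurveGerms.

(** * Growth and regularity along curves *)

Section Pluriharmonic.
Context {R : realType}.
Local Notation C := (Cplx R).
Local Notation "x %:C" := (real_complex_def (Phant R) x : C) (format "x %:C").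
Local Notation Re := (@complex.Re R).

(** The mean value theorem on the segment from 0 to t. *)
Lemma wder_mvt (u : C -> R) (a b : C -> C) (K : R) (M : nat) :
  (\forall s \near (0 : C), [/\ wder (fun s => (u s)%:C) s (a s) (b s),
     `|a s| <= K%:C * `|s| ^+ M & `|b s| <= K%:C * `|s| ^+ M]) ->
  u 0 = 0 -> vanish M.+1 (fun s => (u s)%:C).
Proof.
move=> /near0_disc[r r0 H] u0; exists (`|K| * 2).
apply: filterS (near0_norm_lt r0) => t tr.
have line (x : R) : rder (fun y => y%:C * t) x t.
  apply: rder_ext (rderM (rder_id x) (rder_cst t x)) _ _; first by ring.
  by near=> y.
have inr (x : R) : 0 <= x <= 1 -> `|x%:C * t| <= `|t|.
  move=> /andP[x0 x1]; rewrite normrM norm_rc (ger0_norm x0).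
  by rewrite ler_piMl// -rc1 lerC.
have dq (x : R) : 0 <= x <= 1 ->
    is_derive x 1 (fun y => u (y%:C * t)) (Re (a (x%:C * t) * t + b (x%:C * t) * t^*)).
  move=> hx; have [d _ _] := H (x%:C * t) (le_lt_trans (inr x hx) tr).
  exact: (rder_Re (rder_comp (g := fun y => y%:C * t) d (line x))).
have cq : {within `[0, 1], continuous (fun y => u (y%:C * t))}.
  by apply: derivable_within_continuous => x; rewrite in_itv /= => /dq[].
have [x|c] := @MVT R (fun y => u (y%:C * t))
  (fun x => Re (a (x%:C * t) * t + b (x%:C * t) * t^*)) 0 1 ltr01 _ cq.
  by rewrite in_itv /= => /andP[x0 x1]; apply: dq; rewrite !ltW.
rewrite in_itv /= => /andP[c0 c1]; rewrite rc1 mul1r rc0 mul0r u0 !subr0 mulr1 => ->.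
have c01 : 0 <= c <= 1 by rewrite !ltW.
have [_ ha hb] := H (c%:C * t) (le_lt_trans (inr c c01) tr).
rewrite norm_rc; apply: le_trans (norm_Re_le _) _.
have bK x : x <= K%:C * `|c%:C * t| ^+ M -> x <= `|K|%:C * `|t| ^+ M.
  move=> h; apply: le_trans h _; apply: (@le_trans _ _ (`|K|%:C * `|c%:C * t| ^+ M)).
    by apply: ler_wpM2r; rewrite ?exprn_ge0// lerC ler_norm.
  apply: ler_wpM2l; first by rewrite -norm_rc.
  by apply: lerXn2r; rewrite ?nnegrE//; exact: inr.
apply: le_trans (ler_normD _ _) _; rewrite !normrM norm_conjC.
have -> : (`|K| * 2)%:C * `|t| ^+ M.+1 = `|K|%:C * `|t| ^+ M * `|t| + `|K|%:C * `|t| ^+ M * `|t|.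
  by rewrite rcM exprSr; ring.
apply: lerD.
- apply: ler_wpM2r; [exact: normr_ge0|].
  exact: (bK _ ha).
- apply: ler_wpM2r; [exact: normr_ge0|].
  exact: (bK _ hb).
Unshelve. all: by end_near. Qed.

(** Used to see that the derivative of a potential along a holomorphic curve
    is regular enough for the Cauchy formula, without naming the derivatives.
    *)
Definition wsmooth (f : C -> C) := exists a b, wgerm f a b.

Lemma wsmooth_cst c : wsmooth (fun=> c).
Proof. by exists (fun=> 0), (fun=> 0); exact: wgerm_cst. Qed.

Lemma wsmoothD f g : wsmooth f -> wsmooth g -> wsmooth (fun s => f s + g s).
Proof. by move=> [a [b h]] [a' [b' h']]; do 2!eexists; exact: wgermD h h'. Qed.

Lemma wsmoothB f g : wsmooth f -> wsmooth g -> wsmooth (fun s => f s - g s).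
Proof. by move=> [a [b h]] [a' [b' h']]; do 2!eexists; exact: wgermB h h'. Qed.

Lemma wsmoothM f g : wsmooth f -> wsmooth g -> wsmooth (fun s => f s * g s).
Proof. by move=> [a [b h]] [a' [b' h']]; do 2!eexists; exact: wgermM h h'. Qed.

Lemma wsmooth_conj f : wsmooth f -> wsmooth (fun s => (f s)^*).
Proof. by move=> [a [b h]]; do 2!eexists; exact: wgerm_conj h. Qed.

Lemma wsmoothV f : wsmooth f -> f 0 != 0 -> wsmooth (fun s => (f s)^-1).
Proof. by move=> [a [b h]] f0; do 2!eexists; exact: wgermV h f0. Qed.

Lemma wsmooth_holo (f f' : C -> C) : holo f f' -> wsmooth f.
Proof. by move=> /holo_wgerm h; exists f', (fun=> 0). Qed.

Lemma wsmooth_ext f g : wsmooth f -> (forall s, f s = g s) -> wsmooth g.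
Proof. by move=> h E; have -> : g = f by apply/funext => s; rewrite E. Qed.

Lemma wsmooth_sum (I : Type) (r : seq I) (f : I -> C -> C) : (forall i, wsmooth (f i)) ->
  wsmooth (fun s => \sum_(i <- r) f i s).
Proof.
move=> h; elim: r => [|i r IH].
  by apply: wsmooth_ext (wsmooth_cst 0) _ => s; rewrite big_nil.
by apply: wsmooth_ext (wsmoothD (h i) IH) _ => s; rewrite big_cons.
Qed.

Lemma wsmooth_expR (u : C -> R) : wsmooth (fun s => (u s)%:C) -> wsmooth (fun s => (expR (u s))%:C).
Proof.
move=> [a [b h]]; do 2!eexists; apply: (wgerm_real (g := expR) (g' := expR)) h _ _.
  by near=> y; exact: is_derive_expR.
exact: continuous_expR.
Unshelve. all: by end_near. Qed.

Lemma wsmooth_hdot n (g g' h h' : C -> 'rV[C]_n) : holo_curve g g' -> holo_curve h h' ->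
  wsmooth (fun s => hdot (g s) (h s)).
Proof.
move=> cg ch; apply: wsmooth_sum => i; apply: wsmoothM; first exact: wsmooth_holo (cg i).
exact: wsmooth_conj (wsmooth_holo (ch i)).
Qed.

Lemma holo_curve_l n m (g g' : C -> 'rV[C]_(n + m)) : holo_curve g g' ->
  holo_curve (fun s => lsubmx (g s)) (fun s => lsubmx (g' s)).
Proof. by move=> h i; apply: holo_ext (h (lshift m i)) _; apply: nearC => s; rewrite !mxE. Qed.

Lemma holo_curve_r n m (g g' : C -> 'rV[C]_(n + m)) : holo_curve g g' ->
  holo_curve (fun s => rsubmx (g s)) (fun s => rsubmx (g' s)).
Proof. by move=> h i; apply: holo_ext (h (rshift n i)) _; apply: nearC => s; rewrite !mxE. Qed.

Lemma wsmooth_sqnorm n (g g' : C -> 'rV[C]_n) : holo_curve g g' ->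
  wsmooth (fun s => (sqnorm (g s))%:C).
Proof. by move=> h; apply: wsmooth_ext (wsmooth_hdot h h) _ => s; rewrite sqnormE. Qed.

Lemma wsmooth_fbh_exp n m mu (g g' : C -> 'rV[C]_(n + m)) : holo_curve g g' ->
  wsmooth (fun s => (fbh_exp mu (g s))%:C).
Proof.
move=> h; apply: wsmooth_expR.
apply: wsmooth_ext (wsmoothM (wsmooth_cst (- mu)%:C) (wsmooth_sqnorm (holo_curve_l h))) _ => s.
by rewrite rcM.
Qed.

Lemma wsmooth_fbh_gap n m mu (g g' : C -> 'rV[C]_(n + m)) : holo_curve g g' ->
  wsmooth (fun s => (fbh_gap mu (g s))%:C).
Proof.
move=> h; apply: wsmooth_ext (wsmoothB (wsmooth_fbh_exp mu h) (wsmooth_sqnorm (holo_curve_r h))) _.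
by move=> s; rewrite rcB.
Qed.

Lemma wsmooth_fbh_grad n m mu nu (g g' : C -> 'rV[C]_(n + m)) k : holo_curve g g' ->
  FBH_domain mu (g 0) -> wsmooth (fun s => fbh_grad mu nu (g s) 0 k).
Proof.
move=> h /FBH_domainE gap0.
have gapV : wsmooth (fun s => (fbh_gap mu (g s))%:C^-1).
  by apply: wsmoothV (wsmooth_fbh_gap mu h) _; rewrite rc_eq0 gt_eqF.
case: (split_ordP k) => j ->.
  apply: wsmooth_ext (wsmoothM (wsmoothD (wsmooth_cst (nu%:C * mu%:C))
    (wsmoothM (wsmooth_cst mu%:C) (wsmoothM (wsmooth_fbh_exp mu h) gapV))) (wsmooth_holo (holo_curve_l h j))) _.
  by move=> s; rewrite fbh_grad_l.
apply: wsmooth_ext (wsmoothM gapV (wsmooth_holo (holo_curve_r h j))) _.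
by move=> s; rewrite fbh_grad_r.
Qed.

Lemma wsmooth_fs_grad n (g g' : C -> 'rV[C]_n) k : holo_curve g g' ->
  wsmooth (fun s => fs_grad (g s) 0 k).
Proof.
move=> h; have d : wsmooth (fun s => (1 + hdot (g s) (g s))^-1).
  apply: wsmoothV; first exact: wsmoothD (wsmooth_cst 1) (wsmooth_hdot h h).
  by rewrite gt_eqF// fs_denom_gt0.
by apply: wsmooth_ext (wsmoothM d (wsmooth_holo (h k))) _ => s; rewrite mxE.
Qed.

(** The chain rule once more: differentiating d Phi / dzbar (g) paired with g'
    gives the metric evaluated on g'. *)
Lemma wgerm_grad n (U : set 'rV[C]_n) Phi Pb L (g g' : C -> 'rV[C]_n) :
  potential U Phi Pb L -> holo_curve g g' -> (\forall s \near (0 : C), U (g s)) ->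
  (forall k, wsmooth (fun s => Pb (g s) 0 k)) ->
  exists b, wgerm (fun s => hdot (Pb (g s)) (g' s)) (fun s => hdot (L (g s) (g' s)) (g' s)) b.
Proof.
move=> pot hg hU sm.
have [A HA] := choice sm; have [B HB] := choice HA.
have [g'' Hg''] := choice (fun k => holo_derivative (hg k)).
have W := wgerm_sum (index_enum _) (fun k => wgermM (HB k) (wgerm_conj ((holo_wgerm _ _).1 (Hg'' k)))).
eexists; apply: wgerm_ext W _.
have HBn : \forall s \near (0 : C), forall k, wder (fun s => Pb (g s) 0 k) s (A k s) (B k s).
  by apply: near_forall => k; exact: wgerm_near (HB k).
apply: filterS3 (holo_curve_near hg) hU HBn => s cg Us hB; split=> //.
apply: eq_bigr => k _; rewrite conj0 mulr0 addr0; congr (_ * _).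
have [b d] := pot_der2 pot k cg Us.
by have [] := wder_uniq (hB k) d.
Qed.

End Pluriharmonic.

(** * Pluriharmonic differences and rank *)

Section RankBound.
Context {R : realType}.
Local Notation C := (Cplx R).
Local Notation "x %:C" := (real_complex_def (Phant R) x : C) (format "x %:C").
Local Notation Re := (@complex.Re R).

Lemma add_conj (z : C) : z + z^* = (2 * Re z)%:C.
Proof.
case: z => a b; apply: complex_ext => /=; first by ring.
by rewrite subrr.
Qed.

Lemma sos_le M M' (f : C -> C) : (M' <= M)%N -> sos M f -> sos M' f.
Proof. by move=> h [ps v]; exists ps; exact: vanish_le v. Qed.

(** Each square must vanish at the origin, hence be O(|t|^2). *)
Lemma sos_vanish1 (f : C -> C) : sos 1 f -> f 0 = 0 -> vanish 1 f.
Proof.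
move=> [ps v] f0; have [K H] := v.
have E : \sum_(p <- ps) nsq p.[0] = 0.
  have := nbhs_singleton H; rewrite f0 sub0r normrN normr0 expr1 mulr0 => h.
  by apply/eqP; rewrite -normr_le0.
have vp p : p \in ps -> vanish 1 (fun t => nsq p.[t]).
  move=> pin; have p0 : p.[0] = 0.
    move/eqP: E; rewrite psumr_eq0 => [|q _]; last exact: nsq_ge0.
    by move=> /allP/(_ p pin) /=; rewrite nsq_eq0 => /eqP.
  have [p' hp] := holo_poly p; have d := wgerm_wder ((holo_wgerm _ _).1 hp).
  exact: vanishMl (wder_vanish d p0) (vanish_conj (poly_vanish0 p)).
have vs : vanish 1 (fun t => \sum_(p <- ps) nsq p.[t]).
  elim: ps vp {v E K H} => [|p ps IH] vp.
    by apply: vanish_ext (vanish0 1) _; apply: nearC => t; rewrite big_nil.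
  apply: vanish_ext (vanishD (vp p (mem_head _ _)) (IH _)) _.
    by move=> q qin; apply: vp; rewrite in_cons qin orbT.
  by apply: nearC => t; rewrite big_cons.
apply: vanish_ext (vanishD v vs) _; apply: nearC => t; ring.
Qed.

Lemma poly_antiderivative (p : {poly C}) : exists2 h : {poly C}, h.[0] = 0 & h^`() = p.
Proof.
exists (\poly_(i < (size p).+1) (if i is j.+1 then p`_j / j.+1%:R else 0)).
  by rewrite horner_coef0 coef_poly.
apply/polyP => i; rewrite coef_deriv coef_poly ltnS.
case: ltnP => h; last by rewrite mul0rn nth_default.
by rewrite -[LHS]mulr_natr divfK// pnatr_eq0.
Qed.

Lemma wder_poly (p : {poly C}) t : wder (fun s => p.[s]) t p^`().[t] 0.
Proof.
elim/poly_ind: p => [|p c IH].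
  apply: wder_ext (wder_cst 0 t) _ _ _ => //; first by rewrite deriv0 horner0.
  by apply: nearC => s; rewrite horner0.
apply: wder_ext (wderD (wderM IH (wder_id t)) (wder_cst c t)) _ _ _.
- by rewrite derivD derivC derivM derivX !hornerE; ring.
- by ring.
- by apply: nearC => s; rewrite hornerMXaddC.
Qed.

Lemma holo_polyP (p : {poly C}) : holo (fun s => p.[s]) (fun s => p^`().[s]).
Proof.
have [K H] : exists K : R, \forall s \near (0 : C), `|p^`().[s]| <= K%:C.
  by apply/vanish_bounded; exact: poly_vanish0.
by exists K; apply: filterS H => s h; split=> //; exact: wder_poly.
Qed.

Lemma fs_pot_exp n (p : 'rV[C]_n) : (expR (fs_pot p))%:C = 1 + hdot p p.
Proof. by rewrite /fs_pot lnK ?posrE ?ltr_wpDr ?sqnorm_ge0// rcD sqnormE. Qed.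

(** Let h be a polynomial primitive of the jet of phi. The derivative of S -
    log (1 + |F|^2) - 2 Re h is O(|t|^M), so that exp S agrees to order M with
    a positive constant times |e^h|^2 (1 + |F|^2), a sum of N + 1 squares. *)
Lemma exp_rank_bound N (F F' : C -> 'rV[C]_N) (S : C -> R) (phi phi' : C -> C) :
  holo_curve F F' -> holo phi phi' ->
  (\forall s \near (0 : C), wder (fun s => (S s - fs_pot (F s))%:C) s (phi s) (phi s)^*) ->
  forall M, exists2 bs : seq {poly C}, (size bs < N.+2)%N &
    vanish M (fun t => (expR (S t))%:C - \sum_(b <- bs) nsq b.[t]).
Proof.
move=> hF hphi H M.
have [p vp] := holo_jet M hphi; have [h h0 hp] := poly_antiderivative p.
pose T s := S s - fs_pot (F s).
pose G s := T s - T 0 - 2 * Re h.[s].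
have dG : \forall s \near (0 : C), wder (fun s => (G s)%:C) s (phi s - p.[s]) (phi s - p.[s])^*.
  apply: filterS H => s d; have dh := wder_poly h s; rewrite hp in dh.
  apply: wder_ext (wderB (wderB d (wder_cst (T 0)%:C s)) (wderD dh (wder_conj dh))) _ _ _.
  - by rewrite subr0 conj0 addr0.
  - by rewrite subr0 add0r conjB.
  - apply: nearC => u; rewrite /G !rcB; congr (_ - _ - _).
    exact: add_conj.
have G0 : G 0 = 0 by rewrite /G h0 mulr0 subrr subr0.
have [K Kp] := vp.
have vG : vanish M.+1 (fun s => (G s)%:C).
  apply: (@wder_mvt R G (fun s => phi s - p.[s]) (fun s => (phi s - p.[s])^*) K M) => //.
  by apply: filterS2 dG Kp => s d b; split; rewrite ?norm_conjC.
have vG1 : vanish 1 (fun s => (G s)%:C) by exact: vanish_le vG.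
have veG : vanish M (fun s => (expR (G s))%:C - 1).
  have bG k : vanish 0 (fun s => (G s)%:C ^+ k) by exact: (vanishX k (vanish_le (leq0n _) vG1)).
  have v1 : vanish M (fun s => \sum_(0 <= k < M) (k.+1`!%:R^-1)%:C * (G s)%:C ^+ k.+1).
    apply: vanish_sum => k; apply: vanishZ.
    apply: vanish_ext (vanishMl (vanish_le (leqnSn M) vG) (bG k)) _.
    by apply: nearC => s; rewrite exprS.
  apply: vanish_ext (vanishD (vanish_le (leqnSn M) (vanish_exp M.+1 vG1)) v1) _.
  apply: nearC => s; rewrite big_nat_recl//= fact0 invr1 expr0 rc1 mulr1; ring.
have hE := holo_cexp (holo_polyP h).
(* The constant exp (T 0) is absorbed in the squares by its square root. *)
pose k := Num.sqrt (expR (T 0)).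
have hb := holoZ k%:C hE.
have [b0 vb0] := holo_jet M hb.
have [bF vbF] := choice (fun j => holo_jet M (holoM hb (hF j))).
exists (b0 :: [seq bF j | j <- enum 'I_N]); first by rewrite /= size_map size_enum_ord.
have kk : k%:C * k%:C = (expR (T 0))%:C by rewrite -rcM -expr2 sqr_sqrtr ?expR_ge0.
have v1 : vanish M (fun t => nsq (k%:C * cexp h.[t]) - nsq b0.[t]) by exact: nsq_jet.
have v2 : vanish M (fun t => \sum_j (nsq (k%:C * cexp h.[t] * F t 0 j) - nsq (bF j).[t])).
  by apply: vanish_sum => j; exact: nsq_jet.
pose rest t := nsq (k%:C * cexp h.[t]) * (1 + hdot (F t) (F t)).
have bF0 j : vanish 0 (fun t => F t 0 j).
  by have d := wgerm_wder ((holo_wgerm _ _).1 (hF j)); exact: wder_vanish0 d.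
have brest : vanish 0 rest.
  apply: vanishMl.
    have d := wgerm_wder ((holo_wgerm _ _).1 hb).
    exact: vanishMl (wder_vanish0 d) (vanish_conj (wder_vanish0 d)).
  apply: vanishD (vanish_cst 1) _; apply: vanish_sum => j.
  exact: vanishMl (bF0 j) (vanish_conj (bF0 j)).
apply: vanish_ext (vanishD (vanishMl veG brest) (vanishD v1 v2)) _.
apply: nearC => t; rewrite big_cons big_map big_enum /= [X in _ = _ - (_ + X)](eq_bigl predT)//.
have -> : (expR (S t))%:C = (expR (G t))%:C * rest t.
  have -> : S t = G t + (T 0 + 2 * Re h.[t] + fs_pot (F t)) by rewrite /G /T; ring.
  rewrite expRD rcM; congr (_ * _); rewrite expRD rcM fs_pot_exp; congr (_ * _).
  by rewrite expRD rcM nsqM /nsq conj_rc kk normsq_cexp.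
have E : \sum_j nsq (k%:C * cexp h.[t] * F t 0 j) = nsq (k%:C * cexp h.[t]) * hdot (F t) (F t).
  by rewrite mulr_sumr; apply: eq_bigr => j _; rewrite nsqM.
rewrite /rest sumrB E; ring.
Qed.

(** Let phi be the conjugate of the d/dzbar derivative of c Phi (g) - log (1 +
    |F|^2). The d/dz derivative of that derivative is the difference of the
    two metrics on the velocities, which is zero: phi is holomorphic. *)
Lemma pluriharmonic_difference n m N mu nu (c : R) (g g' : C -> 'rV[C]_(n + m))
    (F F' : C -> 'rV[C]_N) :
  holo_curve g g' -> holo_curve F F' -> (\forall s \near (0 : C), FBH_domain mu (g s)) ->
  (\forall s \near (0 : C), c%:C * hdot (fbh_hess mu nu (g s) (g' s)) (g' s) =
     hdot (fs_hess (F s) (F' s)) (F' s)) ->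
  exists phi phi', holo phi phi' /\ \forall s \near (0 : C),
    wder (fun s => (c * FBH_potential mu nu (g s) - fs_pot (F s))%:C) s (phi s) (phi s)^*.
Proof.
move=> hg hF hU E; have U0 := nbhs_singleton hU.
have [b1 w1] := wgerm_grad (@fbh_potential R n m mu nu) hg hU (fun k => wsmooth_fbh_grad nu k hg U0).
have hT : \forall s \near (0 : C), setT (F s) by exact: nearC.
have [b2 w2] := wgerm_grad (@fs_potential R N) hF hT (fun k => wsmooth_fs_grad k hF).
have w := wgermB (wgermZ c%:C w1) w2.
exists (fun s => (c%:C * hdot (fbh_grad mu nu (g s)) (g' s) - hdot (fs_grad (F s)) (F' s))^*).
eexists; split.
  apply/holo_wgerm; apply: wgerm_ext (wgerm_conj w) _; apply: filterS E => s Es.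
  by split=> //; rewrite Es subrr conj0.
apply: filterS3 (holo_curve_near hg) (holo_curve_near hF) hU => s cg cF Us.
have d1 := pot_der1 (@fbh_potential R n m mu nu) cg Us.
have d2 := pot_der1 (@fs_potential R N) cF I.
apply: wder_ext (wderB (wderZ c%:C d1) d2) _ _ _.
- by rewrite conjB conjM conj_rc !hdot_conj.
- by rewrite conjCK.
- by apply: nearC => u; rewrite [RHS]rcB [X in _ = X - _]rcM.
Qed.

End RankBound.

(** * The diastasis along a curve *)

Section Decomposition.
Context {R : realType}.
Local Notation C := (Cplx R).
Local Notation "x %:C" := (real_complex_def (Phant R) x : C) (format "x %:C").
Local Notation Re := (@complex.Re R).

Lemma holo_curve_subr n (f f' : C -> 'rV[C]_n) p : holo_curve f f' ->
  holo_curve (fun s => f s - p) f'.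
Proof.
move=> h i; apply: holo_ext (holoB (h i) (holo_cst (p 0 i))) _.
by apply: nearC => s; rewrite !mxE subr0.
Qed.

Lemma holo_curveZ n (e e' : C -> C) (f f' : C -> 'rV[C]_n) : holo e e' -> holo_curve f f' ->
  holo_curve (fun s => e s *: f s) (fun s => e' s *: f s + e s *: f' s).
Proof.
move=> he h i; apply: holo_ext (holoM he (h i)) _.
by apply: nearC => s; rewrite !mxE.
Qed.

Lemma holo_hdotl n (f f' : C -> 'rV[C]_n) p : holo_curve f f' ->
  holo (fun s => hdot (f s) p) (fun s => hdot (f' s) p).
Proof.
move=> h; apply: holo_ext (holo_sum (index_enum _) (fun i => holoZ (p 0 i)^* (h i))) _.
by apply: nearC => s; split; apply: eq_bigr => i _; rewrite mulrC.
Qed.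

Lemma nsqV (z : C) : nsq z^-1 = (nsq z)^-1.
Proof. by rewrite /nsq conjV invfM mulrC. Qed.

Lemma Re_nsq (z : C) : (Re (nsq z))%:C = nsq z.
Proof. by rewrite /nsq mulC_conj. Qed.

Lemma Re_nsq_gt0 (z : C) : z != 0 -> 0 < Re (nsq z).
Proof. by move=> z0; rewrite -ltrC Re_nsq rc0 lt_def nsq_eq0 z0 nsq_ge0. Qed.

Lemma sos_sqnorm M n (f f' : C -> 'rV[C]_n) : holo_curve f f' ->
  sos M (fun s => hdot (f s) (f s)).
Proof. by move=> h; apply: sos_sum => i; exact: sos_holo (h i). Qed.

(** Both sides measure the defect of the Moebius map of the unit ball that
    sends W to 0. *)
Lemma ball_identity k (w W : 'rV[C]_k) :
  nsq (1 - hdot w W) - (1 - hdot W W) * hdot (w - W) (w - W) - nsq (hdot (w - W) W) =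
  (1 - hdot W W) * (1 - hdot w w).
Proof.
rewrite /nsq !(hdotDl, hdotDr, hdotNl, hdotNr) !(conjB, conjD, conjN, conj1, hdot_conj).
ring.
Qed.

Variables (n m : nat) (mu nu c : R).
Hypotheses (mu0 : 0 < mu) (nu1 : -1 < nu) (c0 : 0 < c).
Variables (g g' : C -> 'rV[C]_(n + m)).
Hypotheses (hg : holo_curve g g') (hU : \forall s \near (0 : C), FBH_domain mu (g s)).

(** The curve g = (z, w) recentered as follows: zeta is z - z (0); wt is w
    times a holomorphic factor ee chosen so that e^(mu |z|^2) |w|^2 = e^(mu
    |zeta|^2) |wt|^2; om is wt - W0, and dd is the denominator of the Moebius
    map of the ball that sends W0 to 0. *)
Let z0 := lsubmx (g 0).
Let zeta s := lsubmx (g s) - z0.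
Let x s := hdot (zeta s) z0.
Let x' s := hdot (lsubmx (g' s)) z0.
Let ee s := cexp (mu%:C * x s + (mu / 2)%:C * hdot z0 z0).
Let wt s := ee s *: rsubmx (g s).
Let wt' s := (ee s * (mu%:C * x' s)) *: rsubmx (g s) + ee s *: rsubmx (g' s).
Let W0 := wt 0.
Let om s := wt s - W0.
Let dd s := 1 - hdot (wt s) W0.
Let bet := 1 - sqnorm W0.
Let kap := c * (nu + 1) * mu.

(** With beta = 1 - |W0|^2, the number 1 - Y is beta (1 - e^(mu |zeta|^2)
    |wt|^2) / |dd|^2: this turns log of the gap into log (1 - Y) and the real
    part of a holomorphic function. *)
Let Y s : R := (bet * sqnorm (om s) + Re (nsq (hdot (om s) W0))
  + bet * (expR (mu * sqnorm (zeta s)) - 1) * sqnorm (wt s)) / Re (nsq (dd s)).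

Let S s : R := kap * sqnorm (zeta s) - c * ln (1 - Y s).

Let hzeta : holo_curve zeta (fun s => lsubmx (g' s)).
Proof. exact: holo_curve_subr (holo_curve_l hg). Qed.

Let hx : holo x x'.
Proof. exact: holo_hdotl. Qed.

Let hee : holo ee (fun s => ee s * (mu%:C * x' s)).
Proof.
apply: holo_ext (holo_cexp (holoD (holoZ mu%:C hx) (holo_cst ((mu / 2)%:C * hdot z0 z0)))) _.
by apply: nearC => s; rewrite addr0.
Qed.

Let hwt : holo_curve wt wt'.
Proof. exact: holo_curveZ hee (holo_curve_r hg). Qed.

Let hom : holo_curve om wt'.
Proof. exact: holo_curve_subr. Qed.

Let hdd : holo dd (fun s => - hdot (wt' s) W0).
Proof.
apply: holo_ext (holoB (holo_cst 1) (holo_hdotl W0 hwt)) _.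
by apply: nearC => s; rewrite sub0r.
Qed.

Let zeta0 : zeta 0 = 0. Proof. by rewrite /zeta subrr. Qed.
Let om0 : om 0 = 0. Proof. by rewrite /om subrr. Qed.

Let sqnorm0 k : sqnorm (0 : 'rV[C]_k) = 0.
Proof. by rewrite /sqnorm big1// => j _; rewrite mxE /= expr0n addr0. Qed.

Let lsubE s : sqnorm (lsubmx (g s)) = sqnorm (zeta s) + 2 * Re (x s) + sqnorm z0.
Proof.
apply: (@complexI R); rewrite !rmorphD /= -add_conj /x hdot_conj.
rewrite -[LHS]/((sqnorm (lsubmx (g s)))%:C) !sqnormE.
have -> : lsubmx (g s) = zeta s + z0 by rewrite /zeta subrK.
by rewrite hdotDl !hdotDr; ring.
Qed.

Let wtE s : sqnorm (wt s) = expR (mu * (2 * Re (x s) + sqnorm z0)) * sqnorm (rsubmx (g s)).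
Proof.
apply: (@complexI R); rewrite -[LHS]/((sqnorm (wt s))%:C) -[RHS]/((_ * _)%:C) sqnormE rcM sqnormE.
rewrite /wt hdotZl hdotZr mulrA; congr (_ * _); rewrite -/(nsq _) /nsq normsq_cexp.
by congr (expR _)%:C; rewrite -sqnormE -rcM ReD Re_rcM /=; field.
Qed.

Let expwtE s : expR (mu * sqnorm (zeta s)) * sqnorm (wt s) =
  expR (mu * sqnorm (lsubmx (g s))) * sqnorm (rsubmx (g s)).
Proof. by rewrite wtE mulrA -expRD lsubE; congr (expR _ * _); ring. Qed.

Let bet0 : 0 < bet.
Proof.
have := expwtE 0; rewrite zeta0 sqnorm0 mulr0 expR0 mul1r -/W0 /bet => ->.
have := nbhs_singleton hU; rewrite /FBH_domain /= => h.
have E : expR (- mu * sqnorm (lsubmx (g 0))) * expR (mu * sqnorm (lsubmx (g 0))) = 1.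
  by rewrite -expRD mulNr addNr expR0.
rewrite subr_gt0 -(@ltr_pM2l _ (expR (- mu * sqnorm (lsubmx (g 0))))) ?expR_gt0//.
by rewrite [X in X < _]mulrA E mul1r mulr1.
Qed.

Let betC : bet%:C = 1 - hdot W0 W0.
Proof. by rewrite /bet rcB sqnormE. Qed.

Let dd0 : dd 0 = bet%:C.
Proof. by rewrite betC. Qed.

Let dd0_neq0 : dd 0 != 0.
Proof. by rewrite dd0 rc_eq0 gt_eqF. Qed.

Let YC s : (Y s)%:C = bet%:C * \sum_i nsq (om s 0 i / dd s) + nsq (hdot (om s) W0 / dd s)
  + bet%:C * (((expR (mu * sqnorm (zeta s)))%:C - 1) * \sum_i nsq (wt s 0 i / dd s)).
Proof.
have E (f : C -> 'rV[C]_m) : \sum_i nsq (f s 0 i / dd s) = hdot (f s) (f s) / nsq (dd s).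
  by rewrite mulr_suml; apply: eq_bigr => i _; rewrite nsqM nsqV.
have rcY (b q h e w d : R) : ((b * q + h + b * (e - 1) * w) / d)%:C =
    (b%:C * q%:C + h%:C + b%:C * (e%:C - 1) * w%:C) / d%:C.
  by rewrite rcM rcV !rcD !rcM rcB.
rewrite (E om) (E wt) nsqM nsqV /Y rcY !Re_nsq !sqnormE.
move: (expR _)%:C bet%:C (hdot (om s) (om s)) (nsq (hdot _ _)) (hdot (wt s) (wt s)) (nsq _)^-1.
by move=> *; ring.
Qed.

Let Y0 : Y 0 = 0.
Proof.
rewrite /Y om0 zeta0 !sqnorm0 !mulr0 expR0 subrr mulr0 mul0r.
by rewrite /hdot big1 ?/nsq ?mul0r ?addr0 ?mul0r// => i _; rewrite mxE mul0r.
Qed.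

Let S0 : S 0 = 0.
Proof. by rewrite /S zeta0 sqnorm0 Y0 subr0 ln1 !mulr0 subrr. Qed.

Let oneY s : dd s != 0 ->
  1 - Y s = bet * (expR (mu * sqnorm (lsubmx (g s))) * fbh_gap mu (g s)) / Re (nsq (dd s)).
Proof.
move=> ds; have nz : Re (nsq (dd s)) != 0 by rewrite gt_eqF// Re_nsq_gt0.
apply: (mulIf nz); rewrite divfK// mulrBl mul1r /Y divfK//.
have -> : expR (mu * sqnorm (lsubmx (g s))) * fbh_gap mu (g s) =
    1 - expR (mu * sqnorm (zeta s)) * sqnorm (wt s).
  rewrite /fbh_gap mulrBr expwtE; congr (_ - _).
  by rewrite /fbh_exp -expRD mulNr subrr expR0.
apply: (@complexI R).
have rcl (b q h e w d : R) : (d - (b * q + h + b * (e - 1) * w))%:C =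
    d%:C - (b%:C * q%:C + h%:C + b%:C * (e%:C - 1) * w%:C).
  by rewrite rcB !rcD !rcM rcB rc1.
have rcr (b e w : R) : (b * (1 - e * w))%:C = b%:C * (1 - e%:C * w%:C).
  by rewrite rcM rcB rc1 rcM.
apply: (etrans (rcl _ _ _ _ _ _)); apply: (etrans _ (esym (rcr _ _ _))).
rewrite !Re_nsq !sqnormE betC.
have alg (A b q h e w : C) : A - b * q - h = b * (1 - w) ->
    A - (b * q + h + b * (e - 1) * w) = b * (1 - e * w).
  by move=> H; transitivity (A - b * q - h - b * (e - 1) * w); [ring|rewrite H; ring].
exact: (alg _ _ _ _ _ _ (ball_identity (wt s) W0)).
Qed.

Let dd_near : \forall s \near (0 : C), dd s != 0.
Proof.
have d := wgerm_wder ((holo_wgerm _ _).1 hdd).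
exact: tends_neq0 (wder_cont d) dd0_neq0.
Qed.

(** S is obtained from c Phi by subtracting the real parts of holomorphic
    functions, and it is a sum of squares vanishing at 0. *)
Let SE : \forall s \near (0 : C), S s = c * FBH_potential mu nu (g s)
  - kap * (2 * Re (x s) + sqnorm z0) - c * ln bet + c * ln (Re (nsq (dd s))).
Proof.
apply: filterS2 hU dd_near => s /FBH_domainE gap0 ds.
have n0 := Re_nsq_gt0 ds.
rewrite /S oneY// lnM ?posrE ?invr_gt0// ?mulr_gt0 ?expR_gt0//.
rewrite lnV ?posrE// lnM ?posrE ?mulr_gt0 ?expR_gt0// lnM ?posrE ?expR_gt0// expRK.
rewrite /FBH_potential -/(fbh_exp mu (g s)) -/(fbh_gap mu (g s)) lsubE /kap.
by ring.
Qed.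

(** The functions subtracted from c Phi in [SE] are pluriharmonic: the real
    part of x, and log |dd|^2. *)
Let S_pluriharmonic N (F F' : C -> 'rV[C]_N) : holo_curve F F' ->
  (\forall s \near (0 : C), c%:C * hdot (fbh_hess mu nu (g s) (g' s)) (g' s) =
     hdot (fs_hess (F s) (F' s)) (F' s)) ->
  exists phi phi', holo phi phi' /\ \forall s \near (0 : C),
    wder (fun s => (S s - fs_pot (F s))%:C) s (phi s) (phi s)^*.
Proof.
move=> hF E; have [phi [phi' [hphi H]]] := pluriharmonic_difference hg hF hU E.
have [d1 hd1] := holo_derivative hdd; have [x1 hx1] := holo_derivative hx.
eexists; eexists; split.
  exact: holoD (holoB hphi (holoZ kap%:C hx1)) (holoZ c%:C (holoM hd1 (holoV hdd dd0_neq0))).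
have nx : \forall s \near (0 : C), wder x s (x' s) 0 by have [K] := hx; apply: filterS => s [].
have nd : \forall s \near (0 : C), wder dd s (- hdot (wt' s) W0) 0.
  by have [K] := hdd; apply: filterS => s [].
have nd2 : \forall s \near (0 : C), wder dd s (- hdot (wt' s) W0) 0 /\ dd s != 0.
  by apply: filterS2 nd dd_near => s.
have H2 : \forall s \near (0 : C), (wder dd s (- hdot (wt' s) W0) 0 /\ dd s != 0) /\
    \forall r \near s, S r = c * FBH_potential mu nu (g r)
  - kap * (2 * Re (x r) + sqnorm z0) - c * ln bet + c * ln (Re (nsq (dd r))).
  by apply: filterS2 nd2 (near_near SE) => s.
apply: filterS3 H nx H2 => s dH dx [[ddd ds] Es].
move: (- hdot (wt' s) W0) ddd => d' ddd.
have dn : wder (fun r => (Re (nsq (dd r)))%:C) s (d' * (dd s)^*) (dd s * d'^*).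
  apply: wder_ext (wderM ddd (wder_conj ddd)) _ _ _.
  - by rewrite conj0 mulr0 addr0.
  - by rewrite mul0r add0r.
  - by apply: nearC => r; rewrite Re_nsq.
have dl := wder_comp_real dn (is_derive1_ln (Re_nsq_gt0 ds)).
have dsc : (dd s)^* != 0 by rewrite conjC_eq0.
have nsqVE : ((Re (nsq (dd s)))^-1)%:C = (dd s * (dd s)^*)^-1 by rewrite rcV Re_nsq.
apply: wder_ext (wderD (wderB (wderB dH (wderZ kap%:C (wderD dx (wder_conj dx))))
  (wder_cst (kap * sqnorm z0 + c * ln bet)%:C s)) (wderZ c%:C dl)) _ _ _.
- rewrite nsqVE conj0; move: (dd s) (dd s)^* ds dsc => u v u0 v0.
  by field; rewrite u0 v0.
- rewrite nsqVE conjD conjB !conjM !conj_rc conjV.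
  move: (dd s) (dd s)^* ds dsc => u v u0 v0.
  by field; rewrite u0 v0.
- apply: filterS Es => r ->.
  have rcE (p k y e l f h : R) : (p - k * (2 * y + e) - l + h - f)%:C =
      (p - f)%:C - k%:C * (2 * y)%:C - (k * e + l)%:C + h%:C.
    by rewrite !(rcD, rcB, rcM); ring.
  apply: (etrans _ (esym (rcE _ _ _ _ _ _ _))).
  have <- := add_conj (x r); congr (_ - _ - _ + _).
  exact: esym (rcM _ _).
Qed.

Let Y_vanish : vanish 1 (fun s => (Y s)%:C) /\ forall M, sos M (fun s => (Y s)%:C).
Proof.
have hV := holoV hdd dd0_neq0.
have sY M : sos M.+1 (fun s => (Y s)%:C).
  have mz : sos M.+1 (fun s => (mu * sqnorm (zeta s))%:C).
    apply: sos_ext (sosZ (ltW mu0) (sos_sqnorm M.+1 hzeta)) _.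
    by apply: vanish_refl => s; rewrite rcM sqnormE.
  have mz0 : vanish 1 (fun s => (mu * sqnorm (zeta s))%:C).
    apply: sos_vanish1; last by rewrite zeta0 sqnorm0 mulr0.
    exact: sos_le mz.
  have s1 := sos_expB1 mz0 mz.
  have so i : sos M.+1 (fun s => nsq (om s 0 i / dd s)) by exact: sos_holo (holoM (hom i) hV).
  have sw i : sos M.+1 (fun s => nsq (wt s 0 i / dd s)) by exact: sos_holo (holoM (hwt i) hV).
  have sh : sos M.+1 (fun s => nsq (hdot (om s) W0 / dd s)).
    exact: sos_holo (holoM (holo_hdotl W0 hom) hV).
  apply: sos_ext (sosD (sosD (sosZ (ltW bet0) (sos_sum (index_enum _) so)) sh)
    (sosZ (ltW bet0) (sosM s1 (sos_sum (index_enum _) sw)))) _.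
  by apply: vanish_refl => s; rewrite YC.
split; last by move=> M; exact: sos_le (sY M).
by apply: sos_vanish1; [exact: sY|rewrite Y0].
Qed.

Let kap0 : 0 < kap.
Proof. by rewrite /kap !mulr_gt0//; have := nu1; lra. Qed.

(** Once one square |u|^2 is split off S, the rest vanishes at the origin, as
    S and u do there. *)
Let no_rank N (u u' : C -> C) :
  holo u u' -> u 0 = 0 -> u' 0 != 0 ->
  (forall M, sos M (fun s => (S s)%:C - nsq (u s))) ->
  ~ (forall M, exists2 bs : seq {poly C}, (size bs < N)%N &
      vanish M (fun t => (expR (S t))%:C - \sum_(b <- bs) nsq b.[t])).
Proof.
move=> hu u0 u'0 sS; pose S2 s := S s - Re (nsq (u s)).
have S2E s : (S2 s)%:C = (S s)%:C - nsq (u s) by rewrite rcB Re_nsq.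
have s2 M : sos M (fun s => (S2 s)%:C).
  by apply: sos_ext (sS M) _; apply: vanish_refl => s; rewrite S2E.
apply: (@no_finite_rank R N u u' S S2) => //.
- by move=> t; rewrite S2E; ring.
- by apply: sos_vanish1 => //; rewrite S2E S0 u0 /nsq mul0r subr0.
Qed.

(** The rank bound on exp S excludes a square |u|^2 in S with u'(0) nonzero.
    The coordinates of zeta contribute such a square if the horizontal
    velocity is not zero. If it is zero, then the velocity of om at 0 is a
    nonzero multiple of the vertical velocity, and the linear term of - log (1
    - Y) contributes the squares of om / dd. *)
Theorem no_common_curve N (F F' : C -> 'rV[C]_N) : holo_curve F F' ->
  (\forall s \near (0 : C), c%:C * hdot (fbh_hess mu nu (g s) (g' s)) (g' s) =
     hdot (fs_hess (F s) (F' s)) (F' s)) -> g' 0 = 0.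
Proof.
move=> hF E; have [phi [phi' [hphi H]]] := S_pluriharmonic hF E.
have rk := exp_rank_bound hF hphi H.
have [vY sY] := Y_vanish.
have slog M : sos M (fun s => c%:C * (- ln (1 - Y s) - Y s)%:C).
  exact: sosZ (ltW c0) (sos_nlogB vY (sY M)).
have SEC s : (S s)%:C = kap%:C * (\sum_i nsq (zeta s 0 i)) + c%:C * (- ln (1 - Y s) - Y s)%:C + c%:C * (Y s)%:C.
  rewrite -hdot_nsq -sqnormE -!rcM -!rcD; congr _%:C; rewrite /S; ring.
have l0 : lsubmx (g' 0) = 0.
  apply/rowP => i; rewrite [RHS]mxE; apply/eqP/negPn/negP => li.
  pose k := Num.sqrt kap.
  have kk : k%:C * k%:C = kap%:C by rewrite -rcM -expr2 sqr_sqrtr// ltW.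
  have k0 : k%:C != 0 by rewrite rc_eq0 gt_eqF// sqrtr_gt0.
  apply: (no_rank (holoZ k%:C (hzeta i)) _ _ _ rk).
  - by rewrite zeta0 mxE mulr0.
  - by rewrite mulf_neq0.
  - move=> M.
    have s1 : sos M (fun s => kap%:C * (\sum_(j | j != i) nsq (zeta s 0 j))).
      apply: sosZ; first exact: ltW.
      apply: sos_ext (sos_sum [seq j <- index_enum _ | j != i] (fun j => sos_holo M (hzeta j))) _.
      by apply: vanish_refl => s; rewrite big_filter.
    apply: sos_ext (sosD (sosD s1 (slog M)) (sosZ (ltW c0) (sY M))) _.
    apply: vanish_refl => s; rewrite SEC (nsqM k%:C).
    have -> : \sum_j nsq (zeta s 0 j) =
      nsq (zeta s 0 i) + \sum_(j | j != i) nsq (zeta s 0 j) by rewrite (bigD1 i).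
    rewrite [nsq k%:C](_ : _ = kap%:C); first by ring.
    by rewrite /nsq conj_rc.
have r0 : rsubmx (g' 0) = 0.
  apply/rowP => i; rewrite [RHS]mxE; apply/eqP/negPn/negP => ri.
  pose k := Num.sqrt (c * bet).
  have cb0 : 0 < c * bet by rewrite mulr_gt0.
  have kk : k%:C * k%:C = c%:C * bet%:C by rewrite -!rcM -expr2 sqr_sqrtr// ltW.
  have k0 : k%:C != 0 by rewrite rc_eq0 gt_eqF// sqrtr_gt0.
  have hV := holoV hdd dd0_neq0.
  apply: (no_rank (holoZ k%:C (holoM (hom i) hV)) _ _ _ rk).
  - by rewrite om0 mxE mul0r mulr0.
  - rewrite om0 [(0 : 'rV_m) 0 i]mxE mul0r addr0 mulf_neq0// mulf_neq0 ?invr_eq0//.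
    rewrite /wt' /x' l0 /hdot big1 => [|j _]; last by rewrite mxE mul0r.
    rewrite !mulr0 scale0r add0r mxE mulf_neq0//; exact: cexp_neq0.
  - move=> M.
    have s1 : sos M (fun s => kap%:C * (\sum_j nsq (zeta s 0 j))).
      apply: sosZ; first exact: ltW.
      exact: sos_sum (fun j => sos_holo M (hzeta j)).
    have s2 : sos M (fun s => (c * bet)%:C * (\sum_(j | j != i) nsq (om s 0 j / dd s))).
      apply: sosZ; first exact: ltW.
      apply: sos_ext (sos_sum [seq j <- index_enum _ | j != i] (fun j => sos_holo M (holoM (hom j) hV))) _.
      by apply: vanish_refl => s; rewrite big_filter.
    have sh : sos M (fun s => c%:C * nsq (hdot (om s) W0 / dd s)).
      exact: sosZ (ltW c0) (sos_holo M (holoM (holo_hdotl W0 hom) hV)).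
    have sw : sos M (fun s => (c * bet)%:C * (((expR (mu * sqnorm (zeta s)))%:C - 1) * \sum_j nsq (wt s 0 j / dd s))).
      apply: sosZ; first exact: ltW.
      apply: sosM; last by apply: sos_sum => j; exact: sos_holo (holoM (hwt j) hV).
      have mz L : sos L (fun s => (mu * sqnorm (zeta s))%:C).
        apply: sos_ext (sosZ (ltW mu0) (sos_sqnorm L hzeta)) _.
        by apply: vanish_refl => s; rewrite rcM sqnormE.
      have mz0 : vanish 1 (fun s => (mu * sqnorm (zeta s))%:C).
        by apply: sos_vanish1; rewrite ?zeta0 ?sqnorm0 ?mulr0.
      exact: sos_le (sos_expB1 mz0 (mz M.+1)).
    apply: sos_ext (sosD (sosD (sosD s1 (slog M)) s2) (sosD sh sw)) _.
    apply: vanish_refl => s; rewrite SEC YC (nsqM k%:C).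
    have -> : \sum_j nsq (om s 0 j / dd s) =
      nsq (om s 0 i / dd s) + \sum_(j | j != i) nsq (om s 0 j / dd s).
      by rewrite (bigD1 i).
    rewrite [nsq k%:C](_ : _ = c%:C * bet%:C); last by rewrite /nsq conj_rc.
    by rewrite rcM; ring.
by rewrite -(hsubmxK (g' 0)) l0 r0 row_mx0.
Qed.

End Decomposition.

(** * From manifolds to curves *)

(** The differential depends only on the germ: the o-term of f serves for g.
    *)
Lemma near_eq_diff (K : numFieldType) (V W : normedModType K) (f g : V -> W) (x : V) :
  (\forall y \near x, f y = g y) -> differentiable f x ->
  differentiable g x /\ ('d g x = 'd f x :> (V -> W)).
Proof.
move=> fg df; have [cdf] := (diff_locallyP x f).1 df => /eqaddoP lf.
have e : g \o shift x = cst (g x) + 'd f x +o_ 0 id.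
  apply/eqaddoP => eps eps0; have lfe := lf _ eps0.
  have fg0 : \forall h \near (0 : V), f (h + x) = g (h + x).
    by have := fg; rewrite (near_shift 0 x) subr0.
  apply: filterS2 fg0 lfe => h /= fgh.
  rewrite -!/(_ - _) !fctE /= /shift /= fgh.
  by rewrite (nbhs_singleton fg).
have dg := diff_unique cdf e.
by split=> //; apply/diff_locallyP; rewrite dg.
Qed.

Lemma mul_jacobian (K : numFieldType) n m (f : 'rV[K]_n -> 'rV[K]_m) x v :
  v *m jacobian f x = 'd f x v.
Proof. exact: mul_rV_lin1. Qed.

Lemma row_jacobian (K : numFieldType) n m (f : 'rV[K]_n -> 'rV[K]_m) x i :
  row i (jacobian f x) = 'd f x (delta_mx 0 i).
Proof. by rewrite rowE mul_jacobian. Qed.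

Lemma near_eq_jacobian (K : numFieldType) n m (f g : 'rV[K]_n -> 'rV[K]_m) x :
  (\forall y \near x, f y = g y) -> differentiable f x ->
  differentiable g x /\ jacobian g x = jacobian f x.
Proof.
move=> fg df; have [dg E] := near_eq_diff fg df; split; first exact: dg.
apply/row_matrixP => i.
exact: etrans (row_jacobian g x i)
  (etrans (congr1 (@^~ (delta_mx 0 i)) E) (esym (row_jacobian f x i))).
Qed.

Lemma jacobian_comp (K : numFieldType) n m p (f : 'rV[K]_n -> 'rV[K]_m)
  (g : 'rV[K]_m -> 'rV[K]_p) x : differentiable f x -> differentiable g (f x) ->
  jacobian (g \o f) x = jacobian f x *m jacobian g (f x).
Proof.
move=> df dg; apply/row_matrixP => i.
rewrite row_mul (row_jacobian f) mul_jacobian; apply: etrans (row_jacobian _ x i) _.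
exact: (congr1 (@^~ (delta_mx 0 i)) (diff_comp df dg)).
Qed.

Section Geometry.
Context {R : realType}.
Local Notation C := (Cplx R).
Local Notation "x %:C" := (real_complex_def (Phant R) x : C) (format "x %:C").

Lemma wder_of_quotient (f : C -> C) (t a : C) :
  h^-1 * (f (h + t) - f t) @[h --> (0 : C)^'] --> a -> wder f t a 0.
Proof.
move=> cf; pose A s := if s == t then a else (f s - f t) / (s - t).
exists A, (fun=> 0); split; [|exact: tends_cst|]; last first.
  apply: nearC => s; rewrite mul0r addr0 /A; case: eqVneq => [->|st].
    by rewrite subrr mulr0 addr0.
  by rewrite divfK ?subr_eq0// addrC subrK.
pose Q h := if h == 0 then a else h^-1 * (f (h + t) - f t).
have cQ : {for (0 : C), continuous Q}.
  apply/continuous_withinNx; rewrite {2}/Q eqxx; apply: cvg_trans cf.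
  apply: near_eq_cvg.
  have n0 : \forall h \near (0 : C)^', h != 0 by exact: nbhs_dnbhs_neq.
  by apply: filterS n0 => h h0; rewrite /Q (negbTE h0).
have tQ : tends (nbhs (0 : C)) Q (Q 0) by split; exact: cQ.
rewrite [Q 0]/Q eqxx in tQ; apply: tends_ext (tends_comp (tends_sub t) tQ).
apply: nearC => s; rewrite /Q /A subr_eq0; case: eqVneq => // st.
by rewrite subrK mulrC.
Qed.

Lemma curve_differentiable n m (h : 'rV[C]_n -> 'rV[C]_m) p v t :
  differentiable h (p + t *: v) ->
  curve (fun s => h (p + s *: v)) t (v *m jacobian h (p + t *: v)).
Proof.
move=> dh i; apply: wder_of_quotient.
have J := deriveEjacobian v dh.
have D : k^-1 *: (h (k *: v + (p + t *: v)) - h (p + t *: v)) @[k --> (0 : C)^']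
    --> v *m jacobian h (p + t *: v).
  by rewrite -J; exact: (diff_derivable (v := v) dh).
have cD := continuous_cvg _ (@coord_continuous C 1 m 0 i _) D.
have [cE] : tends ((0 : C)^') (fun k => (k^-1 *: (h (k *: v + (p + t *: v)) - h (p + t *: v))) 0 i)
  ((v *m jacobian h (p + t *: v)) 0 i) by split; exact: cD.
suff [//] : tends ((0 : C)^') (fun k => k^-1 * (h (p + (k + t) *: v) 0 i - h (p + t *: v) 0 i))
  ((v *m jacobian h (p + t *: v)) 0 i).
apply: tends_ext (Tends cE).
apply: (@filterS _ _ _ setT) => [k _|]; last exact: filterT.
have -> : k *: v + (p + t *: v) = p + (k + t) *: v by rewrite scalerDl addrCA.
by move: (h _) (h _) => a b; rewrite !mxE.
Qed.

Implicit Types M N S : hermitian_space R.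

Lemma near_chart_inv M (i : chart_index M) (p : M) (Q : M -> Prop) :
  is_chart i -> chart_dom i p -> (\forall q \near p, Q q) ->
  \forall z \near chart_map i p,
    [/\ chart_dom i (chart_inv i z), chart_map i (chart_inv i z) = z & Q (chart_inv i z)].
Proof.
move=> [oD oI mapK _ cinv] ip Qp.
have im : \forall z \near chart_map i p, (chart_map i @` chart_dom i) z.
  by apply: open_nbhs_nbhs; split=> //; exists p.
have Qz : \forall z \near chart_map i p, Q (chart_inv i z).
  have /= c := cinv p ip.
  by apply: c; rewrite mapK.
apply: filterS2 im Qz => z [q iq <-]; rewrite mapK//.
Qed.

(** The pointwise condition of a holomorphic isometry, in all charts around p
    and f p. It is stable under composition. *)
Definition iso_at M N (f : M -> N) (p : M) :=
  {for p, continuous f} /\ forall i j, chart_dom i p -> chart_dom j (f p) ->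
    differentiable (local_expr f i j) (chart_map i p) /\
    metric i (chart_map i p) = pullback_metric f i j (chart_map i p).

Lemma iso_at_on M N (U : set M) (f : M -> N) (p : M) :
  holomorphic_on U f -> isometric_on U f -> U p -> iso_at f p.
Proof.
move=> hf mf Up; have [cf df] := hf p Up; split=> // i j ip jp.
by split; [exact: df|exact: mf].
Qed.

Lemma adjmxM m n p (A : 'M[C]_(m, n)) (B : 'M[C]_(n, p)) :
  adjmx (A *m B) = adjmx B *m adjmx A.
Proof. by rewrite /adjmx trmx_mul map_mxM. Qed.

(** Near p, the chart j of N may be inserted between f and g since f is
    continuous. *)
Lemma local_expr_comp M N S (f : M -> N) (g : N -> S) (p : M) i j k :
  is_chart i -> is_chart j -> chart_dom i p -> chart_dom j (f p) ->
  {for p, continuous f} ->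
  \forall z \near chart_map i p,
    (local_expr g j k \o local_expr f i j) z = local_expr (g \o f) i k z.
Proof.
move=> ci cj ip jp cf.
have nD : \forall q \near p, chart_dom j (f q).
  have [oD _ _ _ _] := cj; apply: cf; exact: open_nbhs_nbhs.
apply: filterS (near_chart_inv ci ip nD) => z [_ _ jz].
by rewrite /local_expr /=; have [_ _ -> //] := cj.
Qed.

(** The chain rule for Jacobians, applied in any chart of N around f p. *)
Lemma iso_at_comp M N S (f : M -> N) (g : N -> S) (p : M) :
  (forall i : chart_index M, is_chart i) -> complex_manifold N ->
  iso_at f p -> iso_at g (f p) -> iso_at (g \o f) p.
Proof.
move=> cM [_ _ covN cN _] [cf If] [cg Ig]; split.
  by apply: continuous_comp; [exact: cf|exact: cg].
move=> i k ip kp; have [j jp] := covN (f p).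
have [df mf] := If i j ip jp; have [dg mg] := Ig j k jp kp.
have fE : local_expr f i j (chart_map i p) = chart_map j (f p).
  by rewrite /local_expr; have [_ _ -> //] := cM i.
have dg' : differentiable (local_expr g j k) (local_expr f i j (chart_map i p)).
  by rewrite fE.
have [d JE] := near_eq_jacobian (local_expr_comp g k (cM i) (cN j) ip jp cf)
  (differentiable_comp df dg').
split; first exact: d.
have gE : local_expr (g \o f) i k (chart_map i p) = local_expr g j k (chart_map j (f p)).
  have [_ _ mK _ _] := cM i; have [_ _ nK _ _] := cN j.
  by rewrite /local_expr (mK p ip) (nK (f p) jp).
rewrite /pullback_metric gE JE (jacobian_comp df dg') fE mf /pullback_metric fE mg.
by rewrite /pullback_metric adjmxM !mulmxA.
Qed.

Lemma mulmx_delta_quad n (A : 'M[C]_n) a :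
  ((delta_mx 0 a : 'rV[C]_n) *m A *m adjmx (delta_mx 0 a : 'rV[C]_n)) 0 0 = A a a.
Proof.
rewrite -rowE mxE (bigD1 a)//= big1 ?addr0 => [|j ja].
  by rewrite !mxE !eqxx rmorph1 mulr1.
by rewrite !mxE eqxx (negbTE ja) rmorph0 mulr0.
Qed.

Lemma near_line (V : normedModType C) (p v : V) (Q : V -> Prop) :
  (\forall z \near p, Q z) -> \forall s \near (0 : C), Q (p + s *: v).
Proof.
move=> Qp.
have c1 : s *: v @[s --> (0 : C)] --> (0 : C) *: v.
  exact: (@cvgZr_tmp C V C (nbhs (0 : C)) _ (fun s => s) 0 v (@cvg_id C (nbhs (0 : C)))).
have c : (p + s *: v) @[s --> (0 : C)] --> p + (0 : C) *: v.
  exact: (cvgD (cvg_cst p) c1).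
by apply: c; rewrite scale0r addr0.
Qed.

(** The restriction of f to the a-th coordinate line of the chart i: its
    velocity has squared length the diagonal entry of the metric of the
    source. *)
Lemma iso_curve M N (f : M -> N) (p : M) i j (a : 'I_(cdim M)) :
  is_chart i -> chart_dom i p -> chart_dom j (f p) -> open (chart_dom j) ->
  (\forall q \near p, iso_at f q) ->
  let z s := chart_map i p + s *: delta_mx 0 a in
  let g s := local_expr f i j (z s) in
  let g' s := delta_mx 0 a *m jacobian (local_expr f i j) (z s) in
  \forall s \near (0 : C), [/\ curve g s (g' s), chart_dom j (f (chart_inv i (z s))) &
    (g' s *m metric j (g s) *m adjmx (g' s)) 0 0 = metric i (z s) a a].
Proof.
move=> ci ip jp oj nf z g g'.
have cf : {for p, continuous f} by have [] := nbhs_singleton nf.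
have nj : \forall q \near p, chart_dom j (f q) by apply: cf; exact: open_nbhs_nbhs.
have nQ : \forall q \near p, iso_at f q /\ chart_dom j (f q) by apply: filterS2 nf nj.
apply: filterS (near_line (delta_mx 0 a) (near_chart_inv ci ip nQ)) => s.
rewrite -/(z s) => -[iq qE [[_ If] jq]].
have [df mf] := If i j iq jq; rewrite qE in df mf.
split=> //; first exact: curve_differentiable.
rewrite -[RHS]mulmx_delta_quad mf /g' adjmxM /pullback_metric -/(g s).
by rewrite !mulmxA.
Qed.

Local Open Scope quotient_scope.

Lemma homogeneous_neq0 (N : nat) (u : @nonzero_vectors R N) k :
  (homogeneous (\pi_(@CP_quot R N) u : @CP_space R N) 0 k != 0) = (set_val u 0 k != 0).
Proof.
have /andP[s1 s2] : same_line (repr (\pi_(@CP_quot R N) u)) u.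
  by apply/eqmodP; rewrite reprK.
have aux (x y : 'rV[C]_N.+1) : (x <= y)%MS -> x 0 k != 0 -> y 0 k != 0.
  by move=> /sub_rVP[a ->]; rewrite mxE mulf_eq0 => /norP[].
by apply/idP/idP; exact: aux.
Qed.

(** Lifted to nonzero vectors, the domain of the chart is the open set where v
    k is not zero, because this condition is the same on all representatives
    of a line. *)
Lemma open_CP_chart (N : nat) k : open (chart_dom k : set (@CP R N)).
Proof.
change (open ((\pi_(@CP_quot R N) : @nonzero_vectors R N -> @CP_quot R N) @^-1` [set x : @CP_space R N | homogeneous x 0 k != 0])).
have -> : ((\pi_(@CP_quot R N) : @nonzero_vectors R N -> @CP_quot R N) @^-1` [set x : @CP_space R N | homogeneous x 0 k != 0])
  = set_val @^-1` [set v : 'rV[C]_N.+1 | v 0 k != 0].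
  by apply/funext => u; rewrite /preimage /= homogeneous_neq0.
apply: open_comp => [u _|]; first exact: (@initial_continuous _ _ (@set_val _ (@nonzero_vectors R N))).
have -> : [set v : 'rV[C]_N.+1 | v 0 k != 0] = (fun v => v 0 k) @^-1` [set x : C | x != 0] by [].
apply: open_comp => [v _|]; first exact: coord_continuous.
by rewrite openE => x x0; exact: (tends_neq0 (tends_id x) x0).
Qed.

Lemma CP_chart_exists (N : nat) (x : @CP R N) : exists k, chart_dom k x.
Proof.
have : homogeneous x != 0 by have := set_valP (repr (x : CP_quot N)).
apply: contra_neqP => /forallNP h; apply/rowP => k; rewrite [RHS]mxE.
by apply/eqP/negPn/negP; exact: h.
Qed.

(** The squared length q common to both curves is bounded, hence so are both
    velocities, and the two curves are holomorphic germs in the sense of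
    [holo]. *)
Lemma isometric_curves_velocity0 n m (mu nu c : R) (N : nat) (g g' : C -> 'rV[C]_(n + m))
  (F F' : C -> 'rV[C]_N) (q : C -> C) (B : R) :
  0 < mu -> -1 < nu -> 0 < c ->
  (\forall s \near (0 : C), [/\ curve g s (g' s), FBH_domain mu (g s) &
    c%:C * hdot (fbh_hess mu nu (g s) (g' s)) (g' s) = q s]) ->
  (\forall s \near (0 : C), curve F s (F' s) /\ hdot (fs_hess (F s) (F' s)) (F' s) = q s) ->
  (\forall s \near (0 : C), `|q s| <= B%:C) ->
  g' 0 = 0.
Proof.
move=> mu0 nu1 c0 Hg HF Hq.
have [cg0 _ _] := nbhs_singleton Hg; have [cF0 _] := nbhs_singleton HF.
have [Pg bg] := curve_bounded cg0; have [PF bF] := curve_bounded cF0.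
have nc : `|c%:C| = c%:C by rewrite norm_rc gtr0_norm.
have hg : holo_curve g g'.
  apply: (@holo_curve_bounded _ _ _ _ _); apply: filterS3 Hg Hq bg => s [cs ds es] qs ps.
  split=> // i.
  apply: (fbh_velocity_bounded (G := B / c) mu0 nu1 ds ps) => //.
  have cC0 : 0 < c%:C by rewrite -rc0 ltrC.
  have cB : c%:C * (B / c)%:C = B%:C.
    by apply: etrans (esym (rcM _ _)) _; congr _%:C; rewrite mulrC divfK// gt_eqF.
  rewrite -(ler_pM2l cC0) cB -[X in X * _]nc -normrM es.
  exact: qs.
have hF : holo_curve F F'.
  apply: (@holo_curve_bounded _ _ _ _ _); apply: filterS3 HF Hq bF => s [cs es] qs ps.
  split=> // i; apply: (fs_velocity_bounded i ps (G := B)).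
  by rewrite es.
apply: (no_common_curve mu0 nu1 c0 hg _ hF).
- by apply: filterS Hg => s [].
- by apply: filterS2 Hg HF => s [_ _ ->] [_ ->].
Qed.

Lemma metric_bounded M (i : chart_index M) (p : M) a :
  kahler M -> chart_dom i p -> exists B : R, \forall s \near (0 : C),
    `|metric i (chart_map i p + s *: delta_mx 0 a) a a| <= B%:C.
Proof.
move=> [_ _ _ sm _] ip.
have c : {for chart_map i p, continuous (fun z => metric i z a a)}.
  by apply: (sm i a a 0%N); exists p.
have t : tends (nbhs (chart_map i p)) (fun z => metric i z a a) (metric i (chart_map i p) a a).
  by split; exact: c.
have [B nB] := tends_bounded t; exists B.
exact: (near_line (Q := fun z => `|metric i z a a| <= B%:C) (delta_mx 0 a) nB).
Qed.

(** A coordinate line of the common submanifold S1, seen in the domain through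
    f, and in projective space through S2 and P, gives two isometric
    holomorphic curves; the velocity of the first one is not zero since f is
    an immersion. *)
Theorem FBH_not_relative n m (mu nu c : R) (P : hermitian_space R) :
  0 < mu -> -1 < nu -> 0 < c -> projective_kahler P ->
  ~ relatives (scale_metric c (@FBH R n m mu nu)) P.
Proof.
move=> mu0 nu1 c0 [kP [N imP]] [S1 [S2 [f [g [F [subf subg [s _] dim [G [_ _ hF _ mF]]]]]]]].
have [kS1 _ hf immf mf] := subf; have [kS2 _ hg _ mg] := subg.
have [mS1 _ _ _ _] := kS1; have [mS2 _ _ _ _] := kS2; have [mP _ _ _ _] := kP.
have [_ _ covS cS _] := mS1; have [i is_] := covS s.
pose a : 'I_(cdim S1) := Ordinal dim.
have [U [fP [oU Us hfP _ mfP]]] := imP (g (F s)).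
have gF q : iso_at (g \o F) q.
  exact: iso_at_comp cS mS2 (iso_at_on hF mF I) (iso_at_on hg mg I).
have Hnear : \forall q \near s, iso_at (fP \o (g \o F)) q.
  have nU : \forall q \near s, U ((g \o F) q).
    by have [cgF _] := gF s; apply: cgF; exact: open_nbhs_nbhs.
  apply: filterS nU => q Uq.
  exact: iso_at_comp cS mP (gF q) (iso_at_on hfP mfP Uq).
have [k kx] := CP_chart_exists (fP (g (F s))).
have nf : \forall q \near s, iso_at f q.
  by apply: (@filterS _ _ _ setT) => [q _|]; [exact: iso_at_on hf mf I|exact: filterT].
have Hf := iso_curve (j := tt : chart_index (scale_metric c (@FBH R n m mu nu))) a (cS i) is_ I openT nf.
have HH := iso_curve a (cS i) is_ kx (open_CP_chart k) Hnear.
have [B nB] := metric_bounded a kS1 is_.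
pose e : 'rV[C]_(cdim S1) := delta_mx 0 a.
pose z (t : C) := chart_map i s + t *: e.
pose fl := local_expr (N := scale_metric c (@FBH R n m mu nu)) f i tt.
pose Hl := local_expr (fP \o (g \o F)) i k.
have v0 : e *m jacobian fl (z 0) = 0.
  apply: (isometric_curves_velocity0 (g := fun t => fl (z t)) (F := fun t => Hl (z t))
    (g' := fun t => e *m jacobian fl (z t))
    (F' := fun t => e *m jacobian Hl (z t)) mu0 nu1 c0 _ _ nB).
  - apply: filterS Hf => t [ct _ et]; split; first exact: ct.
      exact: set_valP.
    apply: etrans et; rewrite /= -scalemxAr -scalemxAl mxE quad_form.
    rewrite (complex_hessian_potential (@fbh_potential R n m mu nu))//.
    exact: set_valP.
  - apply: filterS HH => t [ct _ et]; split; first exact: ct.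
    apply: etrans et; rewrite /= quad_form.
    by rewrite (complex_hessian_potential (@fs_potential R N)).
have rf : row_free (jacobian fl (chart_map i s)) := immf s I i tt is_ I.
have z0 : z 0 = chart_map i s by rewrite /z scale0r addr0.
rewrite z0 in v0.
have e0 : e = 0 by apply: (row_free_inj rf); rewrite v0 mul0mx.
have := congr1 (fun u : 'rV[C]_(cdim S1) => u 0 a) e0.
by rewrite !mxE !eqxx => /eqP; rewrite oner_eq0.
Qed.

End Geometry.

Local Close Scope classical_set_scope.

Theorem corollary11 (R : realType) (m : nat) (mu : R) (P : hermitian_space R) :
  (1 <= m)%N -> 0 < mu -> projective_kahler P ->
  strongly_not_relative (FBH 1 m mu (- (m.+1%:R)^-1)) P.
Proof.
move=> m1 mu0 kP c c0; apply: FBH_not_relative => //.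
by rewrite ltrN2 invf_lt1 ?ltr0n// ltr1n.
Qed.
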